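(* Let $(M,g)$ be an $n$-dimensional Riemannian manifold of bounded geometry, let $m>0$, $s>n/2$, let $h^\bullet$ be an $m$-massive Fractional Gaussian Field on $M$ of regularity $s$ and put $g^\bullet=e^{2h^\bullet}g$. Put $\theta(x)=\mathbf E[h^\bullet(x)^2]\ge0$ and $\overline g^n=e^{n\theta}g$, $\overline g^1=e^{\theta}g$. Then for every measurable $A\subset M$, $$\mathbf E\big[\mathrm{vol}_{g^\bullet}(A)\big]=\mathrm{vol}_{\overline g^n}(A)\ge\mathrm{vol}_g(A),$$ and for every absolutely continuous curve $\gamma:[0,1]\to M$, $$\mathbf E\big[L_{g^\bullet}(\gamma)\big]=L_{\overline g^1}(\gamma)\ge L_g(\gamma).$$
   Context: $(M,g)$ is a complete connected smooth Riemannian manifold without boundary of dimension $n$, with bounded geometry (injectivity radius bounded away from $0$, all covariant derivatives of the curvature tensor bounded). $\Delta$ is its Laplace–Beltrami operator ($\Delta\le 0$), $A_m=m^2-\frac12\Delta$ on $L^2(\mathrm{vol}_g)$. The $m$-massive Fractional Gaussian Field of regularity $s$, $h^\bullet\sim\mathsf{FGF}^M_{s,m}$, is the centered Gaussian random distribution (random element of the dual of $\mathcal C_c^\infty(M)$) with $\mathbf E\,e^{i\langle u, h^\bullet\rangle}=\exp\big(-\frac12\|A_m^{-s/2}u\|_{L^2}^2\big)$ for $u\in\mathcal C^\infty_c(M)$. For $s>n/2$ it is almost surely given by a continuous function $h^\omega$ on $M$, with which it is identified. For a metric $e^{2f}g$ with $f$ continuous: $\mathrm{vol}_{e^{2f}g}(A)=\int_Ae^{nf}d\mathrm{vol}_g$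 and $L_{e^{2f}g}(\gamma)=\int_0^1e^{f(\gamma_r)}|\dot\gamma_r|_g\,dr$. *)

(* Defs.v *)
Set Warnings "-notation-overridden,-ambiguous-paths,-notation-incompatible-prefix".
From HB Require Import structures.
From mathcomp Require Import all_boot all_order all_algebra.
From mathcomp Require Import all_classical all_reals all_analysis.
From mathcomp Require Import complex.
Set Implicit Arguments. Unset Strict Implicit. Unset Printing Implicit Defensive.
Import Order.TTheory GRing.Theory Num.Theory numFieldNormedType.Exports.
Local Open Scope classical_set_scope.
Local Open Scope ring_scope.

Lemma sigma_finite_product d1 d2 (T1 : measurableType d1)
    (T2 : measurableType d2) (R : realType)
    (m1 : {sigma_finite_measure set T1 -> \bar R})
    (m2 : {sigma_finite_measure set T2 -> \bar R}) :
  sigma_finite setT (m1 \x m2)%E.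
Proof.
have /sigma_finiteP[F [TF ndF Foo]] := sigma_finiteT m1.
have /sigma_finiteP[G [TG ndG Goo]] := sigma_finiteT m2.
exists (fun n => F n `*` G n).
  rewrite -setXTT TF TG predeqE => -[x y]; split.
    move=> [/= [n _ Fnx] [k _ Gky]]; exists (maxn n k) => //; split.
    - by move: x Fnx; exact/subsetPset/ndF/leq_maxl.
    - by move: y Gky; exact/subsetPset/ndG/leq_maxr.
  by move=> [n _ []/= ? ?]; split; exists n.
move=> k; have [? ?] := Foo k; have [? ?] := Goo k.
split; first exact: measurableX.
by rewrite product_measure1E// lte_mul_pinfty// ge0_fin_numE.
Qed.

Section LebesgueTuple.
Context {R : realType}.
Notation RT := (measurableTypeR R).

Definition tcons n (x : RT * n.-tuple RT) : n.+1.-tuple RT :=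
  [tuple of x.1 :: x.2].
Definition tuncons n (t : n.+1.-tuple RT) : RT * n.-tuple RT :=
  (thead t, [tuple of behead t]).

Lemma measurable_tcons n : measurable_fun [set: RT * n.-tuple RT] (@tcons n).
Proof. exact: (measurable_cons measurable_fst measurable_snd). Qed.

Lemma measurable_tuncons n : measurable_fun [set: n.+1.-tuple RT] (@tuncons n).
Proof.
apply: measurable_fun_pair; first exact: measurable_tnth.
exact: measurable_behead.
Qed.

Lemma tconsK n : cancel (@tcons n) (@tuncons n).
Proof.
move=> [x t]; rewrite /tuncons /tcons theadE /=; congr (_, _).
exact: val_inj.
Qed.

Section step.
Variables (n : nat) (mu : {sigma_finite_measure set (n.-tuple RT) -> \bar R}).

(* the product measure dx * dmu, carried to tuples of length n + 1 *)
Definition leb_step : set (n.+1.-tuple RT) -> \bar R :=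
  pushforward ((@lebesgue_measure R) \x mu)%E (@tcons n).


Let leb_step0 : leb_step set0 = 0%E.
Proof. by rewrite /leb_step /pushforward preimage_set0 measure0. Qed.

Let leb_step_ge0 A : (0 <= leb_step A)%E.
Proof. by rewrite /leb_step /pushforward measure_ge0. Qed.

Let leb_step_sigma_additive : semi_sigma_additive leb_step.
Proof.
move=> F mF tF mUF; rewrite /leb_step /pushforward preimage_bigcup.
apply: measure_semi_sigma_additive.
- by move=> k; rewrite -[X in measurable X]setTI; exact: measurable_tcons.
- apply/trivIsetP => i j _ _ ij; rewrite -preimage_setI.
  by move/trivIsetP : tF => /(_ i j Logic.I Logic.I ij) ->; rewrite preimage_set0.
- rewrite -preimage_bigcup -[X in measurable X]setTI.
  exact: measurable_tcons.
Qed.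

HB.instance Definition _ := isMeasure.Build _ _ _ leb_step
  leb_step0 leb_step_ge0 leb_step_sigma_additive.

Let leb_step_sigma_finite : sigma_finite setT leb_step.
Proof.
have [F TF mF] := sigma_finite_product (@lebesgue_measure R) mu.
exists (fun k => (@tuncons n) @^-1` F k).
  by rewrite -preimage_bigcup -TF preimage_setT.
move=> k; have [mFk Fk] := mF k; split.
  by rewrite -[X in measurable X]setTI; exact: measurable_tuncons.
rewrite /leb_step /pushforward -comp_preimage.
by rewrite (_ : _ \o _ = id) ?preimage_id//; apply/funext => x /=; rewrite tconsK.
Qed.

HB.instance Definition _ :=
  Measure_isSigmaFinite.Build _ _ _ leb_step leb_step_sigma_finite.
End step.

(* n-dimensional Lebesgue measure, on tuples because that is where the library
   puts the product sigma-algebra *)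
Fixpoint lebesgue_tuple n : {sigma_finite_measure set (n.-tuple RT) -> \bar R} :=
  match n with
  | 0 => [the {sigma_finite_measure set (0.-tuple RT) -> \bar R} of
            dirac ([tuple] : 0.-tuple RT)]
  | n'.+1 => [the {sigma_finite_measure set (n'.+1.-tuple RT) -> \bar R} of
            leb_step (lebesgue_tuple n')]
  end.
End LebesgueTuple.

Definition row_of_tuple {R : realType} n
  (t : n.-tuple (measurableTypeR R)) : 'rV[R]_n := \row_i tnth t i.

Section Calculus.
Context {R : realType}.

Definition partial n (a : 'I_n) (f : 'rV[R]_n -> R) : 'rV[R]_n -> R :=
  fun x => 'D_(delta_mx 0 a) f x.

Definition iter_partial n (l : seq 'I_n) (f : 'rV[R]_n -> R) :
    'rV[R]_n -> R := foldr (@partial n) f l.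

Definition smooth_on n (U : set 'rV[R]_n) (f : 'rV[R]_n -> R) : Prop :=
  forall (l : seq 'I_n) (x : 'rV[R]_n), U x ->
    {for x, continuous (iter_partial l f)} /\
    forall a : 'I_n, derivable (iter_partial l f) x (delta_mx 0 a).

Definition smooth_map_on n k (U : set 'rV[R]_n) (f : 'rV[R]_n -> 'rV[R]_k) :=
  forall b : 'I_k, smooth_on U (fun x => f x 0 b).

(* row convention: (u *m jacobian_mx f x) is the derivative of f at x along u *)
Definition jacobian_mx n k (f : 'rV[R]_n -> 'rV[R]_k) (x : 'rV[R]_n) :
    'M[R]_(n, k) := \matrix_(a, b) partial a (fun y => f y 0 b) x.

(* Finitely many non-overlapping intervals are listed in increasing order *)
Definition abs_continuous_on n (a b : R) (c : R -> 'rV[R]_n) : Prop :=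
  forall e : R, 0 < e -> exists2 d : R, 0 < d &
    forall (N : nat) (s t : nat -> R),
      (forall k, (k < N)%N -> [/\ a <= s k, s k <= t k & t k <= b]) ->
      (forall k, (k.+1 < N)%N -> t k <= s k.+1) ->
      \sum_(k < N) (t k - s k) < d ->
      \sum_(k < N) `|c (t k) - c (s k)| < e.

End Calculus.

(* The metric is given by its matrices in the charts, as functions of the
   coordinates, subject to the transformation law of a (0,2)-tensor.
   [psi i] is only meaningful on the image of [phi i]. *)
Record riemannian_manifold (R : realType) (n : nat) := RiemannianManifold {
  carrier :> ptopologicalType;
  chart : Type;
  dom : chart -> set carrier;
  phi : chart -> carrier -> 'rV[R]_n;
  psi : chart -> 'rV[R]_n -> carrier;
  chart_at : carrier -> chart;
  metric : chart -> 'rV[R]_n -> 'M[R]_n;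
  rm_hausdorff : hausdorff_space carrier;
  rm_second_countable : @second_countable carrier;
  dom_open : forall i, open (dom i);
  cod_open : forall i, open (phi i @` dom i);
  chart_atP : forall p, dom (chart_at p) p;
  phiK : forall i p, dom i p -> psi i (phi i p) = p;
  phi_continuous : forall i p, dom i p -> {for p, continuous (phi i)};
  psi_continuous : forall i x, (phi i @` dom i) x -> {for x, continuous (psi i)};
  transition_smooth : forall i j,
    smooth_map_on (phi i @` (dom i `&` dom j)) (phi j \o psi i);
  metric_smooth : forall i a b,
    smooth_on (phi i @` dom i) (fun x => metric i x a b);
  metric_sym : forall i x, (phi i @` dom i) x -> (metric i x)^T = metric i x;
  metric_pos : forall i x, (phi i @` dom i) x -> forall v : 'rV[R]_n, v != 0 ->
    0 < (v *m metric i x *m v^T) 0 0;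
  metric_transform : forall i j p, dom i p -> dom j p ->
    let J := jacobian_mx (phi j \o psi i) (phi i p) in
    metric i (phi i p) = J *m metric j (phi j p) *m J^T
}.

Section Riemannian.
Context {R : realType} {n : nat} (M : riemannian_manifold R n).

Definition cod (i : chart M) : set 'rV[R]_n := phi i @` dom i.

Definition borel := g_sigma_algebraType (@open M).

Definition metric_norm (i : chart M) (x v : 'rV[R]_n) : R :=
  Num.sqrt ((v *m metric i x *m v^T) 0 0).

(* |gamma'(r)|_g, with value 0 where gamma is not differentiable *)
Definition speed (gamma : R -> M) (r : R) : R :=
  let i := chart_at (gamma r) in
  let c := phi i \o gamma in
  if `[< derivable c r 1 >] then metric_norm i (c r) (derive1 c r) else 0.

Definition abs_continuous_curve (gamma : R -> M) : Prop :=
  {within `[0, 1], continuous gamma} /\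
  forall (i : chart M) (a b : R), 0 <= a -> b <= 1 ->
    (forall t, a <= t <= b -> dom i (gamma t)) ->
    abs_continuous_on a b (phi i \o gamma).

Definition curve_length (gamma : R -> M) : \bar R :=
  (\int[lebesgue_measure]_(r in `[0%R, 1%R]) (speed gamma r)%:E)%E.

Definition conformal_length (f : M -> R) (gamma : R -> M) : \bar R :=
  (\int[lebesgue_measure]_(r in `[0%R, 1%R])
     (expR (f (gamma r)) * speed gamma r)%:E)%E.

Definition riemannian_distance (p q : M) : \bar R :=
  ereal_inf [set L | exists gamma : R -> M,
    [/\ abs_continuous_curve gamma, gamma 0 = p, gamma 1 = q &
        L = curve_length gamma]].

Definition complete_manifold : Prop :=
  forall p : nat -> M,
    (forall e : R, 0 < e -> exists N, forall j k, (N <= j)%N -> (N <= k)%N ->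
      (riemannian_distance (p j) (p k) < e%:E)%E) ->
    exists q : M, p @ \oo --> q.

Definition imetric (i : chart M) (x : 'rV[R]_n) : 'M[R]_n := invmx (metric i x).

Definition christoffel (i : chart M) (l a b : 'I_n) (x : 'rV[R]_n) : R :=
  2^-1 * \sum_(d < n) imetric i x l d *
    (partial a (fun y => metric i y b d) x
     + partial b (fun y => metric i y a d) x
     - partial d (fun y => metric i y a b) x).

(* The l-th component of R(d_a, d_b) d_k *)
Definition riemann_up (i : chart M) (l k a b : 'I_n) (x : 'rV[R]_n) : R :=
  partial a (christoffel i l b k) x - partial b (christoffel i l a k) x
  + \sum_(p < n) (christoffel i l a p x * christoffel i p b k x
                  - christoffel i l b p x * christoffel i p a k x).

(* Components in one chart of a covariant tensor field; only the values on
   index sequences whose length is the rank of the tensor are meaningful. *)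
Definition tensor := seq 'I_n -> 'rV[R]_n -> R.

Definition curvature_tensor (i : chart M) : tensor := fun I x =>
  if I is [:: l; k; a; b]
  then \sum_(p < n) metric i x l p * riemann_up i p k a b x else 0.

Definition covariant_derivative (i : chart M) (T : tensor) : tensor :=
  fun I x => if I is a :: J then
    partial a (T J) x
    - \sum_(q < size J) \sum_(l < n)
        christoffel i l a (nth a J q) x * T (set_nth a J q l) x
  else 0.

Definition tensor_sqnorm (i : chart M) (k : nat) (T : tensor)
    (x : 'rV[R]_n) : R :=
  \sum_(I : k.-tuple 'I_n) \sum_(J : k.-tuple 'I_n)
    (\prod_(q < k) imetric i x (tnth I q) (tnth J q)) * T I x * T J x.

Definition bounded_curvature_derivatives : Prop :=
  forall k : nat, exists C : R, forall (i : chart M) (x : 'rV[R]_n), cod i x ->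
    tensor_sqnorm i (4 + k)
      (iter k (covariant_derivative i) (curvature_tensor i)) x <= C.

Definition geodesic (gamma : R -> M) : Prop :=
  continuous gamma /\
  forall (i : chart M) (t : R), dom i (gamma t) ->
    let c := phi i \o gamma in
    [/\ derivable c t 1, derivable (derive1 c) t 1 &
      forall l : 'I_n, derive1 (derive1 c) t 0 l
        + \sum_(a < n) \sum_(b < n)
            christoffel i l a b (c t) * derive1 c t 0 a * derive1 c t 0 b = 0].

(* exp_p v = q, where v lists the components of a tangent vector at p in the
   chart [chart_at p] *)
Definition exp_map (p : M) (v : 'rV[R]_n) (q : M) : Prop :=
  exists gamma : R -> M, [/\ geodesic gamma, gamma 0 = p,
    derive1 (phi (chart_at p) \o gamma) 0 = v & gamma 1 = q].

Definition tangent_ball (p : M) (r : R) : set 'rV[R]_n :=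
  [set v | metric_norm (chart_at p) (phi (chart_at p) p) v < r].

(* exp_p is a diffeomorphism from the ball of radius r in T_pM onto an open
   set; [ex] is exp_p and [lg] its inverse *)
Definition exp_diffeo (p : M) (r : R) : Prop :=
  exists (ex : 'rV[R]_n -> M) (lg : M -> 'rV[R]_n),
    let B := tangent_ball p r in let U := ex @` B in
    [/\ forall v, B v -> exp_map p v (ex v) /\ lg (ex v) = v,
        open U,
        forall v, B v -> {for v, continuous ex},
        forall i, smooth_map_on (B `&` ex @^-1` dom i) (phi i \o ex) &
        forall i, smooth_map_on (phi i @` (dom i `&` U)) (lg \o psi i)].

Definition injectivity_radius (p : M) : \bar R :=
  ereal_sup [set r%:E | r in [set r : R | 0 < r /\ exp_diffeo p r]].

Definition bounded_geometry : Prop :=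
  (exists2 rho : R, 0 < rho & forall p : M, (rho%:E <= injectivity_radius p)%E)
  /\ bounded_curvature_derivatives.

Definition sqrt_det (i : chart M) (x : 'rV[R]_n) : R :=
  Num.sqrt (\det (metric i x)).

(* this determines vol, as M is covered by countably many charts *)
Definition is_volume_measure (vol : {measure set borel -> \bar R}) : Prop :=
  forall (i : chart M) (A : set M), measurable (A : set borel) -> A `<=` dom i ->
    vol A = (\int[lebesgue_tuple n]_(t in [set t | (phi i @` A) (row_of_tuple t)])
               (sqrt_det i (row_of_tuple t))%:E)%E.

Definition conformal_volume (vol : {measure set borel -> \bar R})
    (f : M -> R) (A : set M) : \bar R :=
  (\int[vol]_(x in (A : set borel)) (expR (n%:R * f x))%:E)%E.

Definition test_function (u : M -> R) : Prop :=
  (forall i, smooth_on (cod i) (u \o psi i)) /\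
  exists2 K : set M, compact K & forall p, ~ K p -> u p = 0.

(* Convergence to 0 in the Frechet space of the smooth functions supported in a
   fixed compact set; a linear functional is in the dual of C_c^oo iff it is
   sequentially continuous on each of these spaces. *)
Definition test_cvg0 (u : nat -> M -> R) : Prop :=
  (exists2 K : set M, compact K & forall k p, ~ K p -> u k p = 0) /\
  forall (i : chart M) (l : seq 'I_n) (C : set 'rV[R]_n),
    compact C -> C `<=` cod i -> forall e : R, 0 < e ->
    \forall k \near \oo, forall x, C x ->
      `|iter_partial l (u k \o psi i) x| <= e.

Definition distribution (T : (M -> R) -> R) : Prop :=
  (forall (a : R) u v, test_function u -> test_function v ->
     T (fun x => a * u x + v x) = a * T u + T v) /\
  (forall u : nat -> M -> R, (forall k, test_function (u k)) -> test_cvg0 u ->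
     (fun k => T (u k)) @ \oo --> (0 : R)).

(* Delta u = det(g)^(-1/2) d_a (det(g)^(1/2) g^(ab) d_b u) *)
Definition laplace_beltrami (u : M -> R) (p : M) : R :=
  let i := chart_at p in
  (sqrt_det i (phi i p))^-1 * \sum_(a < n)
    partial a (fun y => sqrt_det i y *
      \sum_(b < n) imetric i y a b * partial b (u \o psi i) y) (phi i p).

Section L2.
Variable vol : {measure set borel -> \bar R}.

Definition in_L2 (u : M -> R) : Prop := (u : borel -> R) \in Lfun vol 2%:E.

Definition L2_inner (u v : M -> R) : R :=
  (\int[vol]_(x in (setT : set borel)) (u x * v x))%R.

Definition L2_cvg (u : nat -> M -> R) (v : M -> R) : Prop :=
  ('N[vol]_2%:E [EFin \o (fun x : borel => u k x - v x)%R] @[k --> \oo]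
    --> 0)%E.

Definition ae_equal (u v : M -> R) : Prop :=
  {ae vol, forall x : borel, u x = v x}.

(* Graph of A_m = m^2 - Delta / 2: the closure in L^2 of the operator on
   C_c^oo, which is self-adjoint because M is complete. *)
Definition A_graph (m : R) (u v : M -> R) : Prop :=
  [/\ in_L2 u, in_L2 v &
    exists2 w : nat -> M -> R, (forall k, test_function (w k)) &
      L2_cvg w u /\
      L2_cvg (fun k x => m ^+ 2 * w k x - 2^-1 * laplace_beltrami (w k) x) v].

(* A projection-valued measure E on L^2, with the finite scalar measures
   spm u = <E(.)u, u> *)
Record projection_measure := ProjectionMeasure {
  proj : set R -> (M -> R) -> (M -> R);
  spm : (M -> R) -> {measure set (measurableTypeR R) -> \bar R};
  proj_L2 : forall B u, measurable B -> in_L2 u -> in_L2 (proj B u);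
  proj_linear : forall B (a : R) u v, measurable B -> in_L2 u -> in_L2 v ->
    ae_equal (proj B (fun x => a * u x + v x))
             (fun x => a * proj B u x + proj B v x);
  proj_sym : forall B u v, measurable B -> in_L2 u -> in_L2 v ->
    L2_inner (proj B u) v = L2_inner u (proj B v);
  proj_setI : forall B C u, measurable B -> measurable C -> in_L2 u ->
    ae_equal (proj (B `&` C) u) (proj B (proj C u));
  proj_setT : forall u, in_L2 u -> ae_equal (proj setT u) u;
  spmE : forall u B, measurable B -> in_L2 u ->
    spm u B = (L2_inner (proj B u) u)%:E
}.

Definition spectral_domain (E : projection_measure) (f : R -> R)
    (u : M -> R) : Prop :=
  in_L2 u /\ (\int[spm E u]_x ((f x) ^+ 2)%:E < +oo)%E.

(* v = (\int f dE) u; the integral of f against <E(.)u, w> is written by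
   polarization *)
Definition spectral_integral (E : projection_measure) (f : R -> R)
    (u v : M -> R) : Prop :=
  [/\ spectral_domain E f u, in_L2 v &
    forall w, spectral_domain E f w ->
      L2_inner v w = 4^-1 *
        ((\int[spm E (fun x => u x + w x)%R]_x f x)
         - (\int[spm E (fun x => u x - w x)%R]_x f x))].

Definition spectral_resolution (G : (M -> R) -> (M -> R) -> Prop)
    (E : projection_measure) : Prop :=
  forall u v, G u v <-> spectral_integral E id u v.

(* v = A_m^a u; only the values of x `^ a for x >= m^2 > 0 matter *)
Definition A_power (m a : R) (u v : M -> R) : Prop :=
  exists2 E, spectral_resolution (A_graph m) E &
    spectral_integral E (fun x => x `^ a) u v.

End L2.

End Riemannian.

Section FGF.
Context {R : realType} {n : nat} (M : riemannian_manifold R n)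
  (vol : {measure set (borel M) -> \bar R})
  {d : measure_display} {Omega : measurableType d} (P : probability Omega R).

(* E[exp(i X)], the library having no complex-valued integral *)
Definition expectation_expi (X : Omega -> R) : R[i] :=
  Complex (\int[P]_w cos (X w)) (\int[P]_w sin (X w)).

Definition is_FGF (s m : R) (H : Omega -> (M -> R) -> R) : Prop :=
  [/\ forall w, distribution (H w),
      forall u, test_function u -> measurable_fun setT (fun w => H w u) &
      forall u, test_function u ->
        exists2 v, A_power vol m (- (s / 2)) u v &
          expectation_expi (fun w => H w u)
          = (expR (- (2^-1 * fine ('N[vol]_2%:E [EFin \o (v : borel M -> R)])%E ^+ 2)))%:C%C].

(* almost surely, the distribution H w is the continuous function h w *)
Definition continuous_representative (H : Omega -> (M -> R) -> R)
    (h : Omega -> M -> R) : Prop :=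
  {ae P, forall w, continuous (h w) /\
    forall u, test_function u ->
      H w u = (\int[vol]_(x in (setT : set (borel M))) (u x * h w x))%R}.

End FGF.

(* Main.v *)
Require Import Defs.
Set Warnings "-notation-overridden,-ambiguous-paths,-notation-incompatible-prefix".
From HB Require Import structures.
From mathcomp Require Import all_boot all_order all_algebra.
From mathcomp Require Import all_classical all_reals all_analysis.
From mathcomp Require Import measurable_realfun perm ring lra.
Set Implicit Arguments. Unset Strict Implicit. Unset Printing Implicit Defensive.
Import Order.TTheory GRing.Theory Num.Theory numFieldNormedType.Exports.
Local Open Scope classical_set_scope.
Local Open Scope ring_scope.

(** At a fixed point [x] the value [h(x)] of the field is a centered Gaussian variable
    of variance [theta x], so that [E[e^(a h(x))] = e^(a^2 theta(x) / 2)].  Exchanging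
    expectation and integral by Tonelli turns the expected volume of [A] into
    [\int_A e^(n^2 theta / 2) dvol] and the expected length of a curve into
    [\int e^(theta / 2) |gamma'|].  The inequalities hold because [theta >= 0].

    The Gaussian law of [h(x)] is recovered from that of the random distribution.
    Normalized bumps [u_k] that concentrate at [x] ([dirac_sequence]) satisfy
    [<u_k, h> -> h(x)] by continuity, and a pointwise limit of centered Gaussian variables
    is centered Gaussian ([gaussian_limit]).  For [<u_k, h>] to be Gaussian, its
    characteristic function is needed at every [t], that is, the characteristic
    functional at [t u_k], where it involves the norm of [A_m^(-s/2) (t u_k)].  As the
    power of [A_m] is taken with respect to some spectral resolution, the homogeneity of
    this norm ([A_power_norm_homogeneous]) rests on the uniqueness of spectral
    resolutions ([resolution_unique]).  The latter is proved by the growth of iterates: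
    for [u] in the range of [E([c - r, c + r])] the norms of [(A - c)^k u] grow at most
    like [r^k], whereas any mass of another spectral measure of [u] at distance at least
    [rho > r] from [c] would make them grow like [rho^k].

    From the characteristic function, the exponential moment is obtained by writing a
    damped exponential as a Gaussian superposition of sines and cosines
    ([damped_exp_mean], [gaussian_exp_mean]), and the second moment from
    [x^2 = lim (2 / d^2) (1 - cos (d x))] as [d] tends to 0 ([gaussian_variance]).

    Tonelli asks for joint measurability of the field, which follows from continuity and
    a countable basis ([continuous_jointly_measurable]), and for sigma-finiteness of the
    volume, which follows from the finiteness of the volume of small boxes
    ([volume_box]); the positivity of this volume is what allows the bumps to be
    normalized.  The speed of a curve, defined pointwise through a varying choice of
    charts, is not shown to be measurable: its integral is a supremum over measurable
    minorants, and it may be replaced by an essentially largest minorant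
    ([lower_integralM_minorant]). *)
(** * Integrals of functions that need not be measurable *)

Section LowerIntegral.
Local Open Scope ereal_scope.
Context d (T : measurableType d) (R : realType) (mu : {measure set T -> \bar R}).
Implicit Types (D N : set T) (f g : T -> \bar R).
Import HBNNSimple.

Lemma lower_integral_le D f c : (forall x, D x -> 0 <= f x) ->
  (forall g : T -> R, measurable_fun setT g -> (forall x, (0 <= g x)%R) ->
    (forall x, (g x)%:E <= (f \_ D) x) -> \int[mu]_x (g x)%:E <= c) ->
  \int[mu]_(x in D) f x <= c.
Proof.
move=> f0 H; rewrite ge0_integralE//; apply: ge_ereal_sup => _ [h /= hf <-].
by rewrite -integralT_nnsfun; apply: H.
Qed.

Lemma ge0_le_lower_integral D f g : (forall x, D x -> 0 <= f x) ->
  (forall x, D x -> f x <= g x) ->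
  \int[mu]_(x in D) f x <= \int[mu]_(x in D) g x.
Proof.
move=> f0 fg.
have g0 x : D x -> 0 <= g x by move=> Dx; rewrite (le_trans (f0 _ Dx)) ?fg.
rewrite !ge0_integralE//; apply: ereal_sup_le.
move=> _ [h /= hf <-]; exists h => //= x; apply: (le_trans (hf x)).
by rewrite /patch; case: ifPn => // /set_mem /fg.
Qed.

(** Null sets are invisible to the integral of a nonnegative function even when
    the function is not measurable: they are so for each minorant. *)
Lemma negligible_lower_integral D N f g : measurable N -> mu N = 0 ->
  (forall x, D x -> 0 <= f x) -> (forall x, D x -> 0 <= g x) ->
  (forall x, D x -> ~ N x -> f x = g x) ->
  \int[mu]_(x in D) f x = \int[mu]_(x in D) g x.
Proof.
move=> mN N0; have mNC : measurable (~` N) by exact: measurableC.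
suff le f' g' : (forall x, D x -> 0 <= f' x) -> (forall x, D x -> 0 <= g' x) ->
    (forall x, D x -> ~ N x -> f' x = g' x) ->
    \int[mu]_(x in D) f' x <= \int[mu]_(x in D) g' x.
  move=> f0 g0 fg; apply/eqP; rewrite eq_le !le// => x Dx Nx.
  by rewrite fg.
move=> {}f0 {}g0 fg; apply: lower_integral_le => // h mh h0 hf.
have -> : \int[mu]_x (h x)%:E = \int[mu]_(x in ~` N) (h x)%:E.
  rewrite (@ge0_negligible_integral _ _ _ _ _ N)// ?setTD//.
  - exact/measurable_EFinP.
  - by move=> x _; rewrite lee_fin.
rewrite integral_mkcond [leRHS]integral_mkcond.
apply: ge0_le_lower_integral => x _.
  by rewrite /patch; case: ifPn => // _; rewrite lee_fin.
rewrite /patch; case: ifPn => [/set_mem Nx|_]; last first.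
  by case: ifPn => // /set_mem /g0.
move: (hf x); rewrite /patch; case: ifPn => // /set_mem Dx.
by rewrite fg.
Qed.

End LowerIntegral.

Section MaximalMinorant.
Context d (T : measurableType d) (R : realType) (mu : {measure set T -> \bar R}).

Let phi (y : R) : R := y / (1 + y).

Let phi_ge0 y : 0 <= y -> 0 <= phi y.
Proof. by move=> y0; rewrite divr_ge0// addr_ge0. Qed.

Let phi_le1 y : 0 <= y -> phi y <= 1.
Proof. by move=> y0; rewrite /phi ler_pdivrMr ?ltr_wpDr// mul1r lerDr. Qed.

Let phi_lt y z : 0 <= y -> y < z -> phi y < phi z.
Proof.
move=> y0 yz; have z0 := le_lt_trans y0 yz.
rewrite /phi ltr_pdivrMr ?ltr_pwDl//.
rewrite mulrAC ltr_pdivlMr ?ltr_wpDl// ?addr_gt0//; nra.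
Qed.

Let phi_le y z : 0 <= y -> y <= z -> phi y <= phi z.
Proof.
by move=> y0; rewrite le_eqVlt => /predU1P[->//|/(phi_lt y0)/ltW].
Qed.

Let measurable_phi (D : set T) (g : T -> R) : measurable D -> (forall x, 0 <= g x) ->
  measurable_fun D g -> measurable_fun D (phi \o g).
Proof.
move=> mD g0 mg; rewrite [_ \o _](_ : _ = (fun x => g x * (1 + g x) `^ (-1))).
  apply: measurable_funM => //.
  apply: (measurableT_comp (measurable_powR _)) => //.
  exact: measurable_funD.
by apply/funext => x /=; rewrite /phi powRN powRr1 ?addr_ge0.
Qed.

(** The essential supremum of the measurable minorants of a nonnegative
    function.  The strictly increasing bounded map [phi] turns the search for it
    into the maximization of a bounded integral. *)
Lemma maximal_measurable_minorant (D : set T) (G : T -> R) :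
  measurable D -> (mu D < +oo)%E -> (forall x, D x -> 0 <= G x) ->
  exists Gs : T -> R, [/\ measurable_fun D Gs,
    forall x, D x -> 0 <= Gs x <= G x &
    forall g : T -> R, measurable_fun D g -> (forall x, D x -> 0 <= g x <= G x) ->
      {ae mu, forall x, D x -> g x <= Gs x}].
Proof.
move=> mD Dfin G0.
pose Q := [set g : T -> R | [/\ measurable_fun D g,
  forall x, 0 <= g x & forall x, D x -> g x <= G x]].
pose I (g : T -> R) := (\int[mu]_(x in D) (phi (g x))%:E)%E.
pose S := ereal_sup (I @` Q).
have Q0 : Q (cst 0) by split => //; exact: measurable_cst.
have IleD g : Q g -> (I g <= mu D)%E.
  move=> [_ g0 _]; rewrite -[leRHS]mul1e -integral_cst//.
  by apply: ge0_le_lower_integral => x Dx; rewrite lee_fin ?phi_ge0 ?phi_le1.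
have Sfin : S \is a fin_num.
  rewrite ge0_fin_numE.
    by apply: le_lt_trans Dfin; apply: ge_ereal_sup => _ [g Qg <-]; exact: IleD.
  apply: le_ereal_sup_tmp; exists (I (cst 0)); first by exists (cst 0).
  by apply: integral_ge0 => x _; rewrite lee_fin phi_ge0.
have /choice[g_ gP] : forall k : nat, exists g, Q g /\ (S - (k.+1%:R^-1)%:E <= I g)%E.
  move=> k; have k0 : 0 < k.+1%:R^-1 :> R by rewrite invr_gt0.
  by have [_ [g Qg <-] /ltW ?] := ub_ereal_sup_adherent k0 Sfin; exists g.
have Qmax g h : Q g -> Q h -> Q (fun x => Num.max (g x) (h x)).
  move=> [mg g0 gG] [mh h0 hG]; split => [|x|x Dx].
  - exact: measurable_maxr.
  - by rewrite le_max g0.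
  - by rewrite ge_max gG// hG.
pose M := fix M k x := if k is k'.+1 then Num.max (M k' x) (g_ k' x) else 0.
have QM k : Q (M k).
  elim: k => [|k IH].
    by rewrite (_ : M 0%N = cst 0).
  rewrite (_ : M k.+1 = (fun x => Num.max (M k x) (g_ k x)))//.
  by apply: Qmax => //; case: (gP k).
have ndM x : nondecreasing_seq (M ^~ x).
  by apply/nondecreasing_seqP => k; rewrite /= le_max lexx.
have ubM x : D x -> has_ubound (range (M ^~ x)).
  move=> Dx; exists (G x) => _ [k _ <-].
  by case: (QM k) => _ _; exact.
have cvM x : D x -> cvgn (M ^~ x).
  by move=> Dx; apply: nondecreasing_is_cvgn => //; exact: ubM.
pose Gs := (fun x => limn (M ^~ x)) \_ D.
have GsE x : D x -> Gs x = limn (M ^~ x).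
  by move=> Dx; rewrite /Gs patchE mem_set.
have MGs x k : D x -> M k x <= Gs x.
  move=> Dx; rewrite GsE//; exact: (nondecreasing_cvgn_le (ndM x) (cvM _ Dx)).
have QGs : Q Gs.
  split => [|x|x Dx].
  - apply: (@measurable_realfun.measurable_fun_cvg _ _ _ _ M).
      by move=> k; case: (QM k).
    by move=> x Dx; rewrite GsE//; exact: cvM.
  - have [Dx|nDx] := pselect (D x); last by rewrite /Gs patchE memNset.
    by apply: le_trans (MGs x 0%N Dx); rewrite /=.
  - rewrite GsE//; apply: limr_le; first exact: cvM.
    by apply: nearW => k; case: (QM k) => _ _; exact.
have ISGs : I Gs = S.
  apply/eqP; rewrite eq_le; apply/andP; split.
    by apply: ereal_sup_ubound; exists Gs.
  apply/lee_addgt0Pr => e e0.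
  have [k kP] : exists k : nat, k.+1%:R^-1 < e.
    have [k _ kP] := near_infty_natSinv_lt (PosNum e0).
    by exists k; apply: kP => /=.
  rewrite -leeBlDr//; apply: (@le_trans _ _ (S - (k.+1%:R^-1)%:E)%E).
    by rewrite leeB// lee_fin ltW.
  have [[mg g0 gG] /le_trans] := gP k; apply.
  apply: ge0_le_lower_integral => x Dx; rewrite lee_fin ?phi_ge0//.
  apply: phi_le => //; apply: le_trans (MGs x k.+1 Dx).
  by rewrite /= le_max lexx orbT.
exists Gs; case: (QGs) => mGs Gs0 GsG; split => // [x Dx|g mg gP'].
  by rewrite Gs0 GsG.
pose h x := Num.max (Gs x) ((g \_ D) x).
have Qh : Q h.
  apply: Qmax => //; split => [|x|x Dx].
  - by apply: (eq_measurable_fun g) => // x xD; rewrite patchE xD.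
  - by rewrite patchE; case: ifPn => // /set_mem/gP'/andP[].
  - by rewrite patchE mem_set//; case/andP: (gP' _ Dx).
have [mh h0 hG] := Qh.
have Gsh x : phi (Gs x) <= phi (h x).
  by apply: phi_le => //; rewrite le_max lexx.
have intphi u : Q u -> mu.-integrable D (EFin \o (phi \o u)).
  move=> Qu; have [mu' u0 _] := Qu.
  apply/integrableP; split; first exact/measurable_EFinP/measurable_phi.
  apply: (@le_lt_trans _ _ (I u)); last exact: le_lt_trans (IleD _ Qu) Dfin.
  by apply: ge0_le_lower_integral => // x Dx /=; rewrite ger0_norm ?phi_ge0.
have : (\int[mu]_(x in D) `|(phi (h x) - phi (Gs x))%:E| = 0)%E.
  transitivity (\int[mu]_(x in D) ((phi (h x))%:E - (phi (Gs x))%:E))%E.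
    apply: eq_integral => x _; rewrite -EFinB gee0_abs// lee_fin subr_ge0.
    exact: Gsh.
  rewrite integralB//; [|exact: (intphi h)|exact: (intphi Gs)].
  rewrite -/(I h) -/(I Gs) ISGs; apply/eqP; rewrite eq_le sube_le0 sube_ge0 ?Sfin//.
  rewrite ereal_sup_ubound/=; last by exists h.
  rewrite -ISGs; apply: ge0_le_lower_integral => x Dx; rewrite lee_fin ?Gsh//.
  exact: phi_ge0.
move/ae_eq_integral_abs => /(_ mD); case.
  by apply/measurable_EFinP/measurable_funB; exact: measurable_phi.
move=> N [mN N0 sN]; exists N; split => // x /= xP; apply: sN => /= H.
apply: xP => Dx; have /eqP := H Dx; rewrite eqe subr_eq0 => /eqP E.
rewrite leNgt; apply/negP => lt.
have : phi (Gs x) < phi (h x).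
  by apply: phi_lt => //; rewrite lt_max patchE mem_set// lt orbT.
by rewrite E ltxx.
Qed.

(** A strictly positive measurable factor does not see the difference between a
    nonnegative function and its maximal measurable minorant, as the minorants
    of [F * G] are [F] times those of [G]. *)
Lemma lower_integralM_minorant (D : set T) (G : T -> R) :
  measurable D -> (mu D < +oo)%E -> (forall x, D x -> 0 <= G x) ->
  exists Gs : T -> R, [/\ measurable_fun D Gs, forall x, D x -> 0 <= Gs x &
    forall F : T -> R, measurable_fun D F -> (forall x, D x -> 0 < F x) ->
      (\int[mu]_(x in D) (F x * G x)%:E = \int[mu]_(x in D) (F x * Gs x)%:E)%E].
Proof.
move=> mD Dfin G0.
have [Gs [mGs GsP Gsmax]] := maximal_measurable_minorant mD Dfin G0.
exists Gs; split => // [x /GsP/andP[]//|F mF F0].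
apply/eqP; rewrite eq_le; apply/andP; split; last first.
  apply: ge0_le_lower_integral => x Dx; have /andP[Gs0 GsG] := GsP _ Dx.
    by rewrite lee_fin mulr_ge0// ltW ?F0.
  by rewrite lee_fin ler_wpM2l// ltW ?F0.
apply: lower_integral_le => [x Dx|g mg g0 gFG].
  by rewrite lee_fin mulr_ge0 ?G0// ltW ?F0.
have mgD : measurable_fun D g by exact: measurable_funTS.
have : {ae mu, forall x, D x -> g x * F x `^ (-1) <= Gs x}.
  apply: Gsmax.
    apply: measurable_funM => //.
    exact: (measurableT_comp (measurable_powR _)).
  move=> x Dx; have F0x := F0 _ Dx.
  rewrite powRN powRr1 ?(ltW F0x)// divr_ge0 ?(ltW F0x)//= ler_pdivrMr//.
  by have := gFG x; rewrite patchE mem_set// lee_fin mulrC.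
move=> H; apply: (@le_trans _ _ (\int[mu]_(x in D) (g x)%:E)%E).
  rewrite [leRHS]integral_mkcond; apply: ge0_le_lower_integral => x _.
    by rewrite lee_fin.
  rewrite patchE; case: ifPn => // nD; move: (gFG x).
  by rewrite patchE (negbTE nD).
apply: ae_ge0_le_integral => //.
- by move=> x _; rewrite lee_fin.
- exact/measurable_EFinP.
- move=> x Dx; have /andP[Gs0 GsG] := GsP _ Dx.
  by rewrite lee_fin mulr_ge0// ltW ?F0.
- exact/measurable_EFinP/measurable_funM.
- apply: filterS H => x H Dx; have F0x := F0 _ Dx; move: (H Dx).
  by rewrite powRN powRr1 ?(ltW F0x)// ler_pdivrMr// lee_fin mulrC.
Qed.

End MaximalMinorant.

(** * The Hilbert space of square-integrable functions *)

Section SquareIntegrable.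
Context d (T : measurableType d) (R : realType) (mu : {measure set T -> \bar R}).
Notation L2 := (Lfun mu 2%:E).
Notation ip f g := (\int[mu]_x (f x * g x))%R.
Implicit Types u v w : T -> R.

Lemma Lfun2_measurable u : u \in L2 -> measurable_fun setT u.
Proof. by rewrite inE => /andP[]; rewrite inE. Qed.

Lemma Lfun2_lin (a : R) u v : u \in L2 -> v \in L2 ->
  (fun x => a * u x + v x) \in L2.
Proof.
have p1 : (1 <= 2%:E :> \bar R)%E by rewrite lee_fin ler1n.
by move=> u2 v2; have [_] := Lfun_submod_closed mu p1; apply.
Qed.

Lemma Lfun2_0 : (fun=> 0 : R) \in L2.
Proof.
have p1 : (1 <= 2%:E :> \bar R)%E by rewrite lee_fin ler1n.
by have [] := Lfun_submod_closed mu p1.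
Qed.

Lemma Lfun2Z (a : R) u : u \in L2 -> (fun x => a * u x) \in L2.
Proof.
move=> u2; have := Lfun2_lin a u2 Lfun2_0.
by under eq_fun do rewrite addr0.
Qed.

Lemma Lfun2D u v : u \in L2 -> v \in L2 -> (fun x => u x + v x) \in L2.
Proof.
move=> u2 v2; have := Lfun2_lin 1 u2 v2.
by under eq_fun do rewrite mul1r.
Qed.

Lemma Lfun2B u v : u \in L2 -> v \in L2 -> (fun x => u x - v x) \in L2.
Proof.
move=> u2 v2; have := Lfun2_lin (-1) v2 u2.
by under eq_fun do rewrite mulN1r addrC.
Qed.

Lemma Lfun2_integrableM u v : u \in L2 -> v \in L2 ->
  mu.-integrable setT (fun x => (u x * v x)%:E).
Proof. by move=> u2 v2; exact/Lfun1_integrable/Lfun2_mul_Lfun1. Qed.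

Lemma ipC u v : ip u v = ip v u.
Proof. by under eq_Rintegral do rewrite mulrC. Qed.

Lemma ip_linl (a : R) u v w : u \in L2 -> v \in L2 -> w \in L2 ->
  ip (fun x => a * u x + v x) w = a * ip u w + ip v w.
Proof.
move=> u2 v2 w2; rewrite -RintegralZl//; last exact: Lfun2_integrableM.
rewrite -RintegralD//; last 2 first.
- have := Lfun2_integrableM (Lfun2Z a u2) w2.
  by under eq_fun do rewrite -mulrA.
- exact: Lfun2_integrableM.
by apply: eq_Rintegral => x _; rewrite mulrDl mulrA.
Qed.

Lemma ipDl u v w : u \in L2 -> v \in L2 -> w \in L2 ->
  ip (fun x => u x + v x) w = ip u w + ip v w.
Proof.
move=> u2 v2 w2; have := ip_linl 1 u2 v2 w2; rewrite mul1r => <-.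
by apply: eq_Rintegral => x _; rewrite mul1r.
Qed.

Lemma ipBl u v w : u \in L2 -> v \in L2 -> w \in L2 ->
  ip (fun x => u x - v x) w = ip u w - ip v w.
Proof.
move=> u2 v2 w2; have := ip_linl (-1) v2 u2 w2.
rewrite mulN1r addrC => <-.
by apply: eq_Rintegral => x _; rewrite mulN1r (addrC (- _)).
Qed.

Lemma ipZl (a : R) u w : u \in L2 -> w \in L2 ->
  ip (fun x => a * u x) w = a * ip u w.
Proof.
move=> u2 w2; rewrite -RintegralZl//; last exact: Lfun2_integrableM.
by apply: eq_Rintegral => x _; rewrite mulrA.
Qed.

Lemma ip_ge0 u : 0 <= ip u u.
Proof. by apply: Rintegral_ge0 => x _; rewrite -expr2 sqr_ge0. Qed.

Lemma ip_ae u v w : u \in L2 -> v \in L2 -> w \in L2 ->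
  {ae mu, forall x, u x = v x} -> ip u w = ip v w.
Proof.
move=> u2 v2 w2 uv; congr fine; apply: ae_eq_integral => //.
- exact: measurable_int (Lfun2_integrableM u2 w2).
- exact: measurable_int (Lfun2_integrableM v2 w2).
- by apply: filterS uv => x uv _; rewrite uv.
Qed.

Lemma integral_sqr u : u \in L2 -> (\int[mu]_x (u x ^+ 2)%:E = (ip u u)%:E)%E.
Proof.
move=> u2; rewrite /Rintegral fineK.
  by apply: eq_integral => x _; rewrite expr2.
exact: integrable_fin_num (Lfun2_integrableM u2 u2).
Qed.

Lemma sqr_Lnorm2 u : u \in L2 -> fine ('N[mu]_2%:E [EFin \o u])%E ^+ 2 = ip u u.
Proof.
move=> u2; have ufin : ('N[mu]_2%:E [EFin \o u])%E \is a fin_num.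
  rewrite ge0_fin_numE ?Lnorm_ge0//.
  by move: u2; rewrite inE => /andP[_]; rewrite inE.
apply: EFin_inj; rewrite -integral_sqr// EFin_expe fineK//.
transitivity ('N[mu]_2%:E[EFin \o u] `^ 2)%E.
  by rewrite -[in RHS](fineK ufin) poweR_EFin powR_mulrn ?fine_ge0 ?Lnorm_ge0// EFin_expe fineK.
rewrite powR_Lnorm ?pnatr_eq0//; apply: eq_integral => x _ /=.
by rewrite powR_mulrn// real_normK// num_real.
Qed.

Lemma finite_sqr_Lfun2 u : measurable_fun setT u ->
  (\int[mu]_x (u x ^+ 2)%:E < +oo)%E -> u \in L2.
Proof.
move=> mu' ufin; rewrite inE; apply/andP; split; first by rewrite inE.
rewrite inE/= /finite_norm unlock poweR_lty//; apply: le_lt_trans ufin.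
apply: ge0_le_lower_integral => x _ /=; first by rewrite lee_fin powR_ge0.
by rewrite lee_fin powR_mulrn// real_normK// num_real.
Qed.

(** A form of completeness: an absolutely convergent series converges in L^2,
    and only the weak convergence is recorded.  By Cauchy-Schwarz, the squares
    of the partial sums are dominated by the integrable function
    [\sum_j r^(-2j) d_j^2], up to a constant. *)
Lemma L2_series (d_ : nat -> T -> R) (r c : R) : 0 < r < 1 ->
  (forall k, d_ k \in L2) -> (forall k, ip (d_ k) (d_ k) <= c * (r ^+ 4) ^+ k) ->
  exists2 v, v \in L2 & forall w, w \in L2 ->
    (fun k => \sum_(j < k) ip (d_ j) w) @ \oo --> ip v w.
Proof.
move=> /andP[r0 r1] d2 dc; have c0 : 0 <= c.
  by have := le_trans (ip_ge0 (d_ 0%N)) (dc 0%N); rewrite expr0 mulr1.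
have rN0 : r != 0 by rewrite gt_eqF.
have mdk k : measurable_fun setT (d_ k) by exact: Lfun2_measurable.
pose t k x := (r ^- 2) ^+ k * d_ k x ^+ 2.
have t0 k x : 0 <= t k x by rewrite mulr_ge0 ?sqr_ge0// exprn_ge0// invr_ge0 sqr_ge0.
pose b x := (\sum_(0 <= k <oo) (t k x)%:E)%E.
have b0 x : (0 <= b x)%E by apply: nneseries_ge0 => k _ _; rewrite lee_fin.
have mt k : measurable_fun setT (fun x => (t k x)%:E).
  by apply/measurable_EFinP/measurable_funM => //; exact: measurable_funX.
have mb : measurable_fun setT b.
  apply: (@ge0_emeasurable_sum _ _ _ _ (fun k x => (t k x)%:E) xpredT) => // k x _ _.
  by rewrite lee_fin.
have bint : (\int[mu]_x b x < +oo)%E.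
  rewrite integral_nneseries//; last by move=> k x _; rewrite lee_fin.
  apply: (@le_lt_trans _ _ (\sum_(0 <= k <oo) (c * (r ^+ 2) ^+ k)%:E)%E).
    apply: lee_nneseries => k *; first by apply: integral_ge0 => x _; rewrite lee_fin.
    rewrite /t; under eq_integral do rewrite EFinM.
    rewrite ge0_integralZl//; last 3 first.
    - by apply/measurable_EFinP/measurable_funX.
    - by move=> x _; rewrite lee_fin sqr_ge0.
    - by rewrite lee_fin exprn_ge0// invr_ge0 sqr_ge0.
    rewrite integral_sqr// -EFinM lee_fin.
    apply: (@le_trans _ _ ((r ^- 2) ^+ k * (c * (r ^+ 4) ^+ k))).
      by rewrite ler_wpM2l// exprn_ge0// invr_ge0 sqr_ge0.
    rewrite mulrCA -exprMn (_ : r ^- 2 * r ^+ 4 = r ^+ 2)//.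
    by rewrite mulrC -[4%N]/(2 + 2)%N exprD mulfK// expf_neq0.
  apply: (@le_lt_trans _ _ (c * (1 - r ^+ 2)^-1)%:E); last exact: ltry.
  apply: lime_le.
    by apply: is_cvg_nneseries => k _ _; rewrite lee_fin mulr_ge0// !exprn_ge0// ltW.
  apply: nearW => n; rewrite sumEFin lee_fin.
  by apply: geometric_le_lim => //; rewrite ?exprn_gt0// ger0_norm ?exprn_ge0 ?exprn_ilt1 ?ltW.
have rg : `|r| < 1 by rewrite ger0_norm// ltW.
pose F := [set x | (b x < +oo)%E].
have mF : measurable F.
  by rewrite -[F]setTI; exact: emeasurable_fun_infty_o.
pose s x := Num.sqrt (fine (b x)).
have ds k x : F x -> `|d_ k x| <= s x * r ^+ k.
  move=> Fx; have tb : t k x <= fine (b x).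
    rewrite -lee_fin fineK ?ge0_fin_numE//.
    apply: le_trans (nneseries_lim_ge k.+1 _); last by move=> *; rewrite lee_fin.
    rewrite big_nat_recr//=.
    by rewrite leeDr// sume_ge0// => ? _; rewrite lee_fin.
  have rk : 0 < (r ^+ 2) ^+ k by rewrite !exprn_gt0.
  have rk0 : 0 <= r ^+ k by rewrite exprn_ge0// ltW.
  rewrite -sqrtr_sqr -[r ^+ k]ger0_norm// -sqrtr_sqr.
  rewrite -sqrtrM ?fine_ge0// ler_sqrt ?mulr_ge0 ?sqr_ge0 ?fine_ge0//.
  by rewrite -exprM mulnC exprM -ler_pdivrMr// mulrC -exprVn.
pose S k x := \sum_(j < k) d_ j x.
pose C := (1 - r)^-1.
have C0 : 0 <= C by rewrite invr_ge0 subr_ge0 ltW.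
have SC k x : F x -> `|S k x| <= s x * C.
  move=> Fx; apply: le_trans (ler_norm_sum _ _ _) _.
  apply: (@le_trans _ _ (series (geometric (s x) r) k)).
    by rewrite /series/= big_mkord; apply: ler_sum => j _; exact: ds.
  by apply: geometric_le_lim => //; rewrite sqrtr_ge0.
have cvS x : F x -> cvgn (S ^~ x).
  move=> Fx; have : cvgn (series (d_ ^~ x)).
    apply: normed_cvg; apply: (@series_le_cvg _ _ (geometric (s x) r)).
    - by move=> k /=.
    - by move=> k /=; rewrite mulr_ge0 ?sqrtr_ge0// exprn_ge0// ltW.
    - by move=> k /=; exact: ds.
    - exact: is_cvg_geometric_series.
  rewrite (_ : series _ = S ^~ x)//.
  by apply/funext => k; rewrite /series/= big_mkord.
pose v := (fun x => limn (S ^~ x)) \_ F.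
have mS k : measurable_fun setT (S k) by exact: measurable_sum.
have mv : measurable_fun setT v.
  apply/(measurable_restrictT _ mF).
  apply: (@measurable_realfun.measurable_fun_cvg _ _ _ _ S).
    by move=> k; exact: measurable_funTS.
  by move=> x Fx; exact: cvS.
have vs x : F x -> `|v x| <= s x * C.
  move=> Fx; rewrite /v patchE mem_set//.
  have : (fun k => `|S k x|) @ \oo --> `|limn (S ^~ x)| by apply: cvg_norm; exact: cvS.
  move=> /cvg_lim <-//; apply: limr_le.
    by apply: is_cvg_norm; exact: cvS.
  by apply: nearW => k; exact: SC.
have s2 x : F x -> (s x * C) ^+ 2 = fine (b x) * C ^+ 2.
  by move=> Fx; rewrite exprMn sqr_sqrtr// fine_ge0.
have v2 : v \in L2.
  apply: finite_sqr_Lfun2 => //.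
  apply: (@le_lt_trans _ _ (\int[mu]_x ((C ^+ 2)%:E * b x))%E).
    apply: ge0_le_lower_integral => x _; first by rewrite lee_fin sqr_ge0.
    have [Fx|nFx] := pselect (F x); last first.
      by rewrite /v patchE memNset// expr0n/= mule_ge0// lee_fin sqr_ge0.
    rewrite -[b x]fineK ?ge0_fin_numE// -EFinM lee_fin mulrC -s2//.
    by rewrite -real_normK ?num_real// lerXn2r ?nnegrE//; [exact: le_trans (vs _ Fx)|exact: vs].
  rewrite ge0_integralZl//; last by rewrite lee_fin sqr_ge0.
  by rewrite lte_mul_pinfty// lee_fin sqr_ge0.
exists v => // w w2.
have mw := Lfun2_measurable w2.
have aeF : {ae mu, forall x, F x}.
  have bi : mu.-integrable setT b.
    apply/integrableP; split => //.
    by under eq_integral do rewrite gee0_abs//.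
  have := integrable_ae measurableT bi; apply: filterS => x /(_ Logic.I).
  by rewrite ge0_fin_numE.
pose h x := ((C ^+ 2)%:E * b x + (w x ^+ 2)%:E)%E.
have [] := @dominated_convergence _ _ _ mu setT measurableT
  (fun k x => (S k x * w x)%:E) (fun x => (v x * w x)%:E) h.
- by move=> k; exact/measurable_EFinP/measurable_funM.
- exact/measurable_EFinP/measurable_funM.
- apply: filterS aeF => x Fx _; apply: cvg_EFin; first exact: nearW.
  apply: cvgMr_tmp; rewrite /v patchE mem_set//; exact: cvS.
- apply: integrableD => //.
    apply/integrableP; split; first exact: measurable_funeM.
    under eq_integral do rewrite gee0_abs ?mule_ge0 ?lee_fin ?sqr_ge0//.
    rewrite ge0_integralZl//; last by rewrite lee_fin sqr_ge0.
    by rewrite lte_mul_pinfty// lee_fin sqr_ge0.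
  exact: Lfun2_integrable_sqr.
- apply: filterS aeF => x Fx k _.
  rewrite /h -[b x]fineK ?ge0_fin_numE// -EFinM -EFinD lee_fin.
  rewrite normrM mulrC.
  have := SC k x Fx; rewrite [C ^+ 2 * _]mulrC -s2//.
  have : 0 <= s x * C by rewrite mulr_ge0 ?sqrtr_ge0.
  rewrite -[w x ^+ 2]real_normK ?num_real//.
  move: (s x * C) `|S k x| `|w x| (normr_ge0 (w x)) => q p a a0 q0 pq.
  apply: (@le_trans _ _ (a * q)); first by rewrite ler_wpM2l.
  have := sqr_ge0 (a - q); nra.
move=> vwi _ cv.
have -> : (fun k => \sum_(j < k) ip (d_ j) w) = (fun k => fine (\int[mu]_x (S k x * w x)%:E)%E).
  apply/funext => k; rewrite /S; elim: k => [|k IH].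
    by rewrite big_ord0; under eq_integral do rewrite big_ord0 mul0r; rewrite integral0.
  rewrite big_ord_recr/= IH -/(Rintegral _ _ _) -/(Rintegral _ _ _) -ipDl//; last first.
    by elim: {IH}k => [|k IH];
      [under eq_fun do rewrite big_ord0; exact: Lfun2_0
      |under eq_fun do rewrite big_ord_recr/=; exact: Lfun2D].
  by apply: eq_Rintegral => x _; rewrite big_ord_recr.
apply: fine_cvg; rewrite /Rintegral fineK//.
exact: integrable_fin_num.
Qed.

End SquareIntegrable.

(** * Spectral measures *)

Section FiniteMeasure.
Context d (T : measurableType d) (R : realType) (nu : {measure set T -> \bar R}).
Hypothesis nuT : (nu setT < +oo)%E.

Let nu_fin A : measurable A -> nu A \is a fin_num.
Proof.
move=> mA; rewrite ge0_fin_numE//; apply: le_lt_trans nuT.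
by apply: le_measure => //; rewrite inE.
Qed.

Lemma sqr_integrable (D : set T) (f : T -> R) : measurable D -> measurable_fun D f ->
  (\int[nu]_(x in D) (f x ^+ 2)%:E < +oo)%E -> nu.-integrable D (EFin \o f).
Proof.
move=> mD mf f2; apply/integrableP; split; first exact/measurable_EFinP.
have nuD : (nu D < +oo)%E by rewrite -ge0_fin_numE// nu_fin.
apply: (@le_lt_trans _ _ (\int[nu]_(x in D) (1 + (f x ^+ 2)%:E))%E).
  apply: ge0_le_lower_integral => // x _ /=; rewrite -EFinD lee_fin.
  have := normr_ge0 (f x); rewrite -[f x ^+ 2]real_normK ?num_real//.
  by move: `|f x| => a a0; have := sqr_ge0 (a - 1); nra.
rewrite ge0_integralD//; last 2 first.
- by move=> x _; rewrite lee_fin sqr_ge0.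
- exact/measurable_EFinP/measurable_funX.
by rewrite integral_cst// mul1e lte_add_pinfty.
Qed.

Lemma bounded_integrable (D : set T) (f : T -> R) (b : R) : measurable D ->
  measurable_fun D f -> (forall x, D x -> `|f x| <= b) ->
  nu.-integrable D (EFin \o f).
Proof.
move=> mD mf fb; apply/integrableP; split; first exact/measurable_EFinP.
have nuD : (nu D < +oo)%E by rewrite -ge0_fin_numE// nu_fin.
apply: (@le_lt_trans _ _ (\int[nu]_(x in D) `|b|%:E)%E).
  apply: ge0_le_lower_integral => // x Dx; rewrite lee_fin.
  by rewrite (le_trans (fb _ Dx))// ler_norm.
by rewrite integral_cst// lte_mul_pinfty// lee_fin.
Qed.

Lemma le_Rintegral_cst (D : set T) (f : T -> R) (a : R) : measurable D ->
  nu.-integrable D (EFin \o f) -> (forall x, D x -> a <= f x) ->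
  a * fine (nu D) <= \int[nu]_(x in D) f x.
Proof.
move=> mD fi af; rewrite -Rintegral_cst//; apply: le_Rintegral => //.
by apply: (@bounded_integrable _ _ `|a|) => //; exact: measurable_cst.
Qed.

Lemma ge_Rintegral_cst (D : set T) (f : T -> R) (b : R) : measurable D ->
  nu.-integrable D (EFin \o f) -> (forall x, D x -> f x <= b) ->
  \int[nu]_(x in D) f x <= b * fine (nu D).
Proof.
move=> mD fi fb; rewrite -Rintegral_cst//; apply: le_Rintegral => //.
by apply: (@bounded_integrable _ _ `|b|) => //; exact: measurable_cst.
Qed.

End FiniteMeasure.

Section SpectralMeasure.
Context {R : realType} {n : nat} (M : riemannian_manifold R n).
Context (vol : {measure set (borel M) -> \bar R}).
Implicit Types (E : projection_measure vol) (u v w z : M -> R) (A B C : set R).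
Implicit Types f : R -> R.
Notation ip := (L2_inner vol).
Notation L2 := (in_L2 vol).
Notation proj := Defs.proj.

(** [L2_inner] and [in_L2] only unfold to the notions of the previous part; the
    facts are repeated here in the form that [rewrite] and [apply] recognize. *)
Lemma L2_innerC u v : ip u v = ip v u. Proof. exact: ipC. Qed.

Lemma L2_inner_lin (a : R) u v w : L2 u -> L2 v -> L2 w ->
  ip (fun x => a * u x + v x) w = a * ip u w + ip v w.
Proof. exact: ip_linl. Qed.

Lemma L2_innerB u v w : L2 u -> L2 v -> L2 w ->
  ip (fun x => u x - v x) w = ip u w - ip v w.
Proof. exact: ipBl. Qed.

Lemma L2_innerZ (a : R) u w : L2 u -> L2 w -> ip (fun x => a * u x) w = a * ip u w.
Proof. exact: ipZl. Qed.

Lemma L2_inner_ae u v w : L2 u -> L2 v -> L2 w -> ae_equal vol u v -> ip u w = ip v w.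
Proof. exact: ip_ae. Qed.

Lemma in_L2_lin (a : R) u v : L2 u -> L2 v -> L2 (fun x => a * u x + v x).
Proof. exact: Lfun2_lin. Qed.

Lemma in_L2Z (a : R) u : L2 u -> L2 (fun x => a * u x).
Proof. exact: Lfun2Z. Qed.

Lemma in_L2D u v : L2 u -> L2 v -> L2 (fun x => u x + v x).
Proof. exact: Lfun2D. Qed.

Lemma in_L2B u v : L2 u -> L2 v -> L2 (fun x => u x - v x).
Proof. exact: Lfun2B. Qed.

Lemma in_L2_0 : L2 (fun=> 0). Proof. exact: Lfun2_0. Qed.

(** The measure [<E(.)u, u>] as a real number, equal to [|E(B)u|^2]. *)
Definition mass E u B : R := ip (proj E B u) u.

Lemma spm_mass E u B : measurable B -> L2 u -> spm E u B = (mass E u B)%:E.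
Proof. by move=> mB u2; rewrite spmE. Qed.

Lemma spmT_fin E u : L2 u -> (spm E u setT < +oo)%E.
Proof. by move=> u2; rewrite spm_mass// ltry. Qed.

Lemma mass_ge0 E u B : measurable B -> L2 u -> 0 <= mass E u B.
Proof. by move=> mB u2; rewrite -lee_fin -spm_mass. Qed.

Lemma mass_le E u A B : measurable A -> measurable B -> A `<=` B -> L2 u ->
  mass E u A <= mass E u B.
Proof.
move=> mA mB AB u2; rewrite -lee_fin -!spm_mass//.
by apply: le_measure => //; rewrite inE.
Qed.

Lemma mass_setT E u : L2 u -> mass E u setT = ip u u.
Proof.
by move=> u2; apply: ip_ae => //; [exact: proj_L2|exact: proj_setT].
Qed.

Lemma projI_ip E A B u w : measurable A -> measurable B -> L2 u -> L2 w ->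
  ip (proj E A u) (proj E B w) = ip (proj E (A `&` B) u) w.
Proof.
move=> mA mB u2 w2; rewrite -proj_sym//; last exact: proj_L2.
apply: L2_inner_ae => //; [do 2 apply: proj_L2 => //|apply: proj_L2 => //|].
  exact: measurableI.
by rewrite setIC; have := proj_setI E mB mA u2; apply: filterS => x ->.
Qed.

Lemma mass_proj E A B u : measurable A -> measurable B -> L2 u ->
  mass E (proj E A u) B = mass E u (A `&` B).
Proof.
move=> mA mB u2; rewrite /mass; have pu := proj_L2 E mA u2.
have mBA : measurable (B `&` A) by exact: measurableI.
by rewrite projI_ip// proj_sym// projI_ip// setICA setIid setIC.
Qed.

Lemma mass_sqr E B u : measurable B -> L2 u ->
  ip (proj E B u) (proj E B u) = mass E u B.
Proof. by move=> mB u2; rewrite projI_ip// setIid. Qed.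

Lemma mass_lin E B (a : R) u w : measurable B -> L2 u -> L2 w ->
  mass E (fun x => a * u x + w x) B =
  a ^+ 2 * mass E u B + 2 * a * ip (proj E B u) w + mass E w B.
Proof.
move=> mB u2 w2; rewrite /mass.
have pu := proj_L2 E mB u2; have pw := proj_L2 E mB w2.
have z2 := in_L2_lin a u2 w2.
rewrite (L2_inner_ae _ _ z2 (proj_linear E a mB u2 w2)); last 2 first.
- exact: proj_L2.
- exact: in_L2_lin.
rewrite (L2_inner_lin a pu pw z2) (L2_innerC (proj E B u)) (L2_innerC (proj E B w)) !L2_inner_lin//.
by rewrite -(proj_sym E mB u2 w2) -(proj_sym E mB w2 w2) (L2_innerC u) (L2_innerC w); ring.
Qed.

Lemma massD E B u w : measurable B -> L2 u -> L2 w ->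
  mass E (fun x => u x + w x) B =
  mass E u B + 2 * ip (proj E B u) w + mass E w B.
Proof.
move=> mB u2 w2; have := mass_lin E 1 mB u2 w2.
by under eq_fun do rewrite mul1r; move=> ->; rewrite expr1n !mul1r mulr1.
Qed.

Lemma massB E B u w : measurable B -> L2 u -> L2 w ->
  mass E (fun x => u x - w x) B =
  mass E u B - 2 * ip (proj E B u) w + mass E w B.
Proof.
move=> mB u2 w2; have := mass_lin E (-1) mB w2 u2.
under eq_fun do rewrite mulN1r addrC; move=> ->.
rewrite proj_sym// [ip w _]L2_innerC; ring.
Qed.

Lemma mass0 E B : measurable B -> mass E (fun=> 0) B = 0.
Proof.
move=> mB; rewrite /mass /L2_inner; under eq_Rintegral do rewrite mulr0.
by rewrite /Rintegral integral0.
Qed.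

Lemma massZ E B (a : R) u : measurable B -> L2 u ->
  mass E (fun x => a * u x) B = a ^+ 2 * mass E u B.
Proof.
move=> mB u2; have := mass_lin E a mB u2 in_L2_0.
under eq_fun do rewrite addr0; move=> ->.
rewrite mass0// addr0 /L2_inner; under eq_Rintegral do rewrite mulr0.
by rewrite /Rintegral integral0 mulr0 addr0.
Qed.

(** Cauchy-Schwarz: [a |-> <E(B)(a u + w), a u + w>] is nonnegative, and affine
    when its quadratic coefficient vanishes. *)
Lemma mass_eq0_ip E B u w : measurable B -> L2 u -> L2 w -> mass E u B = 0 ->
  ip (proj E B u) w = 0.
Proof.
move=> mB u2 w2 u0; have a2 : forall a : R, 0 <= 2 * a * ip (proj E B u) w + mass E w B.
  move=> a; have := mass_ge0 E mB (in_L2_lin a u2 w2).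
  by rewrite mass_lin// u0 mulr0 add0r.
apply/eqP/negPn/negP => ipN0; have := a2 (- (1 + mass E w B) / (2 * ip (proj E B u) w)).
suff -> : 2 * (- (1 + mass E w B) / (2 * ip (proj E B u) w)) *
    ip (proj E B u) w = - (1 + mass E w B) by lra.
by field.
Qed.

Lemma polar_mass E B u w : measurable B -> L2 u -> L2 w ->
  ip (proj E B u) w = 4^-1 *
    (mass E (fun x => u x + w x) B - mass E (fun x => u x - w x) B).
Proof. by move=> mB u2 w2; rewrite massD// massB//; field. Qed.

(** [<(\int f dE) u, w>], written by polarization. *)
Definition polar E f u w : R := 4^-1 *
  ((\int[spm E (fun x => u x + w x)%R]_x f x)
   - (\int[spm E (fun x => u x - w x)%R]_x f x)).

Lemma spectral_domain_integrable E f u : measurable_fun setT f ->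
  spectral_domain E f u -> (spm E u).-integrable setT (EFin \o f).
Proof. by move=> mf [u2 fu]; apply: sqr_integrable => //; exact: spmT_fin. Qed.

(** The domain of [\int f dE] only depends on the part of the spectral measure
    that lives where [f] is large. *)
Lemma spectral_domain_local E f u u' C (b : R) : measurable_fun setT f ->
  measurable C -> (forall x, C x -> `|f x| <= b) ->
  spectral_domain E f u -> L2 u' ->
  (forall A, measurable A -> A `<=` ~` C -> mass E u' A = mass E u A) ->
  spectral_domain E f u'.
Proof.
move=> mf mC fb [u2 fu] u'2 uu'; split => //.
have mf2 A : measurable_fun A (fun x => (f x ^+ 2)%:E).
  by apply: measurable_funTS; exact/measurable_EFinP/measurable_funX.
have mCC : measurable (~` C) by exact: measurableC.
have f20 x : (0 <= (f x ^+ 2)%:E)%E by rewrite lee_fin sqr_ge0.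
rewrite -(setUv C) ge0_integral_setU//; [|exact: mf2|exact/disj_setPCl].
rewrite lte_add_pinfty//.
  apply: (@le_lt_trans _ _ (\int[spm E u']_(x in C) (b ^+ 2)%:E)%E).
    apply: ge0_le_lower_integral => // x Cx; rewrite lee_fin.
    have b0 : 0 <= b by exact: le_trans (fb _ Cx).
    by rewrite -real_normK ?num_real// lerXn2r ?nnegrE ?fb.
  by rewrite integral_cst// spm_mass// -EFinM ltry.
rewrite (@eq_measure_integral _ _ _ _ (spm E u)); last first.
  by move=> A mA AC; rewrite !spm_mass// uu'.
apply: le_lt_trans fu; by apply: ge0_subset_integral => //; exact: mf2.
Qed.

Lemma spectral_domain0 E f : spectral_domain E f (fun=> 0).
Proof.
have z2 := in_L2_0; split => //.
rewrite (@eq_measure_integral _ _ _ _ mzero); last first.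
  by move=> A mA _; rewrite spm_mass// mass0.
by rewrite integral_measure_zero.
Qed.

Lemma mass_disjoint E u A C : measurable A -> measurable C -> A `<=` ~` C ->
  L2 u -> mass E (proj E C u) A = 0.
Proof.
move=> mA mC AC u2; rewrite mass_proj//.
rewrite (_ : C `&` A = set0); last by apply/seteqP; split => // x [Cx /AC].
by apply: EFin_inj; rewrite -spm_mass// measure0.
Qed.

Lemma spectral_domain_proj E f C (b : R) z : measurable_fun setT f ->
  measurable C -> (forall x, C x -> `|f x| <= b) -> L2 z ->
  spectral_domain E f (proj E C z).
Proof.
move=> mf mC fb z2; apply: (spectral_domain_local mf mC fb (spectral_domain0 E f)).
  exact: proj_L2.
by move=> A mA AC; rewrite mass_disjoint// mass0.
Qed.

Lemma mass_perturb E u z A C : measurable A -> measurable C -> A `<=` ~` C ->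
  L2 u -> L2 z ->
  mass E (fun x => u x + proj E C z x) A = mass E u A /\
  mass E (fun x => u x - proj E C z x) A = mass E u A.
Proof.
move=> mA mC AC u2 z2; have p2 := proj_L2 E mC z2.
rewrite massD// massB// mass_disjoint//.
suff -> : ip (proj E A u) (proj E C z) = 0 by rewrite mulr0 !addr0 subr0.
rewrite proj_sym// L2_innerC; apply: mass_eq0_ip => //.
exact: mass_disjoint.
Qed.

(** Testing [v = (\int f dE) u] against [E(C) z] only involves [f] on [C]. *)
Lemma spectral_integral_test E f u v z C (b : R) : measurable_fun setT f ->
  spectral_integral E f u v -> measurable C -> (forall x, C x -> `|f x| <= b) ->
  L2 z -> let w := proj E C z in
  ip v w = 4^-1 * ((\int[spm E (fun x => u x + w x)%R]_(x in C) f x)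
   - (\int[spm E (fun x => u x - w x)%R]_(x in C) f x)).
Proof.
move=> mf [uD v2 uv] mC fb z2 w; have [u2 _] := uD.
have w2 : L2 w by exact: proj_L2.
rewrite uv; last exact: spectral_domain_proj fb z2.
congr (_ * _); have mCC : measurable (~` C) by exact: measurableC.
have int_w (u' : M -> R) : L2 u' ->
    (forall A, measurable A -> A `<=` ~` C -> mass E u' A = mass E u A) ->
    \int[spm E u']_x f x =
    \int[spm E u']_(x in C) f x + \int[spm E u]_(x in ~` C) f x.
  move=> u'2 uu'.
  have fi : (spm E u').-integrable setT (EFin \o f).
    apply: spectral_domain_integrable => //.
    exact: spectral_domain_local fb uD u'2 uu'.
  rewrite -(setUv C) Rintegral_setU//; last exact/disj_setPCl.
    congr (_ + _); congr fine; apply: eq_measure_integral => A mA AC.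
    by rewrite !spm_mass// uu'.
  by rewrite setUv.
rewrite !int_w//; [ring|exact: in_L2B| |exact: in_L2D|].
- by move=> A mA AC; have [] := mass_perturb E mA mC AC u2 z2.
- by move=> A mA AC; have [] := mass_perturb E mA mC AC u2 z2.
Qed.

Lemma spm_bounded_integrable E u f C (b : R) : measurable_fun setT f -> measurable C ->
  (forall x, C x -> `|f x| <= b) -> L2 u -> (spm E u).-integrable C (EFin \o f).
Proof.
by move=> mf mC fb u2; exact: (bounded_integrable (spmT_fin E u2) mC (measurable_funTS mf) fb).
Qed.

(** On the set [C] where [|f| <= b], the norm of [E(C) v] is at most [b] times that
    of [E(C) u].  Testing against [l E(C) v] gives a quadratic inequality in [l],
    which is used at its best point [l = 1 / b]. *)
Lemma spectral_integral_upper E f u v C (b : R) : measurable_fun setT f ->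
  spectral_integral E f u v -> measurable C -> 0 <= b ->
  (forall x, C x -> `|f x| <= b) -> mass E v C <= b ^+ 2 * mass E u C.
Proof.
move=> mf uv mC b0 fb; have [[u2 _] v2 _] := uv.
have key (l : R) : l * mass E v C <=
    2^-1 * b * (mass E u C + l ^+ 2 * mass E v C).
  have z2 := in_L2Z l v2; have w2 := proj_L2 E mC z2.
  have := spectral_integral_test mf uv mC fb z2; rewrite /=.
  have -> : ip v (proj E C (fun x => l * v x)) = l * mass E v C.
    by rewrite -proj_sym// L2_innerC L2_innerZ//; [rewrite L2_innerC|exact: proj_L2].
  move=> ->.
  set w := proj _ _ _ in w2 *.
  have D2 := in_L2D u2 w2; have B2 := in_L2B u2 w2.
  have mDB : mass E (fun x => u x + w x) C + mass E (fun x => u x - w x) C =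
      2 * (mass E u C + l ^+ 2 * mass E v C).
    by rewrite massD// massB// mass_proj// setIid massZ//; ring.
  have leD : \int[spm E (fun x => u x + w x)]_(x in C) f x <=
      b * mass E (fun x => u x + w x) C.
    have := @ge_Rintegral_cst _ _ _ _ (spmT_fin E D2) C f b mC.
    rewrite spm_mass//; apply; first exact: spm_bounded_integrable fb D2.
    by move=> x Cx; rewrite (le_trans (ler_norm _)) ?fb.
  have leB : - b * mass E (fun x => u x - w x) C <=
      \int[spm E (fun x => u x - w x)]_(x in C) f x.
    have := @le_Rintegral_cst _ _ _ _ (spmT_fin E B2) C f (- b) mC.
    rewrite spm_mass//; apply; first exact: spm_bounded_integrable fb B2.
    by move=> x Cx; rewrite lerNl (le_trans (ler_norm _))// normrN fb.
  nra.
have [b00|bN0] := eqVneq b 0.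
  by have := key 1; rewrite b00; lra.
have bp : 0 < b by rewrite lt_neqAle eq_sym bN0.
have := key b^-1; rewrite expr2 => H.
have : b * (b^-1 * mass E v C) <=
  b * (2^-1 * b * (mass E u C + b^-1 * b^-1 * mass E v C)) by rewrite ler_pM2l.
rewrite (_ : b * (2^-1 * b * _) = 2^-1 * (b ^+ 2 * mass E u C) + 2^-1 * mass E v C); last by field.
by rewrite mulrA divff// mul1r; lra.
Qed.

(** On the set [C] where [f >= a] or [f <= -a], according to the sign [sg], the norm
    of [E(C) v] is at least [a] times that of [E(C) u].  Testing against [E(C) u]
    bounds [<E(C) u, v>] from below, the spectral measure of [u - E(C) u] being null
    on [C]; expanding the square of [E(C)(v - a sg u)] concludes. *)
Lemma spectral_integral_lower E f u v C (a b sg : R) : measurable_fun setT f ->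
  spectral_integral E f u v -> measurable C -> 0 <= a -> sg ^+ 2 = 1 ->
  (forall x, C x -> `|f x| <= b) -> (forall x, C x -> a <= sg * f x) ->
  a ^+ 2 * mass E u C <= mass E v C.
Proof.
move=> mf uv mC a0 sg1 fb af; have [[u2 _] v2 _] := uv.
have p2 := proj_L2 E mC u2.
have := spectral_integral_test mf uv mC fb u2 => /=.
set w := proj _ _ _ in p2 *.
have D2 := in_L2D u2 p2; have B2 := in_L2B u2 p2.
have pw : ip (proj E C u) w = mass E u C by rewrite mass_sqr.
have mD : mass E (fun x => u x + w x) C = 4 * mass E u C.
  by rewrite massD// mass_proj// setIid pw; ring.
have mB : mass E (fun x => u x - w x) C = 0.
  by rewrite massB// mass_proj// setIid pw; ring.
have := @le_Rintegral_cst _ _ _ _ (spmT_fin E D2) C (fun x => sg * f x) a mC.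
rewrite RintegralZl//; last exact: spm_bounded_integrable fb D2.
rewrite spm_mass//= mD => H1.
have sgf x : C x -> `|sg * f x| <= `|sg| * b by move=> Cx; rewrite normrM ler_wpM2l ?fb.
have msf : measurable_fun setT (fun x => sg * f x) by exact: measurable_funM.
have {}H1 := H1 (spm_bounded_integrable E msf mC sgf D2) af.
have fB : \int[spm E (fun x => u x - w x)]_(x in C) f x = 0.
  have Nfb x : C x -> - b <= f x.
    by move=> Cx; rewrite lerNl (le_trans (ler_norm _))// normrN fb.
  have fb' x : C x -> f x <= b by move=> Cx; rewrite (le_trans (ler_norm _)) ?fb.
  have fi := spm_bounded_integrable E mf mC fb B2.
  have lo := le_Rintegral_cst (spmT_fin E B2) mC fi Nfb.
  have hi := ge_Rintegral_cst (spmT_fin E B2) mC fi fb'.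
  by move: lo hi; rewrite spm_mass//= mB !mulr0 => lo hi; apply/le_anti/andP.
rewrite fB subr0 => H2.
have := mass_ge0 E mC (in_L2_lin (- (a * sg)) u2 v2).
rewrite mass_lin//.
have -> : ip (proj E C u) v = ip v w by rewrite L2_innerC.
rewrite sqrrN exprMn sg1 H2; nra.
Qed.

End SpectralMeasure.

Lemma measurable_superlevel d (T : measurableType d) (R : realType) (f : T -> R)
  (a : R) : measurable_fun setT f -> measurable [set x | a <= f x].
Proof.
move=> mf; rewrite (_ : [set _ | _] = setT `&` f @^-1` `[a, +oo[%classic).
  exact: mf.
by apply/seteqP; split => x /=; rewrite in_itv/= andbT // => -[].
Qed.

Lemma measure_bigcup_eq0 d (T : measurableType d) (R : realType)
  (mu : {measure set T -> \bar R}) (F : nat -> set T) :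
  (forall i, measurable (F i)) -> (forall i, mu (F i) = 0%E) ->
  mu (\bigcup_i F i) = 0%E.
Proof.
move=> mF F0; apply/eqP; rewrite eq_le measure_ge0 andbT.
have := @generalized_Boole_inequality _ _ _ mu F mF (bigcupT_measurable _ mF).
by rewrite eseries0.
Qed.

(** Two finite measures on the line that agree on closed balls are equal.  Balls are
    the sets on which two spectral resolutions can be compared directly. *)
Lemma finite_measure_unique (R : realType)
  (m1 m2 : {measure set (measurableTypeR R) -> \bar R}) :
  (m1 setT < +oo)%E -> (forall c r : R, 0 <= r ->
    m1 [set x | `|x - c| <= r] = m2 [set x | `|x - c| <= r]) ->
  forall A, measurable A -> m1 A = m2 A.
Proof.
move=> m1T H.
pose G := [set A : set (measurableTypeR R) | exists a b : R, A = `[a, b]%classic].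
have GE (a b : R) : m1 `[a, b]%classic = m2 `[a, b]%classic.
  have [ba|ab] := ltP b a; first by rewrite set_itv_ge ?measure0// -leNgt bnd_simp.
  rewrite (_ : `[a, b]%classic = [set x | `|x - (a + b) / 2| <= (b - a) / 2]).
    by apply: H; lra.
  apply/seteqP; split => x /=; rewrite in_itv/= ler_norml.
    by move=> /andP[? ?]; apply/andP; split; lra.
  by move=> /andP[? ?]; apply/andP; split; lra.
apply: (measure_unique G (fun k => `[- k%:R, k%:R]%classic)).
- apply/seteqP; split => A.
    apply: smallest_sub; first exact: smallest_sigma_algebra.
    move=> _ [[a b] _ <-] /=.
    rewrite (_ : `]a, b]%classic = \bigcup_k `[a + k.+1%:R^-1, b]%classic).
      apply: (@bigcupT_measurable _ (g_sigma_algebraType G)) => k.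
      by apply: sub_sigma_algebra; exists (a + k.+1%:R^-1), b.
    apply/seteqP; split => x /=; rewrite in_itv/=.
      move=> /andP[ax xb]; have : 0 < x - a by rewrite subr_gt0.
      move=> xa; have [k _ kP] := near_infty_natSinv_lt (PosNum xa).
      exists k => //=; rewrite in_itv/= xb andbT -lerBrDl ltW//.
      exact: (kP k (leqnn k)).
    move=> [k _] /=; rewrite in_itv/= => /andP[ax ->]; rewrite andbT.
    by apply: lt_le_trans ax; rewrite ltrDl invr_gt0.
  apply: smallest_sub; first exact: smallest_sigma_algebra.
  by move=> _ [a [b ->]]; exact: measurable_itv.
- move=> _ _ [a [b ->]] [a' [b' ->]]; exists (Num.max a a'), (Num.min b b').
  apply/seteqP; split => x /=; rewrite !in_itv/= ge_max le_min.
    by move=> [/andP[-> ->] /andP[-> ->]].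
  by move=> /andP[/andP[-> ->] /andP[-> ->]].
- by move=> i; exists (- i%:R), i%:R.
- apply/seteqP; split => // x _; exists (Num.truncn `|x|).+1 => //=.
  rewrite in_itv/= -ler_norml ltW//.
  by have /andP[] := truncn_itv (normr_ge0 x).
- by move=> _ [a [b ->]].
- move=> k; apply: le_lt_trans m1T; by apply: le_measure => //; rewrite inE.
Qed.

Section SpectralUniqueness.
Context {R : realType} {n : nat} (M : riemannian_manifold R n).
Context (vol : {measure set (borel M) -> \bar R}).
Implicit Types (E : projection_measure vol) (u v w z : M -> R) (A B C : set R).
Implicit Types f g : R -> R.
Notation ip := (L2_inner vol).
Notation L2 := (in_L2 vol).
Notation proj := Defs.proj.
#[local] Hint Extern 0 (in_L2 _ _) => solve [exact: in_L2D|exact: in_L2B] : core.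

Lemma polar_indic E B u w : measurable B -> L2 u -> L2 w ->
  polar E \1_B u w = ip (proj E B u) w.
Proof.
move=> mB u2 w2; rewrite polar_mass// /polar /Rintegral.
by rewrite !integral_indic// !setIT !spm_mass.
Qed.

Lemma polar_lin E (a : R) f g u w :
  (forall z, z = (fun x => u x + w x) \/ z = (fun x => u x - w x) ->
    (spm E z).-integrable setT (EFin \o f) /\
    (spm E z).-integrable setT (EFin \o g)) ->
  polar E (fun x => a * f x + g x) u w = a * polar E f u w + polar E g u w.
Proof.
move=> H; rewrite /polar.
have [[fD gD] [fB gB]] := (H _ (or_introl erefl), H _ (or_intror erefl)).
have I z : (spm E z).-integrable setT (EFin \o f) ->
    (spm E z).-integrable setT (EFin \o g) ->
    \int[spm E z]_x (a * f x + g x) =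
    a * \int[spm E z]_x f x + \int[spm E z]_x g x.
  move=> fi gi; rewrite -RintegralZl// -RintegralD//.
  by have /= := @integrableZl _ _ _ _ _ measurableT a _ fi.
rewrite !I//; ring.
Qed.

Lemma polar_bound E f (b : R) u w : measurable_fun setT f ->
  (forall x, `|f x| <= b) -> L2 u -> L2 w ->
  `|polar E f u w| <= 2^-1 * b * (ip u u + ip w w).
Proof.
move=> mf fb u2 w2; have b0 : 0 <= b by exact: le_trans (fb 0).
have I z : L2 z -> `|\int[spm E z]_x f x| <= b * ip z z.
  move=> z2; rewrite -(mass_setT E z2).
  have fi := spm_bounded_integrable E mf measurableT (fun x _ => fb x) z2.
  have Nfb x : setT x -> - b <= f x.
    by move=> _; rewrite lerNl (le_trans (ler_norm _))// normrN fb.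
  have fb' x : setT x -> f x <= b by move=> _; rewrite (le_trans (ler_norm _)) ?fb.
  have := le_Rintegral_cst (spmT_fin E z2) measurableT fi Nfb.
  have := ge_Rintegral_cst (spmT_fin E z2) measurableT fi fb'.
  by rewrite spm_mass//= ler_norml => -> ; rewrite mulNr => ->.
have := I _ (in_L2D u2 w2); have := I _ (in_L2B u2 w2).
rewrite -!(mass_setT E)// massB// massD//.
rewrite /polar normrM [`|4^-1|]ger0_norm ?invr_ge0//.
move=> HB HD; have := ler_normB (\int[spm E (fun x => u x + w x)]_x f x)
  (\int[spm E (fun x => u x - w x)]_x f x).
lra.
Qed.

(** The bounded operator [\int f dE] exists for [0 <= f <= 1]: the binary digits
    of [f] turn it into the absolutely convergent series
    [\sum_k 2^-(k+1) E(D_k)], with [D_k] the set where digit [k] of [f] is 1. *)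
Lemma bounded_calculus E f u : measurable_fun setT f ->
  (forall x, 0 <= f x <= 1) -> L2 u ->
  exists2 v, L2 v & forall w, L2 w -> ip v w = polar E f u w.
Proof.
move=> mf f01 u2.
pose h k : R := 2^-1 ^+ k.+1.
have h0 k : 0 < h k by rewrite exprn_gt0.
pose res := fix res k x := if k is k'.+1 then
  res k' x - h k' * \1_[set y | h k' <= res k' y] x else f x.
pose D k := [set x | h k <= res k x].
have mres k : measurable_fun setT (res k).
  elim: k => [//|k IH] /=; apply: measurable_funB => //.
  apply: measurable_funM => //; apply: measurable_indic.
  exact: measurable_superlevel.
have mD k : measurable (D k).
  exact: measurable_superlevel.
have res01 k x : 0 <= res k x <= 2^-1 ^+ k.
  elim: k => [|k]; first by rewrite expr0.
  have hh : 2^-1 ^+ k = 2 * h k by rewrite /h exprS; field.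
  rewrite [res k.+1 x]/= indicE; case: (boolP (x \in _)) => [|].
    by rewrite inE /= mulr1 hh -/(h k); lra.
  by rewrite notin_setE /= mulr0 hh -/(h k) => /negP; rewrite -ltNge; lra.
have p2 k : L2 (proj E (D k) u) by exact: proj_L2.
pose d k := fun x => h k * proj E (D k) u x.
pose r : R := Num.sqrt (Num.sqrt 4^-1).
have r4 : r ^+ 4 = 4^-1.
  by rewrite (_ : 4 = 2 * 2)%N// exprM !sqr_sqrtr ?sqrtr_ge0 ?invr_ge0.
have [|||v v2 vd] := @L2_series _ _ _ vol d r (ip u u).
- apply/andP; split; first by rewrite !sqrtr_gt0 invr_gt0.
  rewrite -(@ltr_pXn2r _ 4) ?nnegrE ?sqrtr_ge0// r4 expr1n invf_lt1//; lra.
- by move=> k; exact: in_L2Z.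
- move=> k; rewrite -/(L2_inner vol _ _) /d L2_innerZ//; last exact: in_L2Z.
  rewrite L2_innerC L2_innerZ// mass_sqr// mulrA r4.
  have -> : h k * h k = 4^-1 * 4^-1 ^+ k.
    rewrite -exprMn -exprS; congr (_ ^+ _); lra.
  have m1 := mass_le E (mD k) measurableT (subsetT _) u2.
  rewrite (mass_setT E u2) in m1.
  have m0 := mass_ge0 E (mD k) u2.
  have : 0 <= 4^-1 ^+ k :> R by rewrite exprn_ge0// invr_ge0.
  move: (4^-1 ^+ k) => q q0; nra.
exists v => // w w2.
have step k : polar E f u w = \sum_(j < k) ip (d j) w + polar E (res k) u w.
  elim: k => [|k ->]; first by rewrite big_ord0 add0r.
  rewrite big_ord_recr/= -addrA; congr (_ + _).
  rewrite L2_innerZ// -polar_indic// -polar_lin//.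
    congr (polar E _ u w); apply/funext => x /=; ring.
  move=> z zE; have z2 : L2 z by case: zE => ->.
  split; first by apply: (@spm_bounded_integrable _ _ _ _ E z _ setT (1)) => // x _;
    rewrite indicE; case: (_ \in _); rewrite ?normr1 ?normr0.
  apply: (@spm_bounded_integrable _ _ _ _ E z _ setT (2^-1 ^+ k.+1)) => //.
    exact: (mres k.+1).
  by move=> x _; have /andP[? ?] := res01 k.+1 x; rewrite ger0_norm.
have lim0 : (fun k => \sum_(j < k) ip (d j) w) @ \oo --> polar E f u w.
  apply/cvgrPdist_le => e e0.
  pose c := 2^-1 * (ip u u + ip w w).
  have c0 : 0 <= c by rewrite mulr_ge0 ?addr_ge0 ?ip_ge0// invr_ge0.
  have : geometric c (2^-1) @ \oo --> (0 : R).
    by apply: cvg_geometric; rewrite ger0_norm ?invr_ge0// invf_lt1//; lra.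
  move=> /cvgrPdist_le /(_ _ e0); apply: filterS => k /=.
  rewrite sub0r normrN => H; rewrite (step k) [_ + polar _ _ _ _]addrC addrK.
  apply: le_trans (polar_bound E (b := 2^-1 ^+ k) (mres k) _ u2 w2) _.
    by move=> x; have /andP[? ?] := res01 k x; rewrite ger0_norm.
  by apply: le_trans H; rewrite mulrAC -/c ler_norm.
exact: (cvg_unique _ (vd w w2) lim0).
Qed.

Lemma mass_bigcup_eq0 E u (F : nat -> set R) A : measurable A ->
  (forall i, measurable (F i)) -> A `<=` \bigcup_i F i -> L2 u ->
  (forall i, mass E u (F i) = 0) -> mass E u A = 0.
Proof.
move=> mA mF AF u2 F0; apply: EFin_inj; rewrite -spm_mass//.
have mUF := bigcupT_measurable _ mF.
apply/eqP; rewrite eq_le measure_ge0 andbT.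
have UF0 : spm E u (\bigcup_i F i) = 0%E.
  by apply: measure_bigcup_eq0 => // i; rewrite spm_mass// F0.
by rewrite -[leRHS]UF0; apply: le_measure => //; rewrite inE.
Qed.

Lemma massC E u B : measurable B -> L2 u ->
  mass E u B + mass E u (~` B) = ip u u.
Proof.
move=> mB u2; have mBC : measurable (~` B) by exact: measurableC.
apply: EFin_inj; rewrite EFinD -!spm_mass// -(mass_setT E u2) -spm_mass//.
by rewrite -measureU// ?setUv ?setICr.
Qed.

Lemma proj_compl E B u w : measurable B -> L2 u -> L2 w ->
  ip (proj E B u) w + ip (proj E (~` B) u) w = ip u w.
Proof.
move=> mB u2 w2; have mBC : measurable (~` B) by exact: measurableC.
rewrite !polar_mass// -mulrDr.
have D := massC E mB (in_L2D u2 w2); have B' := massC E mB (in_L2B u2 w2).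
rewrite -(L2_inner_ae (proj_L2 E measurableT u2) u2 w2 (proj_setT E u2)).
rewrite polar_mass// !mass_setT// -D -B'; ring.
Qed.

(** The parallelogram law bounds the spectral measures of [u + w] and [u - w] by
    those of [u] and [w], so that the domain is a linear space. *)
Lemma spectral_domain_combine E f u w z : measurable_fun setT f ->
  spectral_domain E f u -> spectral_domain E f w -> L2 z ->
  (forall B, measurable B -> mass E z B <= 2 * mass E u B + 2 * mass E w B) ->
  spectral_domain E f z.
Proof.
move=> mf [u2 fu] [w2 fw] z2 zuw; split => //.
have mf2 : measurable_fun setT (fun x => (f x ^+ 2)%:E).
  exact/measurable_EFinP/measurable_funX.
have f20 x : (0 <= (f x ^+ 2)%:E)%E by rewrite lee_fin sqr_ge0.
pose k : {nonneg R} := NngNum (ler0n R 2).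
apply: (@le_lt_trans _ _ (\int[measure_add (mscale k (spm E u)) (mscale k (spm E w))]_x (f x ^+ 2)%:E)%E).
  apply: ge0_le_measure_integral => // B mB.
  rewrite -[leRHS]/(measure_add (mscale k (spm E u)) (mscale k (spm E w)) B).
  rewrite measure_addE.
  rewrite -[leRHS]/(2%:E * spm E u B + 2%:E * spm E w B)%E.
  by rewrite !spm_mass// -!EFinM -EFinD lee_fin zuw.
rewrite ge0_integral_measure_add// !ge0_integral_mscale//.
by rewrite lte_add_pinfty// lte_mul_pinfty// ?lee_fin.
Qed.

Lemma spectral_domainD E f u w : measurable_fun setT f ->
  spectral_domain E f u -> spectral_domain E f w ->
  spectral_domain E f (fun x => u x + w x) /\
  spectral_domain E f (fun x => u x - w x).
Proof.
move=> mf uD wD; have [[u2 _] [w2 _]] := (uD, wD).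
split; apply: (spectral_domain_combine mf uD wD) => // B mB.
- by have := mass_ge0 E mB (in_L2B u2 w2); rewrite massB// massD//; lra.
- by have := mass_ge0 E mB (in_L2D u2 w2); rewrite massB// massD//; lra.
Qed.

Lemma spectral_domain_addc E f (c : R) u : measurable_fun setT f ->
  spectral_domain E f u -> spectral_domain E (fun x => c + f x) u.
Proof.
move=> mf [u2 fu]; split => //.
have mf2 : measurable_fun setT (fun x => (f x ^+ 2)%:E).
  exact/measurable_EFinP/measurable_funX.
apply: (@le_lt_trans _ _ (\int[spm E u]_x ((2 * c ^+ 2)%:E + 2%:E * (f x ^+ 2)%:E))%E).
  apply: ge0_le_lower_integral => x _; first by rewrite lee_fin sqr_ge0.
  rewrite -EFinM -EFinD lee_fin; have := sqr_ge0 (c - f x); nra.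
have f20 x : (0 <= (f x ^+ 2)%:E)%E by rewrite lee_fin sqr_ge0.
rewrite ge0_integralD//; last 3 first.
- by move=> x _; rewrite lee_fin mulr_ge0// sqr_ge0.
- by move=> x _; rewrite mule_ge0// lee_fin.
- exact: measurable_funeM.
rewrite integral_cst// ge0_integralZl//.
have c20 : (0 <= (2 * c ^+ 2)%:E)%E by rewrite lee_fin mulr_ge0// sqr_ge0.
by rewrite lte_add_pinfty// lte_mul_pinfty//; exact: spmT_fin.
Qed.

Lemma spectral_integral_addc E f (c : R) u v : measurable_fun setT f ->
  spectral_integral E f u v ->
  spectral_integral E (fun x => c + f x) u (fun p => c * u p + v p).
Proof.
move=> mf [uD v2 uv]; have [u2 _] := uD.
split; [exact: spectral_domain_addc|exact: in_L2_lin|move=> w wD].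
have wD' : spectral_domain E f w.
  have := @spectral_domain_addc E (fun x => c + f x) (- c) w _ wD.
  rewrite (_ : (fun x => - c + (c + f x)) = f); last first.
    by apply/funext => x; rewrite addKr.
  by apply; exact: measurable_funD.
have [w2 _] := wD.
rewrite L2_inner_lin// uv// -/(polar E f u w) -/(polar E (fun x => c + f x) u w).
have -> : (fun x => c + f x) = (fun x => c * cst 1 x + f x).
  by apply/funext => x; rewrite mulr1.
rewrite polar_lin.
  congr (c * _ + _); rewrite /polar !Rintegral_cst// !mul1r !spm_mass//=.
  by rewrite -polar_mass//; apply: L2_inner_ae => //; [exact: proj_L2|have := proj_setT E u2; apply: filterS => x ->].
move=> z zE; have z2 : L2 z by case: zE => ->.
split; first by apply: (@spm_bounded_integrable _ _ _ _ E z _ setT 1) => // x _; rewrite normr1.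
apply: spectral_domain_integrable => //.
by have [? ?] := spectral_domainD mf uD wD'; case: zE => ->.
Qed.

Let ball_set (c r : R) : set R := [set x | `|x - c| <= r].

Let measurable_ball_set c r : measurable (ball_set c r).
Proof.
rewrite (_ : ball_set c r = `[c - r, c + r]%classic); first exact: measurable_itv.
apply/seteqP; split => x /=; rewrite /ball_set in_itv/= ler_norml.
  by move=> /andP[? ?]; apply/andP; split; lra.
by move=> /andP[? ?]; apply/andP; split; lra.
Qed.

(** [A - c] is defined on the range of [E([c - r, c + r])], being there the
    bounded operator [2r (\int f dE) - r] with [f(x) = (x - c + r) / 2r]. *)
Lemma spectral_integral_local E (c r : R) u : L2 u -> 0 <= r ->
  mass E u (~` ball_set c r) = 0 ->
  exists v, spectral_integral E (fun x => x - c) u v.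
Proof.
move=> u2 r0 u0; set B := ball_set c r in u0.
have mB : measurable B by exact: measurable_ball_set.
have mBC : measurable (~` B) by exact: measurableC.
have mid : measurable_fun setT (fun x : R => x - c) by exact: measurable_funB.
pose f x := ((x - c + r) / (2 * r)) * \1_B x.
have mf : measurable_fun setT f.
  apply: measurable_funM; last exact: measurable_indic.
  by apply: measurable_funM => //; exact: measurable_funD.
have f01 x : 0 <= f x <= 1.
  rewrite /f indicE; case: (boolP (x \in B)) => [|_]; last by rewrite mulr0 lexx ler01.
  rewrite inE /B /ball_set /= ler_norml mulr1 => /andP[x1 x2].
  have [->|rN0] := eqVneq r 0; first by rewrite mulr0 invr0 mulr0 lexx ler01.
  have rp : 0 < 2 * r by rewrite mulr_gt0// lt_neqAle eq_sym rN0.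
  by rewrite divr_ge0 ?ler_pdivrMr//; lra.
have [v0 v02 v0P] := bounded_calculus E mf f01 u2.
have uD : spectral_domain E (fun x => x - c) u.
  apply: (spectral_domain_local mid mB (b := r) _ (spectral_domain0 E _) u2) => //.
  move=> A mA AB; rewrite mass0//; apply/le_anti; rewrite mass_ge0// andbT -u0.
  exact: mass_le.
exists (fun p => 2 * r * v0 p + (- r) * u p).
have ru2 : L2 (fun p => - r * u p) by exact: in_L2Z.
split => //; first exact: in_L2_lin.
move=> w wD; have [w2 _] := wD.
rewrite -/(polar E (fun x => x - c) u w) L2_inner_lin// v0P// L2_innerZ//.
have [pD mD] := spectral_domainD mid uD wD.
have -> : ip u w = polar E (cst 1) u w.
  rewrite /polar !Rintegral_cst// !mul1r !spm_mass//=.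
  rewrite -polar_mass//; apply: L2_inner_ae => //; first exact: proj_L2.
  by have := proj_setT E u2; apply: filterS => x ->.
have fi z : L2 z -> (spm E z).-integrable setT (EFin \o f).
  move=> z2; apply: (@spm_bounded_integrable _ _ _ _ E z _ setT 1) => // x _.
  by have /andP[? ?] := f01 x; rewrite ger0_norm.
have ci (a : R) z : L2 z -> (spm E z).-integrable setT (EFin \o cst a).
  move=> z2; exact: (@spm_bounded_integrable _ _ _ _ E z _ setT `|a|).
have -> : - r * polar E (cst 1) u w = polar E (cst (- r)) u w.
  rewrite /polar !Rintegral_cst// !mul1r; ring.
rewrite -polar_lin; last first.
  by move=> z zE; have z2 : L2 z by [case: zE => ->]; split; [exact: fi|exact: ci].
set g := (fun x => _ + cst _ _).
have mg : measurable_fun setT g by apply: measurable_funD => //; exact: measurable_funM.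
have gi z : L2 z -> (spm E z).-integrable setT (EFin \o g).
  move=> z2; apply: (@spm_bounded_integrable _ _ _ _ E z _ setT (3 * r)) => // x _.
  rewrite /g /= ler_norml; have /andP[] := f01 x; nra.
(* the measures of u + w and u - w coincide off B, where u has no mass *)
have out A : measurable A -> A `<=` ~` B ->
    spm E (fun x => u x + w x) A = spm E (fun x => u x - w x) A.
  move=> mA AB; rewrite !spm_mass// massB// massD//.
  have uA : mass E u A = 0.
    by apply/le_anti; rewrite mass_ge0// andbT -u0; exact: mass_le.
  by rewrite mass_eq0_ip// mulr0 subr0 addr0.
have split_int k z : (spm E z).-integrable setT (EFin \o k) ->
    \int[spm E z]_x k x =
    \int[spm E z]_(x in B) k x + \int[spm E z]_(x in ~` B) k x.
  move=> ki; rewrite -[setT in LHS](setUv B) Rintegral_setU//.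
    by rewrite setUv.
  exact/disj_setPCl.
have idi z : spectral_domain E (fun x => x - c) z ->
  (spm E z).-integrable setT (EFin \o (fun x => x - c)).
  exact: spectral_domain_integrable.
rewrite /polar !(split_int g)//; try exact: gi.
rewrite !(split_int (fun x => x - c)); try exact: idi.
have outR k : \int[spm E (fun x => u x + w x)]_(x in ~` B) k x =
    \int[spm E (fun x => u x - w x)]_(x in ~` B) k x.
  by congr fine; exact: eq_measure_integral.
have inR z : \int[spm E z]_(x in B) g x = \int[spm E z]_(x in B) (x - c).
  apply: eq_Rintegral => x xB; rewrite /g /f indicE xB mulr1/=.
  have [r00|rN0] := eqVneq r 0; last by field.
  move: xB; rewrite inE /B /ball_set/= r00 normr_le0 => /eqP ->.
  by rewrite mulr0 mul0r oppr0 addr0.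
by rewrite !outR !inR; ring.
Qed.

(** If [u] lies in the range of [E([c - r, c + r])], then the iterates of [A - c]
    on [u] exist and grow at most like [r^k]; on the part of [u] where [E'] lives
    at distance at least [rho > r] from [c] they grow at least like [rho^k]. *)
Lemma resolution_mass_out E E' G (c r rho b sg : R) u :
  spectral_resolution G E -> spectral_resolution G E' ->
  0 <= r -> r < rho -> sg ^+ 2 = 1 -> L2 u -> mass E u (~` ball_set c r) = 0 ->
  mass E' u [set x | rho <= sg * (x - c) /\ `|x - c| <= b] = 0.
Proof.
move=> EG E'G r0 rrho sg1; set C := [set x | _ /\ _].
have mid (a : R) : measurable_fun setT (fun x : R => x - a) by exact: measurable_funB.
have mC : measurable C.
  apply: measurableI; last exact: measurable_ball_set.
  by apply: measurable_superlevel; exact: measurable_funM.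
set B := ball_set c r; have mB : measurable B by exact: measurable_ball_set.
have mBC : measurable (~` B) by exact: measurableC.
have rho0 : 0 < rho by exact: le_lt_trans rrho.
have idE : (fun x : R => c + (x - c)) = id by apply/funext => x /=; ring.
have step u' : L2 u' -> mass E u' (~` B) = 0 -> exists v,
    [/\ L2 v, mass E v (~` B) = 0, ip v v <= r ^+ 2 * ip u' u' &
        rho ^+ 2 * mass E' u' C <= mass E' v C].
  move: u' => {}u u2 u0; have [v uv] := spectral_integral_local u2 r0 u0.
  have [_ v2 _] := uv.
  have uv' : spectral_integral E' (fun x => x - c) u v.
    have := spectral_integral_addc c (mid c) uv; rewrite idE => /EG/E'G.
    move=> /(spectral_integral_addc (- c)) => /(_ (@measurable_id _ _ setT)).
    have -> : (fun x => - c + id x) = (fun x => x - c).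
      by apply/funext => x /=; rewrite addrC.
    suff -> : (fun p => - c * u p + (c * u p + v p)) = v by [].
    by apply/funext => p; ring.
  have v0 : mass E v (~` B) = 0.
    apply: (mass_bigcup_eq0 (F := fun k => ~` B `&` ball_set c k%:R)) => //.
    - by move=> k; apply: measurableI.
    - move=> x Bx; exists (Num.truncn `|x - c|).+1 => //; split => //.
      by rewrite /ball_set /= ltW//; have /andP[] := truncn_itv (normr_ge0 (x - c)).
    - move=> k; have mk : measurable (~` B `&` ball_set c k%:R) by exact: measurableI.
      have := @spectral_integral_upper _ _ _ _ E _ _ _ (~` B `&` ball_set c k%:R) k%:R (mid c) uv mk (ler0n _ _).
      have -> : mass E u (~` B `&` ball_set c k%:R) = 0.
        by apply/le_anti; rewrite mass_ge0// andbT -u0; apply: mass_le.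
      rewrite mulr0 => H; apply/le_anti; rewrite mass_ge0// andbT H//.
      by move=> x [].
  exists v; split => //.
    rewrite -(massC E mB v2) -(massC E mB u2) v0 u0 !addr0.
    exact: spectral_integral_upper uv mB r0 (fun _ => id).
  apply: (@spectral_integral_lower _ _ _ _ E' _ _ _ _ rho b sg (mid c) uv') => //.
  - exact: ltW.
  - by move=> x [].
  - by move=> x [].
have main k : forall u, L2 u -> mass E u (~` B) = 0 ->
    (rho ^+ 2) ^+ k * mass E' u C <= (r ^+ 2) ^+ k * ip u u.
  elim: k => [|k IH] {}u u2 u0.
    rewrite !expr0 !mul1r -(mass_setT E' u2); exact: mass_le.
  have [v [v2 v0 vu vC]] := step u u2 u0.
  have H := IH v v2 v0; rewrite ![(_ ^+ 2) ^+ k.+1]exprSr.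
  have rk : 0 <= (rho ^+ 2) ^+ k by rewrite !exprn_ge0// ltW.
  have rk' : 0 <= (r ^+ 2) ^+ k by rewrite !exprn_ge0.
  apply: (@le_trans _ _ ((rho ^+ 2) ^+ k * mass E' v C)).
    by rewrite -mulrA ler_wpM2l.
  by apply: le_trans H _; rewrite -mulrA ler_wpM2l.
move=> u2 u0; apply/le_anti; rewrite mass_ge0// andbT.
pose q := (r / rho) ^+ 2.
have q01 : `|q| < 1.
  rewrite ger0_norm ?sqr_ge0// exprn_ilt1// ?divr_ge0 ?(ltW rho0)//.
  by rewrite ltr_pdivrMr// mul1r.
have lim0 : geometric (ip u u) q @ \oo --> (0 : R) by exact: cvg_geometric.
rewrite -(cvg_lim _ lim0)//; apply: limr_ge; first by apply/cvg_ex; exists 0.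
apply: nearW => k /=; have := main k u u2 u0.
rewrite /q expr_div_n expr_div_n mulrA ler_pdivlMr ?exprn_gt0//.
by rewrite mulrC [ip u u * _]mulrC.
Qed.

(** A vector in the range of the one spectral projection of a ball is in the range of
    the other: the complement of the ball is a countable union of the sets of
    [resolution_mass_out], the even indices covering its right half and the odd ones
    its left half. *)
Lemma resolution_range E E' G (c r : R) u :
  spectral_resolution G E -> spectral_resolution G E' -> 0 <= r ->
  L2 u -> mass E u (~` ball_set c r) = 0 -> mass E' u (~` ball_set c r) = 0.
Proof.
move=> EG E'G r0 u2 u0.
have mB : measurable (ball_set c r) by exact: measurable_ball_set.
pose C (sg : R) k := [set x | r + k.+1%:R^-1 <= sg * (x - c) /\ `|x - c| <= k%:R].
have mC sg k : measurable (C sg k).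
  apply: measurableI; last exact: measurable_ball_set.
  apply: measurable_superlevel; apply: measurable_funM => //; exact: measurable_funB.
have C0 sg k : sg ^+ 2 = 1 -> mass E' u (C sg k) = 0.
  move=> sg1; have rlt : r < r + k.+1%:R^-1 by rewrite ltrDl invr_gt0.
  exact: (resolution_mass_out k%:R EG E'G r0 rlt sg1 u2 u0).
apply: (mass_bigcup_eq0 (F := fun k => C ((-1) ^+ k) k./2)) => //.
- exact: measurableC.
- move=> x /negP; rewrite -ltNge -subr_gt0 => xr.
  have [k1 _ k1P] := near_infty_natSinv_lt (PosNum xr).
  pose k2 := (Num.truncn `|x - c|).+1; pose k := maxn k1 k2.
  have xk : r + k.+1%:R^-1 <= `|x - c|.
    rewrite -lerBrDl ltW//; exact: (k1P k (leq_maxl _ _)).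
  have xk2 : `|x - c| <= k%:R.
    apply: (@le_trans _ _ k2%:R); last by rewrite ler_nat leq_maxr.
    by rewrite ltW//; have /andP[] := truncn_itv (normr_ge0 (x - c)).
  have [x0|x0] := leP 0 (x - c).
    exists k.*2 => //; rewrite doubleK -signr_odd odd_double.
    by split => //; rewrite mul1r; rewrite ger0_norm in xk.
  exists k.*2.+1 => //; rewrite -signr_odd /= odd_double uphalf_double.
  by split => //; rewrite mulN1r; rewrite ltr0_norm in xk.
- by move=> k; apply: C0; rewrite sqrr_sign.
Qed.

(** Each of the two projections of a ball fixes the range of the other; as both are
    symmetric, they coincide. *)
Lemma resolution_mass_ball E E' G (c r : R) u :
  spectral_resolution G E -> spectral_resolution G E' -> 0 <= r ->
  L2 u -> mass E u (ball_set c r) = mass E' u (ball_set c r).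
Proof.
move=> EG E'G r0 u2; set B := ball_set c r.
have mB : measurable B by exact: measurable_ball_set.
have mBC : measurable (~` B) by exact: measurableC.
have inv (F F' : projection_measure vol) : spectral_resolution G F -> spectral_resolution G F' ->
    forall w, L2 w -> ip (proj F' B (proj F B u)) w = ip (proj F B u) w.
  move=> FG F'G w w2; have p2 := proj_L2 F mB u2.
  have p0 : mass F' (proj F B u) (~` B) = 0.
    by apply: (resolution_range FG F'G) => //; exact: mass_disjoint.
  by rewrite -[RHS](proj_compl F' mB p2 w2) (mass_eq0_ip _ _ _ p0)// addr0.
have p2 := proj_L2 E mB u2; have p2' := proj_L2 E' mB u2.
rewrite /mass -(inv E' E E'G EG u u2) -(inv E E' EG E'G u u2).
by rewrite proj_sym// [RHS]proj_sym// L2_innerC.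
Qed.

(** A self-adjoint operator has only one spectral resolution. *)
Lemma resolution_unique E E' G u B :
  spectral_resolution G E -> spectral_resolution G E' ->
  measurable B -> L2 u -> spm E u B = spm E' u B.
Proof.
move=> EG E'G mB u2; apply: finite_measure_unique => //; first exact: spmT_fin.
move=> c r r0; have mb := measurable_ball_set c r.
by rewrite !spm_mass//; congr (_%:E); exact: resolution_mass_ball r0 u2.
Qed.

Lemma spectral_integral_transfer E E' G f u v :
  spectral_resolution G E -> spectral_resolution G E' ->
  spectral_integral E f u v -> spectral_integral E' f u v.
Proof.
move=> EG E'G; have spmI z : L2 z -> forall k : R -> \bar R,
    (\int[spm E z]_x k x = \int[spm E' z]_x k x)%E.
  by move=> z2 k; apply: eq_measure_integral => A mA _; exact: resolution_unique.
move=> [[u2 fu] v2 uv]; split => //; first by split => //; rewrite -spmI.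
move=> w [w2 fw]; rewrite uv; last by split => //; rewrite spmI.
by rewrite /Rintegral !spmI.
Qed.

(** The weak definition of [\int f dE] determines it: by [spectral_integral_test], two
    candidates agree after projection to each of the sets [|f| <= k]. *)
Lemma spectral_integral_norm_unique E f u v v' : measurable_fun setT f ->
  spectral_integral E f u v -> spectral_integral E f u v' -> ip v v = ip v' v'.
Proof.
move=> mf uv uv'; have [[u2 _] v2 _] := uv; have [_ v'2 _] := uv'.
pose e p := v p - v' p; have e2 : L2 e by exact: in_L2B.
pose B k := [set x | `|f x| <= k%:R].
have mB (k : nat) : measurable (B k).
  rewrite (_ : B k = [set x | - k%:R <= - `|f x|]).
    apply: measurable_superlevel; apply: measurableT_comp => //.
    exact: measurableT_comp.
  by apply/seteqP; split => x /=; rewrite lerN2.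
have e0 : ip e e = 0.
  rewrite -(mass_setT E e2); apply: (mass_bigcup_eq0 (F := B)) => //.
    move=> x _; exists (Num.truncn `|f x|).+1 => //.
    by rewrite /B /= ltW//; have /andP[] := truncn_itv (normr_ge0 (f x)).
  move=> k; have test w : spectral_integral E f u w ->
      ip w (proj E (B k) e) = _ :=
    fun uw => spectral_integral_test mf uw (mB k) (fun x Bx => Bx) e2.
  have p2 := proj_L2 E (mB k) e2.
  by rewrite /mass proj_sym// L2_innerB// !test// subrr.
have ew w : L2 w -> ip v w = ip v' w.
  move=> w2; apply/eqP; rewrite -subr_eq0 -L2_innerB//; apply/eqP.
  rewrite -(L2_inner_ae (proj_L2 E measurableT e2) e2 w2 (proj_setT E e2)).
  by apply: mass_eq0_ip => //; rewrite mass_setT.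
by rewrite ew// L2_innerC ew.
Qed.

Lemma spectral_integralZ E f (t : R) u v : measurable_fun setT f -> t != 0 ->
  spectral_integral E f u v ->
  spectral_integral E f (fun p => t * u p) (fun p => t * v p).
Proof.
move=> mf t0 [[u2 fu] v2 uv].
have spmZ (a : R) z (a0 : 0 <= a ^+ 2) : L2 z -> forall k : R -> \bar R,
    (\int[spm E (fun p => a * z p)%R]_x k x =
     \int[mscale (NngNum a0) (spm E z)]_x k x)%E.
  move=> z2 k; apply: eq_measure_integral => A mA _.
  rewrite -[RHS]/((a ^+ 2)%:E * spm E z A)%E !spm_mass//; last exact: in_L2Z.
  by rewrite massZ.
have domZ (a : R) z : spectral_domain E f z -> spectral_domain E f (fun p => a * z p).
  move=> [z2 fz]; split; first exact: in_L2Z.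
  rewrite (spmZ _ _ (sqr_ge0 a))// ge0_integral_mscale//.
  - by rewrite lte_mul_pinfty// lee_fin sqr_ge0.
  - exact/measurable_EFinP/measurable_funX.
  - by move=> x _; rewrite lee_fin sqr_ge0.
split; [exact: domZ|exact: in_L2Z|move=> w wD].
have [w2 _] := wD; have wD' := domZ t^-1 _ wD.
have [wt2 _] := wD'; have [D' B'] := spectral_domainD mf (conj u2 fu) wD'.
have intZ z : spectral_domain E f z ->
    \int[spm E (fun p => t * z p)]_x f x = t ^+ 2 * \int[spm E z]_x f x.
  move=> zD; have fi := spectral_domain_integrable mf zD; have [z2 _] := zD.
  have mEf : measurable_fun setT (EFin \o f) by exact/measurable_EFinP.
  rewrite /Rintegral (spmZ _ _ (sqr_ge0 t))// [in RHS]integralE [in LHS]integralE.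
  rewrite !ge0_integral_mscale//; [|exact: measurable_funeneg|exact: measurable_funepos].
  have pf := integrable_pos_fin_num measurableT fi.
  have nf := integrable_neg_fin_num measurableT fi.
  by rewrite -(fineK pf) -(fineK nf) -!EFinM -!EFinB /= mulrBr.
have -> : (fun p => t * u p + w p) = (fun p => t * (u p + t^-1 * w p)).
  by apply/funext => p; field.
have -> : (fun p => t * u p - w p) = (fun p => t * (u p - t^-1 * w p)).
  by apply/funext => p; field.
rewrite !intZ// -mulrBr mulrCA -uv//.
rewrite (L2_innerC _ v (fun p => t^-1 * w p)) !L2_innerZ// (L2_innerC _ w v).
by field.
Qed.

(** The norm of [A_m^a u] is homogeneous in [u], even though the spectral
    resolution in [A_power] may depend on [u]: there is only one. *)
Lemma A_power_norm_homogeneous (m a t : R) u v v' : t != 0 ->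
  A_power vol m a u v -> A_power vol m a (fun p => t * u p) v' ->
  ip v' v' = t ^+ 2 * ip v v.
Proof.
move=> t0 [E EA uv] [E' E'A uv'].
have mf : measurable_fun setT (fun x : R => x `^ a) by exact: measurable_powR.
have tuv := spectral_integralZ mf t0 uv; have [_ v2 _] := uv.
rewrite -(spectral_integral_norm_unique mf (spectral_integral_transfer EA E'A tuv) uv').
by rewrite L2_innerZ// ?(L2_innerC _ v (fun p => t * v p)) ?L2_innerZ//; [ring|exact: in_L2Z].
Qed.

End SpectralUniqueness.

(** * Real random variables with a Gaussian characteristic function *)

Lemma integral_derivative_eq0 (R : realType) (F f : R -> R) :
  (forall x : R, is_derive x 1 F (f x)) -> continuous f ->
  (@lebesgue_measure R).-integrable setT (EFin \o f) ->
  F x @[x --> +oo%R] --> (0 : R) -> F (- x) @[x --> +oo%R] --> (0 : R) ->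
  (\int[lebesgue_measure]_x f x = 0)%R.
Proof.
move=> Ff cf fi Fp Fm; set mu := lebesgue_measure.
pose I (k : nat) := `[- k%:R, k%:R]%classic : set R.
have Ix k x : `|x| <= k%:R -> I k x by rewrite /I/= in_itv/= -ler_norml.
have mI k : measurable (I k) by exact: measurable_itv.
have mf : measurable_fun setT f by apply/measurable_EFinP; exact: measurable_int fi.
have [|||||_ _ cv] := @dominated_convergence _ _ _ mu setT measurableT
  (fun k x => ((f \_ (I k)) x)%:E) (fun x => (f x)%:E) (fun x => `|f x|%:E).
- move=> k; apply/measurable_EFinP; apply/(measurable_restrictT _ (mI k)).
  exact: measurable_funTS.
- exact/measurable_EFinP.
- apply: aeW => x _; apply: cvg_near_cst; near=> k.
  rewrite patchE mem_set//; apply/Ix/ltW.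
  by near: k; exact: nbhs_infty_gtr.
- by have := integrable_norm fi.
- apply: aeW => x k _ /=; rewrite lee_fin patchE.
  by case: ifPn => // _; rewrite normr0.
have FI k : (\int[mu]_x ((f \_ (I k.+1)) x)%:E)%E = (F k.+1%:R - F (- k.+1%:R))%:E.
  transitivity (\int[mu]_(x in I k.+1) (f x)%:E)%E.
    rewrite [RHS]integral_mkcond; apply: eq_integral => x _.
    by rewrite !patchE; case: ifPn.
  rewrite (@continuous_FTC2 _ _ F) ?EFinB//.
  - by rewrite gtrN.
  - exact: continuous_subspaceT.
  - split => [x _|//|//].
    + by have := Ff x; case.
    + by apply: cvg_at_right_filter; apply: differentiable_continuous;
        apply/derivable1_diffP; case: (Ff (- k.+1%:R)).
    + by apply: cvg_at_left_filter; apply: differentiable_continuous;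
        apply/derivable1_diffP; case: (Ff k.+1%:R).
  - by move=> x _; rewrite derive1E; case: (Ff x).
have cvS : (k.+1%:R : R) @[k --> \oo] --> +oo%R.
  apply/cvgryPge => A; near=> k; apply: (@le_trans _ _ k%:R); last by rewrite ler_nat.
  by near: k; exact: nbhs_infty_ger.
have lim0 : (fun k : nat => (F k.+1%:R - F (- k.+1%:R))%:E) @ \oo --> 0%:E.
  apply: cvg_EFin; first exact: nearW.
  rewrite -[0]subr0; apply: cvgB.
    exact: (cvg_comp _ _ cvS Fp).
  exact: (cvg_comp _ _ cvS Fm).
have cv' : (fun k : nat => (F k.+1%:R - F (- k.+1%:R))%:E) @ \oo -->
    (\int[mu]_x (f x)%:E)%E.
  move: cv; rewrite -cvg_shiftS; apply: cvg_trans.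
  by apply: near_eq_cvg; apply: nearW => k /=; rewrite FI.
by rewrite /Rintegral (cvg_unique _ cv' lim0).
Unshelve. all: by end_near. Qed.

Section GaussianIntegral.
Context (R : realType).
Notation mu := (@lebesgue_measure R).
Implicit Types s b x z : R.

Definition gweight s z := expR (- (s * z ^+ 2)).

Lemma measurable_gweight s : measurable_fun setT (gweight s).
Proof.
apply: measurableT_comp => //; apply: measurableT_comp => //.
by apply: measurable_funM => //; exact: measurable_funX.
Qed.

Lemma gweight_gt0 s z : 0 < gweight s z. Proof. exact: expR_gt0. Qed.

Lemma gweight_le s s' z : s' <= s -> gweight s z <= gweight s' z.
Proof. by move=> ss; rewrite ler_expR lerN2 ler_wpM2r ?sqr_ge0. Qed.

Lemma gweight1 z : gweight 1 z = gauss_fun z.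
Proof. by rewrite /gweight mul1r. Qed.

Lemma gweight_mul_id s z : 2 <= s -> `|z| * gweight s z <= gauss_fun z.
Proof.
move=> s2; apply: (@le_trans _ _ (`|z| * (gauss_fun z * gauss_fun z))).
  rewrite ler_wpM2l// -expRD ler_expR -opprD -mulr2n lerN2 -mulr_natl.
  by rewrite ler_wpM2r ?sqr_ge0.
rewrite mulrA ler_piMl ?gauss_fun_ge0// /gauss_fun expRN ler_pdivrMr ?expR_gt0//.
rewrite mul1r; apply: le_trans (expR_ge1Dx _).
rewrite -[z ^+ 2]real_normK ?num_real//; have := sqr_ge0 (`|z| - 1); nra.
Qed.

Lemma integrable_gweight s (f : R -> R) : 1 <= s -> measurable_fun setT f ->
  (forall z, `|f z| <= 1) ->
  mu.-integrable setT (fun z => (f z * gweight s z)%:E).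
Proof.
move=> s1 mf f1; apply: le_integrable (integrableT_gauss) => //.
  by apply/measurable_EFinP/measurable_funM => //; exact: measurable_gweight.
move=> z _ /=; rewrite lee_fin normrM.
rewrite (ger0_norm (ltW (gweight_gt0 _ _))) (ger0_norm (gauss_fun_ge0 _)).
rewrite -gweight1 -[leRHS]mul1r ler_pM ?gweight_le//; exact/ltW/gweight_gt0.
Qed.

(** The Fourier transform of [e^(-s z^2)], which is even.  Its computation is limited
    to [2 <= s], where [|z| e^(-s z^2)] is dominated by [e^(-z^2)]. *)
Definition gcos s b := \int[mu]_z (cos (b * z) * gweight s z).

Lemma measurable_cosM b : measurable_fun setT (fun z : R => cos (b * z)).
Proof.
apply: measurableT_comp; last exact: measurable_funM.
by apply: continuous_measurable_fun; exact: continuous_cos.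
Qed.

Lemma measurable_sinM b : measurable_fun setT (fun z : R => sin (b * z)).
Proof.
apply: measurableT_comp; last exact: measurable_funM.
by apply: continuous_measurable_fun; exact: continuous_sin.
Qed.

Let dgcos s b z := - (z * sin (b * z)) * gweight s z.

Let is_derive_gweight s z : is_derive z (1 : R) (gweight s) (- (2 * s * z) * gweight s z).
Proof.
have d2 : is_derive z (1 : R) (fun z : R => - (s * z ^+ 2)) (- (2 * s * z)).
  by apply: is_derive_eq; rewrite /GRing.scale/=; ring.
have := @is_derive1_comp _ expR (fun z : R => - (s * z ^+ 2)) z _ _ (is_derive_expR _) d2.
by rewrite mulrC.
Qed.

Let is_derive_sinM b z : is_derive z (1 : R) (fun z : R => sin (b * z)) (b * cos (b * z)).
Proof.
have d1 : is_derive z (1 : R) (fun z : R => b * z) b.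
  by apply: is_derive_eq; rewrite /GRing.scale/=; ring.
by have := @is_derive1_comp _ sin (fun z : R => b * z) z _ _ (is_derive_sin _) d1; rewrite mulrC.
Qed.

Let is_derive_cosM b z : is_derive b (1 : R) (fun b : R => cos (b * z)) (- (z * sin (b * z))).
Proof.
have d1 : is_derive b (1 : R) (fun b : R => b * z) z.
  by apply: is_derive_eq; rewrite /GRing.scale/=; ring.
by have := @is_derive1_comp _ cos (fun b : R => b * z) b _ _ (is_derive_cos _) d1; rewrite mulNr mulrC.
Qed.

Let measurable_dgcos s b : measurable_fun setT (dgcos s b).
Proof.
apply: measurable_funM; last exact: measurable_gweight.
apply: measurableT_comp => //.
by apply: measurable_funM => //; exact: measurable_sinM.
Qed.

Let dgcos_bound s b z : 2 <= s -> `|dgcos s b z| <= gauss_fun z.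
Proof.
move=> s2; rewrite normrM normrN normrM (ger0_norm (ltW (gweight_gt0 _ _))).
apply: le_trans (gweight_mul_id z s2); rewrite ler_wpM2r ?(ltW (gweight_gt0 _ _))//.
by rewrite ler_piMr// sin_max.
Qed.

Let is_derive_gcos s b : 2 <= s ->
  is_derive b (1 : R) (gcos s) (\int[mu]_z dgcos s b z).
Proof.
move=> s2; have s1 : 1 <= s by lra.
pose f b z := cos (b * z) * gweight s z.
have df b' z : is_derive b' (1 : R) (fun b => f b z) (dgcos s b' z).
  have := is_derive_cosM b' z => dc.
  by apply: is_derive_eq; rewrite /dgcos /GRing.scale/=; ring.
have Ib : `]b - 1, b + 1[%classic b by rewrite /= in_itv/=; lra.
have intf x : `]b - 1, b + 1[%classic x -> mu.-integrable setT (EFin \o f x).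
  move=> _; apply: integrable_gweight => //; first exact: measurable_cosM.
  by move=> z; exact: cos_max.
have derf x y : `]b - 1, b + 1[%classic x -> setT y -> derivable (f ^~ y) x 1.
  by move=> _ _; case: (df x y).
have ub x y : `]b - 1, b + 1[%classic x -> setT y ->
    `|partial1of2 f x y| <= gauss_fun y.
  move=> _ _; rewrite partial1of2E (_ : 'D_1 _ x = dgcos s x y) ?dgcos_bound//.
  by case: (df x y).
have D := @derivable_under_integral R _ _ mu f setT measurableT b _ _ Ib intf derf _ (@gauss_fun_ge0 R) integrableT_gauss ub.
have E := @differentiation_under_integral R _ _ mu f setT measurableT b _ _ Ib intf derf _ (@gauss_fun_ge0 R) integrableT_gauss ub.
split => //; move: E; rewrite derive1E => ->.
by apply: eq_Rintegral => z _; rewrite partial1of2E; case: (df b z).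
Qed.

(* integration by parts, the derivative being that of [sin (b z) e^(-s z^2)] *)
Let gcos_ode s b : 2 <= s ->
  \int[mu]_z dgcos s b z = - (b / (2 * s)) * gcos s b.
Proof.
move=> s2; have s1 : 1 <= s by lra.
have s0 : s != 0 by rewrite gt_eqF//; lra.
pose F z := sin (b * z) * gweight s z.
pose f z := b * (cos (b * z) * gweight s z) + 2 * s * dgcos s b z.
have Ff z : is_derive z (1 : R) F (f z).
  have d1 := is_derive_sinM b z; have d2 := is_derive_gweight s z.
  by apply: is_derive_eq; rewrite /f /dgcos /GRing.scale/=; ring.
have int1 : mu.-integrable setT (EFin \o (fun z => cos (b * z) * gweight s z)).
  apply: integrable_gweight => //; first exact: measurable_cosM.
  by move=> z; exact: cos_max.
have int2 : mu.-integrable setT (EFin \o dgcos s b).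
  apply: le_integrable (integrableT_gauss) => //.
    by apply/measurable_EFinP; exact: measurable_dgcos.
  by move=> z _ /=; rewrite lee_fin (ger0_norm (gauss_fun_ge0 _)) dgcos_bound.
have int1' := integrableZl measurableT b int1.
have int2' := integrableZl measurableT (2 * s) int2.
have cg : continuous (gweight s).
  by move=> z; apply: differentiable_continuous; apply/derivable1_diffP;
    case: (is_derive_gweight s z).
have cs : continuous (fun z => sin (b * z)).
  by move=> z; apply: differentiable_continuous; apply/derivable1_diffP;
    case: (is_derive_sinM b z).
have cc : continuous (fun z => cos (b * z)).
  move=> z; apply: (@continuous_comp _ _ _ (fun z => b * z) cos).
    exact: mulrl_continuous.
  exact: continuous_cos.
have Fb z : `|F z| <= gauss_fun z.
  rewrite normrM (ger0_norm (ltW (gweight_gt0 _ _))) -gweight1 -[leRHS]mul1r.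
  by rewrite ler_pM ?sin_max ?gweight_le//; exact/ltW/gweight_gt0.
have F0 : F x @[x --> +oo%R] --> (0 : R).
  apply: norm_cvg0; apply: (@squeeze_cvgr _ _ _ _ (cst 0) gauss_fun).
  - by apply: nearW => z; rewrite normr_ge0 Fb.
  - exact: cvg_cst.
  - exact: cvg_gauss_fun.
have F0' : F (- x) @[x --> +oo%R] --> (0 : R).
  apply: norm_cvg0; apply: (@squeeze_cvgr _ _ _ _ (cst 0) gauss_fun).
  - apply: nearW => z; rewrite normr_ge0/=; apply: le_trans (Fb _) _.
    by rewrite /gauss_fun sqrrN.
  - exact: cvg_cst.
  - exact: cvg_gauss_fun.
have := @integral_derivative_eq0 R F f Ff _ _ F0 F0'.
rewrite /f RintegralD// RintegralZl// RintegralZl// -/(gcos s b) => H.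
have {}H : b * gcos s b + 2 * s * \int[mu]_z dgcos s b z = 0.
  apply: H; last by have := integrableD measurableT int1' int2'.
  move=> z; apply: cvgD.
    by apply: cvgM; [exact: cvg_cst|apply: cvgM; [exact: cc|exact: cg]].
  apply: cvgM; first exact: cvg_cst.
  apply: cvgM; last exact: cg.
  by apply: cvgN; apply: cvgM; [exact: cvg_id|exact: cs].
rewrite -[LHS](mulKf (_ : 2 * s != 0)); last by rewrite mulf_neq0.
have -> : 2 * s * \int[mu]_z dgcos s b z = - (b * gcos s b) by lra.
by field.
Qed.

(** The Fourier transform of a Gaussian, as the solution of
    [y' = - b y / 2s]. *)
Lemma gcosE s b : 2 <= s -> gcos s b = gcos s 0 * expR (- (b ^+ 2 / (4 * s))).
Proof.
move=> s2; have s0 : s != 0 by rewrite gt_eqF//; lra.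
pose y b := gcos s b * expR (b ^+ 2 / (4 * s)).
have dy b' : is_derive b' (1 : R) y 0.
  have d1 := is_derive_gcos b' s2.
  have d2 : is_derive b' (1 : R) (fun b => b ^+ 2 / (4 * s)) (b' / (2 * s)).
    by apply: is_derive_eq; rewrite /GRing.scale/=; field.
  have d3 := @is_derive1_comp _ expR (fun b => b ^+ 2 / (4 * s)) b' _ _ (is_derive_expR _) d2.
  apply: is_derive_eq; rewrite gcos_ode// /GRing.scale/=; ring.
have := is_derive_0_is_cst b 0 dy; rewrite /y expr0n/= mul0r expR0 mulr1 => <-.
by rewrite -mulrA -expRD subrr expR0 mulr1.
Qed.

End GaussianIntegral.

Lemma gcos0_gt0 (R : realType) : 0 < gcos (2 : R) 0.
Proof.
have g2i : (@lebesgue_measure R).-integrable setT (EFin \o gweight 2).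
  have := @integrable_gweight R 2 (cst 1) _ _ _.
  by under eq_fun do rewrite mul1r; apply => // [|z]; [lra|rewrite normr1].
rewrite /gcos; under eq_Rintegral do rewrite mul0r cos0 mul1r.
have m01 : lebesgue_measure (`[0, 1]%classic : set R) = 1%E.
  by rewrite lebesgue_measure_itv/= lte_fin ltr01 oppr0 adde0.
apply: (@lt_le_trans _ _ (expR (- 2))); first exact: expR_gt0.
rewrite -lee_fin /Rintegral fineK; last exact: integrable_fin_num g2i.
set mu' := (X in integral X _ _).
apply: (@le_trans _ _ (\int[mu']_(z in `[0%R, 1%R]) (expR (- 2))%:E)%E).
  rewrite integral_cst; last exact: measurable_itv.
  by rewrite -[leLHS]mule1 -[X in (_ * X <= _)%E]m01.
rewrite integral_mkcond; apply: ge0_le_lower_integral => z _.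
  by rewrite patchE; case: ifPn => // _; rewrite lee_fin expR_ge0.
rewrite patchE; case: ifPn => [|_]; last by rewrite lee_fin expR_ge0.
rewrite inE /= in_itv/= => /andP[z0 z1].
by rewrite lee_fin /gweight ler_expR lerN2 ler_piMr//; nra.
Qed.

Lemma probability_measure_setT d (T : measurableType d) (R : realType)
  (P : probability T R) : (P : {measure set T -> \bar R}) setT = 1%E.
Proof. exact: probability_setT. Qed.

Lemma bounded_cvg_Rintegral d (T : measurableType d) (R : realType)
    (P : probability T R) (f_ : nat -> T -> R) (f : T -> R) :
  (forall k, measurable_fun setT (f_ k)) -> (forall k w, `|f_ k w| <= 1) ->
  (forall w, f_ k w @[k --> \oo] --> f w) ->
  \int[P]_w f_ k w @[k --> \oo] --> \int[P]_w f w.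
Proof.
move=> mf f1 ff.
have oi : P.-integrable setT (EFin \o cst 1).
  apply: (@bounded_integrable _ _ _ P _ setT _ 1) => // [|x _]; last by rewrite normr1.
  by rewrite probability_measure_setT ltry.
have [|||||fi _ cv] := @dominated_convergence _ _ _ P setT measurableT
  (fun k w => (f_ k w)%:E) (fun w => (f w)%:E) (EFin \o cst 1).
- by move=> k; exact/measurable_EFinP.
- by apply/measurable_EFinP; apply: measurable_realfun.measurable_fun_cvg => // w _; exact: ff.
- by apply: aeW => w _; apply: cvg_EFin; [exact: nearW|exact: ff].
- exact: oi.
- by apply: aeW => w k _; rewrite lee_fin.
by apply: fine_cvg; rewrite /Rintegral fineK//; exact: integrable_fin_num.
Qed.

(** Pointwise limits of centered Gaussian variables are centered Gaussian: if the
    variances diverged, the limit characteristic function would vanish off 0. *)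
Lemma gaussian_limit d (T : measurableType d) (R : realType)
    (P : probability T R) (Xk : nat -> T -> R) (X : T -> R) (qk : nat -> R) :
  (forall k, measurable_fun setT (Xk k)) ->
  (forall w, Xk k w @[k --> \oo] --> X w) ->
  (forall k t, t != 0 -> \int[P]_w cos (t * Xk k w) = expR (- (t ^+ 2 * qk k / 2))) ->
  (forall k t, t != 0 -> \int[P]_w sin (t * Xk k w) = 0) ->
  exists q, [/\ 0 <= q,
    forall t, \int[P]_w cos (t * X w) = expR (- (t ^+ 2 * q / 2)) &
    forall t, \int[P]_w sin (t * X w) = 0].
Proof.
move=> mXk Xlim Ck Sk.
have mX : measurable_fun setT X.
  by apply: (@measurable_realfun.measurable_fun_cvg _ _ _ _ Xk) => // w _; exact: Xlim.
have mcos t (Y : T -> R) : measurable_fun setT Y -> measurable_fun setT (fun w => cos (t * Y w)).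
  exact: (measurableT_comp (measurable_cosM t)).
have msin t (Y : T -> R) : measurable_fun setT Y -> measurable_fun setT (fun w => sin (t * Y w)).
  exact: (measurableT_comp (measurable_sinM t)).
have P1 : \int[P]_w (1 : R) = 1.
  by rewrite Rintegral_cst// mul1r probability_measure_setT.
have tX t w : t * Xk k w @[k --> \oo] --> t * X w.
  by apply: cvgM; [exact: cvg_cst|exact: Xlim].
have climT t : \int[P]_w cos (t * Xk k w) @[k --> \oo] --> \int[P]_w cos (t * X w).
  apply: bounded_cvg_Rintegral => [k|k w|w]; [exact: mcos|exact: cos_max|].
  by apply: continuous_cvg; [exact: continuous_cos|exact: tX].
have slimT t : \int[P]_w sin (t * Xk k w) @[k --> \oo] --> \int[P]_w sin (t * X w).
  apply: bounded_cvg_Rintegral => [k|k w|w]; [exact: msin|exact: sin_max|].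
  by apply: continuous_cvg; [exact: continuous_sin|exact: tX].
have sin_eq0 t : \int[P]_w sin (t * X w) = 0.
  have [->|t0] := eqVneq t 0.
    by under eq_Rintegral do rewrite mul0r sin0; rewrite /Rintegral integral0.
  apply/esym; apply: cvg_unique (slimT t) => //.
  by apply: cvg_near_cst; apply: nearW => k; rewrite Sk.
pose L := \int[P]_w cos (1 * X w).
have Llim : expR (- (qk k / 2)) @[k --> \oo] --> L.
  apply: cvg_trans (climT 1); apply: near_eq_cvg; apply: nearW => k.
  by rewrite Ck ?oner_neq0// expr1n mul1r.
have L0 : 0 <= L.
  rewrite -(cvg_lim _ Llim)//; apply: limr_ge; first by apply/cvg_ex; exists L.
  by apply: nearW => k; exact: expR_ge0.
have L1 : L <= 1.
  rewrite -P1; apply: le_Rintegral => //.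
  - apply: (@bounded_integrable _ _ _ P _ setT _ 1) => //; last by move=> x _; exact: cos_max.
      by rewrite probability_measure_setT ltry.
    exact: mcos.
  - apply: (@bounded_integrable _ _ _ P _ setT _ 1) => // [|x _]; last by rewrite normr1.
    by rewrite probability_measure_setT ltry.
have Lgt0 : 0 < L.
  rewrite lt_neqAle L0 andbT; apply/eqP => LE.
  have phi0 (m : nat) : \int[P]_w cos (m.+1%:R^-1 * X w) = 0.
    have mN0 : m.+1%:R^-1 != 0 :> R by rewrite invr_neq0// pnatr_eq0.
    set F := \int[P]_w _; pose N := (m.+1 ^ 2)%N.
    suff : F ^+ N = 0 by move/eqP; rewrite expf_eq0 => /andP[_ /eqP].
    rewrite LE; apply: cvg_unique Llim => //.
    have : (\int[P]_w cos (m.+1%:R^-1 * Xk k w)) ^+ N @[k --> \oo] --> F ^+ N.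
      apply: (@continuous_cvg _ _ _ _ _ (fun k => \int[P]_w _) (fun x => x ^+ N)).
        exact: exprn_continuous.
      exact: climT.
    apply: cvg_trans; apply: near_eq_cvg; apply: nearW => k.
    rewrite Ck// -expRM_natl /N natrX; congr expR; field.
    by rewrite gt_eqF// ltr_pwDl.
  have : \int[P]_w cos (m.+1%:R^-1 * X w) @[m --> \oo] --> \int[P]_w (1 : R).
    apply: bounded_cvg_Rintegral => [k|k w|w]; [exact: mcos|exact: cos_max|].
    rewrite -[X in _ --> X](_ : cos (0 * X w) = 1); last by rewrite mul0r cos0.
    apply: continuous_cvg; first exact: continuous_cos.
    by apply: cvgMr_tmp; exact: cvg_harmonic.
  under eq_fun do rewrite phi0.
  rewrite P1 => lim1; suff /eqP : 1 = 0 :> R by rewrite oner_eq0.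
  by apply: cvg_unique lim1 _ => //; exact: cvg_cst.
pose q := - 2 * ln L.
have qlim : qk k @[k --> \oo] --> q.
  have : - 2 * ln (expR (- (qk k / 2))) @[k --> \oo] --> q.
    apply: cvgM; first exact: cvg_cst.
    by apply: continuous_cvg => //; exact: continuous_ln.
  apply: cvg_trans; apply: near_eq_cvg; apply: nearW => k.
  by rewrite expRK; field.
exists q; split => // [|t].
  by have := ln_le0 L1; rewrite /q; lra.
have [->|t0] := eqVneq t 0.
  under eq_Rintegral do rewrite mul0r cos0.
  by rewrite P1 expr0n/= mul0r mul0r oppr0 expR0.
apply: cvg_unique (climT t) _ => //.
rewrite /=; under eq_fun do rewrite Ck//.
apply: continuous_cvg; first exact: continuous_expR.
by apply: cvgN; apply: cvgMr_tmp; apply: cvgM => //; exact: cvg_cst.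
Qed.

Section GaussianVariable.
Context d (T : measurableType d) (R : realType) (P : probability T R).
Variables (X : T -> R) (q : R).
Hypothesis mX : measurable_fun setT X.
Hypothesis q0 : 0 <= q.
Hypothesis cosX : forall t, \int[P]_w cos (t * X w) = expR (- (t ^+ 2 * q / 2)).
Hypothesis sinX : forall t, \int[P]_w sin (t * X w) = 0.
Notation mu := (@lebesgue_measure R).

Let mcos t : measurable_fun setT (fun w => cos (t * X w)).
Proof. exact: (measurableT_comp (measurable_cosM t)). Qed.

Let msin t : measurable_fun setT (fun w => sin (t * X w)).
Proof. exact: (measurableT_comp (measurable_sinM t)). Qed.

Let bounded_int (f : T -> R) (b : R) : measurable_fun setT f ->
  (forall w, `|f w| <= b) -> P.-integrable setT (EFin \o f).
Proof.
move=> mf fb; apply: (@bounded_integrable _ _ _ P _ setT f b) => //.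
by rewrite probability_measure_setT ltry.
Qed.

(** A damped exponential [e^(x - (delta x)^2 / 8)] is a superposition of cosines
    and sines of [x] with Gaussian weights, so that the characteristic function of
    [X] determines its mean. *)
Lemma damped_exp_mean (delta : R) : 0 < delta ->
  let s := 2 + delta ^+ 2 * q / 2 in
  (\int[P]_w (expR (X w - (delta * X w) ^+ 2 / 8))%:E =
   (expR (q / s) * (gcos s 0 / gcos 2 0))%:E)%E.
Proof.
move=> d0 s; have s2 : 2 <= s by rewrite lerDl divr_ge0// mulr_ge0// sqr_ge0.
have g0 := gcos0_gt0 R; have gN0 : gcos (2 : R) 0 != 0 by rewrite gt_eqF.
have dN0 : delta != 0 by rewrite gt_eqF.
pose f (wz : T * measurableTypeR R) :=
  cos ((delta * X wz.1 - 4 / delta) * wz.2) * gweight 2 wz.2.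
have mf : measurable_fun setT (EFin \o f).
  apply/measurable_EFinP; apply: measurable_funM; last first.
    by apply: (measurableT_comp (measurable_gweight 2)); exact: measurable_snd.
  have mc : measurable_fun setT (cos : R -> R).
    by apply: continuous_measurable_fun; exact: continuous_cos.
  apply: (measurableT_comp mc); apply: measurable_funM; last exact: measurable_snd.
  apply: measurable_funB => //; apply: measurable_funM => //.
  by apply: (measurableT_comp mX); exact: measurable_fst.
have fb w z : `|f (w, z)| <= gauss_fun z.
  rewrite /f normrM (ger0_norm (ltW (gweight_gt0 _ _))) -gweight1 -[leRHS]mul1r.
  by rewrite ler_pM ?cos_max ?gweight_le ?ler1n//; exact/ltW/gweight_gt0.
have fi : (P \x mu)%E.-integrable setT (EFin \o f).
  apply/integrable12ltyP => //.
  apply: (@le_lt_trans _ _ (\int[P]_w (Num.sqrt pi)%:E)%E).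
    apply: ge0_le_lower_integral => w _; first exact: integral_ge0.
    rewrite -integralT_gauss; apply: ge0_le_lower_integral => // z _ /=.
    by rewrite lee_fin.
  by rewrite integral_cst// probability_measure_setT mule1 ltry.
have := Fubini fi.
have -> : (\int[P]_w \int[mu]_z (EFin \o f) (w, z) =
    \int[P]_w (gcos 2 (delta * X w - 4 / delta))%:E)%E.
  apply: eq_integral => w _; rewrite /gcos /Rintegral fineK//.
  apply: integrable_fin_num => //; apply: integrable_gweight; rewrite ?ler1n//.
    exact: measurable_cosM.
  by move=> z; exact: cos_max.
have -> : (\int[mu]_z \int[P]_w (EFin \o f) (w, z) = (gcos s (4 / delta))%:E)%E.
  rewrite /gcos /Rintegral fineK; last first.
    apply: integrable_fin_num => //; apply: integrable_gweight.
    - by rewrite (le_trans _ s2)// ler1n.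
    - exact: measurable_cosM.
    - by move=> z; exact: cos_max.
  apply: eq_integral => z _ /=.
  have ci t c : P.-integrable setT (EFin \o (fun w => c * cos (t * X w))).
    apply: (@bounded_int _ `|c|); first exact: measurable_funM.
    by move=> w; rewrite normrM ler_piMr// cos_max.
  have si t c : P.-integrable setT (EFin \o (fun w => c * sin (t * X w))).
    apply: (@bounded_int _ `|c|); first exact: measurable_funM.
    by move=> w; rewrite normrM ler_piMr// sin_max.
  pose c1 := cos (4 / delta * z) * gweight 2 z.
  pose c2 := sin (4 / delta * z) * gweight 2 z.
  transitivity (\int[P]_w ((c1 * cos (delta * z * X w))%:E +
      (c2 * sin (delta * z * X w))%:E))%E.
    apply: eq_integral => w _; rewrite /f /= -EFinD; congr (_%:E).
    rewrite mulrBl cosB /c1 /c2 (_ : delta * X w * z = delta * z * X w); ring.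
  rewrite integralD//; [|exact: ci|exact: si].
  have ci1 := @bounded_int _ 1 (mcos (delta * z)) (fun w => cos_max _).
  have si1 := @bounded_int _ 1 (msin (delta * z)) (fun w => sin_max _).
  have intZ c (g : T -> R) : P.-integrable setT (EFin \o g) ->
      (\int[P]_w (c * g w)%:E = (c * \int[P]_w g w)%:E)%E.
    move=> gi; rewrite -RintegralZl// /Rintegral fineK//.
    exact: integrable_fin_num (integrableZl measurableT c gi).
  rewrite (intZ _ _ ci1) (intZ _ _ si1) cosX sinX mulr0.
  rewrite adde0 /c1 /gweight -mulrA -expRD; congr (_ * expR _)%:E.
  by rewrite /s; field.
move=> FE.
have expE x : expR (x - (delta * x) ^+ 2 / 8) =
    expR (2 / delta ^+ 2) / gcos 2 0 * gcos 2 (delta * x - 4 / delta).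
  rewrite (gcosE (delta * x - 4 / delta))// mulrA mulfVK// -expRD.
  by congr expR; field.
under eq_integral do rewrite expE EFinM.
rewrite ge0_integralZl//.
- rewrite FE -EFinM (gcosE (4 / delta))//; congr (_%:E).
  have -> : expR (q / s) = expR (2 / delta ^+ 2) * expR (- ((4 / delta) ^+ 2 / (4 * s))).
    rewrite -expRD; congr expR; rewrite /s; field; rewrite dN0 /= gt_eqF//.
    by have := mulr_ge0 (sqr_ge0 delta) q0; lra.
  by field.
- apply/measurable_EFinP; under eq_fun do rewrite gcosE//.
  apply: measurable_funM => //; apply: measurableT_comp => //.
  apply: measurableT_comp => //; apply: measurable_funM => //.
  apply: measurable_funX; apply: measurable_funB => //; exact: measurable_funM.
- by move=> w _; rewrite lee_fin gcosE// mulr_ge0 ?expR_ge0// ltW.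
- by rewrite lee_fin divr_ge0 ?expR_ge0// ltW.
Qed.

(** As [delta] tends to 0, the damped exponentials increase to the exponential and
    their means converge. *)
Lemma gaussian_exp_mean : (\int[P]_w (expR (X w))%:E = (expR (q / 2))%:E)%E.
Proof.
pose del (k : nat) : R := k.+1%:R^-1.
have del0 k : 0 < del k by rewrite invr_gt0.
pose g k w := expR (X w - (del k * X w) ^+ 2 / 8).
have mg k : measurable_fun setT (fun w => (g k w)%:E).
  apply/measurable_EFinP; apply: measurableT_comp => //.
  apply: measurable_funB => //; apply: measurable_funM => //.
  by apply: measurable_funX; exact: measurable_funM.
have dellim : del k @[k --> \oo] --> (0 : R).
  have := @cvg_harmonic R; exact.
have glim w : g k w @[k --> \oo] --> expR (X w).
  apply: (@continuous_cvg _ _ _ _ _ (fun k => X w - (del k * X w) ^+ 2 / 8) expR).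
    exact: continuous_expR.
  rewrite -[X in _ --> X](_ : X w - (0 * X w) ^+ 2 / 8 = X w); last first.
    by rewrite mul0r expr0n/= mul0r subr0.
  apply: cvgB; first exact: cvg_cst.
  apply: cvgMr_tmp; rewrite expr2; under eq_fun do rewrite expr2.
  by apply: cvgM; apply: cvgMr_tmp.
have ndg w : {homo (fun k => (g k w)%:E) : k l / (k <= l)%N >-> (k <= l)%E}.
  move=> k l kl; rewrite lee_fin ler_expR lerD2l lerN2 ler_wpM2r ?invr_ge0//.
  have dd : del l <= del k by rewrite lef_pV2 ?posrE// ler_nat.
  rewrite !exprMn ler_wpM2r ?sqr_ge0// lerXn2r ?nnegrE ?(ltW (del0 _))//.
have := @cvg_monotone_convergence _ _ _ P setT measurableT (fun k w => (g k w)%:E)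
  mg (fun k w _ => _) (fun w _ => ndg w).
move=> /(_ (fun k w => ltac:(rewrite lee_fin; exact: expR_ge0))).
have -> : (\int[P]_w limn (fun k => (g k w)%:E) = \int[P]_w (expR (X w))%:E)%E.
  apply: eq_integral => w _; apply/cvg_lim => //.
  by apply: cvg_EFin; [exact: nearW|exact: glim].
move=> cvl.
pose s k := 2 + del k ^+ 2 * q / 2.
have slim : s k @[k --> \oo] --> (2 : R).
  rewrite -[X in _ --> X](_ : 2 + 0 * 0 * q / 2 = 2); last by rewrite !mul0r addr0.
  apply: cvgD; first exact: cvg_cst.
  apply: cvgMr_tmp; apply: cvgMr_tmp; under eq_fun do rewrite expr2.
  exact: cvgM.
have s2 k : 2 <= s k by rewrite lerDl divr_ge0// mulr_ge0// sqr_ge0.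
have gclim : gcos (s k) 0 @[k --> \oo] --> gcos 2 0.
  have [|||||_ _ cv] := @dominated_convergence _ _ _ mu setT measurableT
    (fun k z => (cos (0 * z) * gweight (s k) z)%:E)
    (fun z => (cos (0 * z) * gweight 2 z)%:E) (EFin \o gauss_fun).
  - move=> k; apply/measurable_EFinP/measurable_funM; first exact: measurable_cosM.
    exact: measurable_gweight.
  - apply/measurable_EFinP/measurable_funM; first exact: measurable_cosM.
    exact: measurable_gweight.
  - apply: aeW => z _; apply: cvg_EFin; first exact: nearW.
    apply: cvgM; first exact: cvg_cst.
    apply: (@continuous_cvg _ _ _ _ _ (fun k => - (s k * z ^+ 2)) expR).
      exact: continuous_expR.
    by apply: cvgN; exact: cvgMr_tmp.
  - exact: integrableT_gauss.
  - apply: aeW => z k _ /=; rewrite lee_fin mul0r cos0 mul1r.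
    rewrite (ger0_norm (ltW (gweight_gt0 _ _))) -gweight1 gweight_le//.
    by have := s2 k; lra.
  apply: fine_cvg; rewrite /gcos /Rintegral fineK//.
  apply: integrable_fin_num => //; apply: integrable_gweight; rewrite ?ler1n//.
    exact: measurable_cosM.
  by move=> z; exact: cos_max.
have rlim : (\int[P]_w (g k w)%:E)%E @[k --> \oo] --> (expR (q / 2))%:E.
  rewrite /g; under eq_fun do rewrite damped_exp_mean// -/(s _).
  apply: cvg_EFin; first exact: nearW.
  rewrite -[X in _ --> X](_ : expR (q / 2) * (gcos 2 0 / gcos 2 0) = expR (q / 2)); last first.
    by rewrite divff ?mulr1// gt_eqF// gcos0_gt0.
  apply: cvgM; last exact: cvgMr_tmp.
  apply: (@continuous_cvg _ _ _ _ _ (fun k => q / s k) expR).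
    exact: continuous_expR.
  apply: cvgM; first exact: cvg_cst.
  by apply: cvgV => //; rewrite pnatr_eq0.
exact: cvg_unique cvl rlim.
Qed.

Lemma ler_norm_sin (x : R) : `|sin x| <= `|x|.
Proof.
wlog x0 : x / 0 < x => [H|].
  have [->|xN0] := eqVneq x 0; first by rewrite sin0.
  have [/H//|xle0] := ltP 0 x.
  by rewrite -normrN -sinN -[leRHS]normrN H// oppr_gt0 lt_neqAle xN0.
have [|c _] := @MVT R sin cos 0 x x0 (fun y _ => is_derive_sin y).
  by apply: continuous_subspaceT; exact: continuous_sin.
by rewrite sin0 !subr0 => ->; rewrite normrM ler_piMl ?cos_max.
Qed.

(** The functions [(2 / delta^2) (1 - cos (delta x))], whose means are known, lie below
    [x^2] and converge to it: Fatou's lemma gives one inequality. *)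
Lemma gaussian_variance : (\int[P]_w (X w ^+ 2)%:E = q%:E)%E.
Proof.
pose del (k : nat) : R := k.+1%:R^-1.
have del0 k : 0 < del k by rewrite invr_gt0.
have dellim : del k @[k --> \oo] --> (0 : R).
  have := @cvg_harmonic R; exact.
pose f k w := 2 / del k ^+ 2 * (1 - cos (del k * X w)).
have cos1 y : 1 - cos y = 2 * sin (y / 2) ^+ 2 :> R.
  rewrite -[in LHS](_ : y / 2 + y / 2 = y) ?cosD; last by field.
  by rewrite -!expr2 cos2sin2; ring.
have f0 k w : 0 <= f k w.
  apply: mulr_ge0; first by rewrite divr_ge0// sqr_ge0.
  by rewrite cos1 mulr_ge0// sqr_ge0.
have fX k w : f k w <= X w ^+ 2.
  rewrite /f cos1.
  have : sin (del k * X w / 2) ^+ 2 <= (del k * X w / 2) ^+ 2.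
    by rewrite -[leLHS]real_normK ?num_real// -[leRHS]real_normK ?num_real//
      lerXn2r ?nnegrE// ler_norm_sin.
  move=> H; apply: (@le_trans _ _ (2 / del k ^+ 2 * (2 * (del k * X w / 2) ^+ 2))).
    by rewrite !ler_wpM2l// divr_ge0// sqr_ge0.
  by rewrite le_eqVlt; apply/orP; left; apply/eqP; field; rewrite gt_eqF.
have mf k : measurable_fun setT (fun w => (f k w)%:E).
  apply/measurable_EFinP; apply: measurable_funM => //.
  exact: measurable_funB.
have sinlim : h^-1 * sin h @[h --> 0^'] --> (1 : R).
  have [/cvg_ex[l dl] E] := is_derive_sin (0 : R).
  have : l = 1 by rewrite -cos0 -E /derive; apply/esym/cvg_lim.
  move=> l1; move: dl; rewrite l1; apply: cvg_trans; apply: near_eq_cvg.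
  by apply: nearW => h; rewrite /= sin0 subr0 addr0 /GRing.scale/= mulr1.
have flim w : f k w @[k --> \oo] --> X w ^+ 2.
  have [X0|XN0] := eqVneq (X w) 0.
    apply: cvg_near_cst; apply: nearW => k.
    by rewrite /f X0 mulr0 cos0 subrr mulr0 expr0n.
  pose h k := del k * X w / 2.
  have hN0 k : h k != 0 by rewrite !mulf_neq0 ?invr_neq0// gt_eqF.
  have hlim : h k @[k --> \oo] --> (0 : R).
    rewrite -[X in _ --> X](_ : 0 * X w / 2 = 0); last by rewrite !mul0r.
    by apply: cvgMr_tmp; exact: cvgMr_tmp.
  move/cvgr_dnbhsP : sinlim => /(_ h (conj hN0 hlim)).
  move=> H.
  have : X w ^+ 2 * ((h k)^-1 * sin (h k) * ((h k)^-1 * sin (h k))) @[k --> \oo]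
      --> X w ^+ 2 * (1 * 1) by apply: cvgM; [exact: cvg_cst|exact: cvgM].
  rewrite !mulr1.
  apply: cvg_trans; apply: near_eq_cvg; apply: nearW => k.
  rewrite /= /f cos1 -/(h k) {1 3}/h; field.
  by rewrite XN0 gt_eqF.
have Ef k : (\int[P]_w (f k w)%:E = (2 / del k ^+ 2 * (1 - expR (- (del k ^+ 2 * q / 2))))%:E)%E.
  have ci := @bounded_int _ 1 (mcos (del k)) (fun w => cos_max _).
  have oi : P.-integrable setT (EFin \o cst 1).
    by apply: (@bounded_int _ 1) => // w; rewrite normr1.
  have b0 : 0 <= 2 / del k ^+ 2 by rewrite divr_ge0// sqr_ge0.
  under eq_integral do rewrite EFinM; rewrite ge0_integralZl//; last first.
    by apply/measurable_EFinP; exact: measurable_funB.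
  under eq_integral do rewrite EFinB.
  rewrite integralB// integral_cst// probability_measure_setT mule1.
  rewrite -[X in (_ - X)%E]fineK; last exact: integrable_fin_num ci.
  by rewrite -/(Rintegral _ _ _) cosX -EFinB -EFinM.
have Elim : (\int[P]_w (f k w)%:E)%E @[k --> \oo] --> q%:E.
  under eq_fun do rewrite Ef.
  apply: cvg_EFin; first exact: nearW.
  have [->|qN0] := eqVneq q 0.
    by apply: cvg_near_cst; apply: nearW => k; rewrite /= mulr0 mul0r oppr0 expR0 subrr mulr0.
  pose h k := - (del k ^+ 2 * q / 2).
  have dN0 k : del k != 0 by rewrite gt_eqF.
  have hN0 k : h k != 0 by rewrite oppr_eq0 !mulf_neq0 ?invr_neq0 ?expf_neq0.
  have hlim : h k @[k --> \oo] --> (0 : R).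
    rewrite -[X in _ --> X](_ : - (0 * 0 * q / 2) = 0); last by rewrite !mul0r oppr0.
    apply: cvgN; apply: cvgMr_tmp; apply: cvgMr_tmp.
    by under eq_fun do rewrite expr2; exact: cvgM.
  have explim : h^-1 * (expR h - 1) @[h --> 0^'] --> (1 : R).
    have [/cvg_ex[l dl] E] := is_derive_expR (0 : R).
    have : l = 1 by rewrite -expR0 -E /derive; apply/esym/cvg_lim.
    move=> l1; move: dl; rewrite l1; apply: cvg_trans; apply: near_eq_cvg.
    by apply: nearW => x; rewrite /= expR0 addr0 /GRing.scale/= mulr1.
  move/cvgr_dnbhsP : explim => /(_ h (conj hN0 hlim)) H.
  have : q * ((h k)^-1 * (expR (h k) - 1)) @[k --> \oo] --> q * 1.
    by apply: cvgM; [exact: cvg_cst|exact: H].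
  rewrite mulr1; apply: cvg_trans; apply: near_eq_cvg.
  apply: nearW => k /=; rewrite -/(h k) {1}/h; field.
  by rewrite dN0 qN0.
apply/eqP; rewrite eq_le; apply/andP; split.
  have fat := @fatou _ _ _ P setT measurableT (fun k w => (f k w)%:E) mf
    (fun k w _ => f0 k w).
  rewrite -[leRHS](cvg_limn_einf_sup Elim).1; apply: le_trans fat.
  rewrite le_eqVlt; apply/orP; left; apply/eqP; apply: eq_integral => w _.
  have fw : (f k w)%:E @[k --> \oo] --> (X w ^+ 2)%:E.
    by apply: cvg_EFin; [exact: nearW|exact: flim].
  by rewrite (cvg_limn_einf_sup fw).1.
have := cvg_lim _ Elim => <-//; apply: lime_le.
  by apply/cvg_ex; exists q%:E.
apply: nearW => k; apply: ge0_le_lower_integral => w _; rewrite lee_fin.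
- exact: f0.
- exact: fX.
Qed.

End GaussianVariable.

(** * Smooth bump functions *)

Section SmoothCalculus.
Context {R : realType} {n : nat}.
Implicit Types (U : set 'rV[R]_n) (f g : 'rV[R]_n -> R) (k : nat).

(** [C^k] functions, in the recursive form that lends itself to induction. *)
Fixpoint Ck_on k U f : Prop :=
  (forall x, U x -> {for x, continuous f} /\
     forall a : 'I_n, derivable f x (delta_mx 0 a)) /\
  if k is k'.+1 then forall a, Ck_on k' U (partial a f) else True.

Lemma iter_partial_rcons l (a : 'I_n) f :
  iter_partial (rcons l a) f = iter_partial l (partial a f).
Proof. by rewrite /iter_partial foldr_rcons. Qed.

Lemma smooth_on_Ck U f : smooth_on U f <-> forall k, Ck_on k U f.
Proof.
split=> [sf k|Cf l].
  elim: k f sf => [|k IH] f sf; first by split => // x Ux; exact: (sf [::]).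
  split=> [x Ux|a]; first exact: (sf [::]).
  by apply: IH => l x Ux; rewrite -iter_partial_rcons; exact: sf.
move: (Cf (size l)) => {Cf}; elim/last_ind: l f => [|l a IH] f.
  by move=> [Cf _].
by rewrite size_rcons => -[_ /(_ a)] /IH; rewrite iter_partial_rcons.
Qed.

Lemma Ck_onS k U f : Ck_on k.+1 U f -> Ck_on k U f.
Proof.
elim: k f => [|k IH] f; first by case=> Cf _.
by move=> [Cf Df]; split => // a; apply: IH; exact: Df.
Qed.

Lemma Ck_on_ext k U f g : open U -> (forall x, U x -> f x = g x) ->
  Ck_on k U f -> Ck_on k U g.
Proof.
move=> oU; have nearU f' g' x : U x -> (forall x, U x -> f' x = g' x) ->
    \forall y \near x, (f' : _ -> R) y = g' y.
  by move=> Ux fg; move: (open_nbhs_nbhs (conj oU Ux)); apply: filterS => y; exact: fg.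
have base f' g' : (forall x, U x -> f' x = g' x) ->
    (forall x, U x -> {for x, continuous f'} /\ forall a, derivable f' x (delta_mx 0 a)) ->
    forall x, U x -> {for x, continuous (g' : _ -> R)} /\
    forall a, derivable g' x (delta_mx 0 a).
  move=> fg Cf x Ux; have [cf df] := Cf x Ux; have nfg := nearU _ _ _ Ux fg; split.
    by rewrite /prop_for /continuous_at -fg//; apply: cvg_trans cf; exact: near_eq_cvg nfg.
  by move=> a; exact: near_eq_derivable nfg (df a).
elim: k f g => [|k IH] f g fg [Cf Df]; (split; first exact: base fg Cf); first by [].
by move=> a; apply: IH (Df a) => x Ux; apply: near_eq_derive; exact: nearU.
Qed.

Lemma Ck_on_cst k U (c : R) : Ck_on k U (fun=> c).
Proof.
elim: k c => [|k IH] c; split => //.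
- by move=> x _; split => [|a]; [exact: cst_continuous|exact: derivable_cst].
- by move=> x _; split => [|a]; [exact: cst_continuous|exact: derivable_cst].
- move=> a; rewrite (_ : partial a _ = fun=> 0); first exact: IH.
  by apply/funext => x; rewrite /partial derive_cst.
Qed.

Lemma Ck_onD k U f g : open U -> Ck_on k U f -> Ck_on k U g ->
  Ck_on k U (fun x => f x + g x).
Proof.
move=> oU; have base f' g' : (forall x, U x -> {for x, continuous f'} /\
    forall a, derivable f' x (delta_mx 0 a)) -> (forall x, U x ->
    {for x, continuous g'} /\ forall a, derivable g' x (delta_mx 0 a)) ->
    forall x, U x -> {for x, continuous (fun x => f' x + g' x : R)} /\
    forall a, derivable (fun x => f' x + g' x) x (delta_mx 0 a).
  move=> Cf Cg x Ux; have [cf df] := Cf _ Ux; have [cg dg] := Cg _ Ux.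
  by split => [|a]; [exact: (cvgD cf cg)|exact: (derivableD (df a) (dg a))].
elim: k f g => [|k IH] f g [Cf Df] [Cg Dg]; (split; first exact: base); first by [].
move=> a; apply: Ck_on_ext (IH _ _ (Df a) (Dg a)) => // x Ux.
have [_ df] := Cf _ Ux; have [_ dg] := Cg _ Ux.
by rewrite /partial [RHS](@deriveD _ _ _ f g).
Qed.

Lemma Ck_onM k U f g : open U -> Ck_on k U f -> Ck_on k U g ->
  Ck_on k U (fun x => f x * g x).
Proof.
move=> oU; have base f' g' : (forall x, U x -> {for x, continuous f'} /\
    forall a, derivable f' x (delta_mx 0 a)) -> (forall x, U x ->
    {for x, continuous g'} /\ forall a, derivable g' x (delta_mx 0 a)) ->
    forall x, U x -> {for x, continuous (fun x => f' x * g' x : R)} /\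
    forall a, derivable (fun x => f' x * g' x) x (delta_mx 0 a).
  move=> Cf Cg x Ux; have [cf df] := Cf _ Ux; have [cg dg] := Cg _ Ux.
  by split => [|a]; [exact: (cvgM cf cg)|exact: (derivableM (df a) (dg a))].
elim: k f g => [|k IH] f g Cf0 Cg0; have [Cf Df] := Cf0; have [Cg Dg] := Cg0;
  (split; first exact: base); first by [].
move=> a; have Cfk := Ck_onS Cf0; have Cgk := Ck_onS Cg0.
apply: Ck_on_ext (Ck_onD oU (IH _ _ Cfk (Dg a)) (IH _ _ Cgk (Df a))) => // x Ux.
have [_ df] := Cf _ Ux; have [_ dg] := Cg _ Ux.
by rewrite /partial [RHS](@deriveM _ _ f g).
Qed.

Lemma Ck_on_prod k U (I : Type) (s : seq I) (F : I -> 'rV[R]_n -> R) : open U ->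
  (forall i, Ck_on k U (F i)) -> Ck_on k U (fun x => \prod_(i <- s) F i x).
Proof.
move=> oU CF; elim: s => [|i s IH].
  by under eq_fun do rewrite big_nil; exact: Ck_on_cst.
by under eq_fun do rewrite big_cons; exact: Ck_onM.
Qed.

Lemma is_derive_line f (x v : 'rV[R]_n) (df : R) :
  is_derive x v f df <-> is_derive (0 : R) (1 : R) (fun h => f (h *: v + x)) df.
Proof.
have E : (fun h : R => h^-1 *: (f (h *: v + x) - f x)) =
    (fun h : R => h^-1 *: (f ((h *: (1 : R) + 0) *: v + x) - f ((0 : R) *: v + x))).
  apply/funext => h; rewrite scale0r add0r addr0; congr (_ *: (f (_ *: _ + _) - _)).
  by rewrite /GRing.scale/= mulr1.
by split => -[D1 D2]; split; rewrite /derivable /derive /= ?E// -?E// in D1 D2 *.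
Qed.

(** Post-composition with a family of one-variable functions that is closed under
    derivation: as the partial derivatives of [e \o f] are taken along lines, the
    one-variable chain rule is enough. *)
Lemma Ck_on_comp k U (I : Type) (e : I -> R -> R) (D : I -> I) f : open U ->
  (forall i y, is_derive y (1 : R) (e i) (e (D i) y)) ->
  Ck_on k U f -> forall i, Ck_on k U (fun x => e i (f x)).
Proof.
move=> oU De; have chain f' x a i : derivable f' x (delta_mx 0 a) ->
    is_derive x (delta_mx 0 a) (fun x => e i (f' x)) (e (D i) (f' x) * partial a f' x).
  move=> df; have : is_derive x (delta_mx 0 a) f' (partial a f' x) by split.
  move=> /is_derive_line d1; apply/is_derive_line.
  have d2 : is_derive (f' ((0 : R) *: delta_mx 0 a + x)) (1 : R) (e i) (e (D i) (f' x)).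
    by rewrite scale0r add0r; exact: De.
  exact: (@is_derive1_comp _ (e i) (fun h => f' (h *: delta_mx 0 a + x)) 0 _ _ d2 d1).
have ce i : continuous (e i).
  by move=> y; apply: differentiable_continuous; apply/derivable1_diffP; case: (De i y).
have base f' i : (forall x, U x -> {for x, continuous f'} /\
    forall a, derivable f' x (delta_mx 0 a)) ->
    forall x, U x -> {for x, continuous (fun x => e i (f' x))} /\
    forall a, derivable (fun x => e i (f' x)) x (delta_mx 0 a).
  move=> Cf x Ux; have [cf df] := Cf _ Ux; split => [|a]; last by case: (chain _ _ _ i (df a)).
  by apply: (@continuous_comp _ _ _ f' (e i)) => //; exact: ce.
elim: k f => [|k IH] f Cf0 i; have [Cf Df] := Cf0; (split; first exact: base); first by [].
move=> a; apply: Ck_on_ext (Ck_onM oU (IH _ (Ck_onS Cf0) (D i)) (Df a)) => // x Ux.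
have [_ df] := Cf _ Ux.
by apply/esym; rewrite /partial; case: (chain _ _ _ i (df a)).
Qed.

End SmoothCalculus.

Section FlatFunction.
Context {R : realType}.
Implicit Types (p : {poly R}) (y z h : R).

(** The flat functions [p(1/y) e^(-1/y)] for [y > 0], extended by 0; this family is
    closed under derivation, [p] becoming [X^2 (p - p')]. *)
Definition flat p y : R := if 0 < y then p.[y^-1] * expR (- y^-1) else 0.

Definition flat_deriv p : {poly R} := 'X^2 * (p - p^`()).

(** [z^i e^(-z) <= i!], as [z^i / i!] is a term of the exponential series. *)
Lemma poly_expR_bounded p : exists2 C, 0 <= C &
  forall z, 0 < z -> `|p.[z]| * expR (- z) <= C.
Proof.
exists (\sum_(i < size p) `|p`_i| * i`!%:R); first by apply: sumr_ge0 => i _; rewrite mulr_ge0.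
move=> z z0; rewrite expRN ler_pdivrMr ?expR_gt0// horner_coef.
apply: le_trans (ler_norm_sum _ _ _) _; rewrite mulr_suml; apply: ler_sum => i _.
rewrite normrM -mulrA ler_wpM2l// ger0_norm ?exprn_ge0 ?(ltW z0)//.
case: (nat_of_ord i) => [|j]; first by rewrite expr0 fact0 mul1r -expR0 ler_expR ltW.
rewrite -ler_pdivrMl ?ltr0n ?fact_gt0//; apply: le_trans (expR_ge1Dxn j (ltW z0)).
by rewrite mulrC lerDr.
Qed.

(** This makes the derivative at 0 vanish, whatever [p]. *)
Lemma flat_quadratic p : exists2 C, 0 <= C & forall y, `|flat p y| <= C * y ^+ 2.
Proof.
have [C C0 CP] := poly_expR_bounded ('X^2 * p); exists C => // y.
rewrite /flat; case: ifPn => [y0|_]; last by rewrite normr0 mulr_ge0// sqr_ge0.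
have := CP y^-1; rewrite invr_gt0 => /(_ y0); rewrite hornerM hornerXn normrM.
rewrite (ger0_norm (sqr_ge0 y^-1)) exprVn -mulrA ler_pdivrMl ?exprn_gt0// => H.
by rewrite normrM (ger0_norm (expR_ge0 _)) [C * _]mulrC.
Qed.

Lemma is_derive_flat p y : is_derive y (1 : R) (flat p) (flat (flat_deriv p) y).
Proof.
have [y0|y0|->] := ltgtP y 0.
- have nf : \forall x \near y, (fun=> 0 : R) x = flat p x.
    near=> x; rewrite /flat ltNge.
    have -> // : x <= 0; rewrite ltW//; near: x; exact: lt_nbhsl.
  have -> : flat (flat_deriv p) y = 0 by rewrite /flat ltNge (ltW y0).
  exact: (near_eq_is_derive nf (is_derive_cst 0 y 1)).
- have nf : \forall x \near y, (fun x => p.[x^-1] * expR (- x^-1)) x = flat p x.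
    by near=> x; rewrite /flat ifT//; near: x; exact: lt_nbhsr.
  apply: (near_eq_is_derive nf).
  have yN0 : y != 0 by rewrite gt_eqF.
  have dV : is_derive y (1 : R) (fun x => x^-1) (- y ^- 2).
    have := is_deriveV yN0 (is_derive_id y (1 : R)).
    by move=> H; apply: is_derive_eq; rewrite /GRing.scale/= mulr1.
  have dN : is_derive y (1 : R) (fun x => - x^-1) (y ^- 2).
    by apply: is_derive_eq; rewrite opprK.
  have dE := @is_derive1_comp _ expR (fun x => - x^-1) y _ _ (is_derive_expR _) dN.
  have dp := @is_derive1_comp _ (horner p) (fun x => x^-1) y _ _ (is_derive_poly p _) dV.
  apply: is_derive_eq.
  rewrite /flat ifT// /flat_deriv hornerM hornerXn hornerD hornerN.
  have sM (a b : R) : a *: b = a * b by [].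
  rewrite !sM -!exprVn; move: (expR _) => E; move: p^`().[_] => B.
  by move: p.[_] => A; move: y^-1 => z; ring.
- have -> : flat (flat_deriv p) 0 = 0 by rewrite /flat ltxx.
  have [C C0 CP] := flat_quadratic p.
  have lim0 : h^-1 *: ((flat p \o shift 0) (h *: (1 : R)) - flat p 0) @[h --> 0^'] --> (0 : R).
    have C1 : 0 < C + 1 by rewrite ltr_wpDl.
    apply/cvgrPdist_le => e e0; near=> h.
    rewrite sub0r normrN /= addr0 {2}/flat ltxx subr0 /GRing.scale/= mulr1.
    have hN0 : h != 0 by near: h; exact: nbhs_dnbhs_neq.
    rewrite normrM normfV ler_pdivrMl ?normr_gt0//.
    apply: le_trans (CP h) _; rewrite -[h ^+ 2]real_normK ?num_real// expr2 mulrA mulrC ler_wpM2l//.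
    have hC : `|h| <= e / (C + 1).
      near: h; apply: nbhs_dnbhs; apply/nbhs_ballP; exists (e / (C + 1)) => /=.
        by rewrite divr_gt0.
      by move=> h; rewrite /ball/= sub0r normrN => /ltW.
    apply: (@le_trans _ _ ((C + 1) * `|h|)); first by rewrite ler_wpM2r// lerDl.
    by rewrite mulrC -ler_pdivlMr.
  split; first by apply/cvg_ex; exists 0.
  by apply/cvg_lim.
Unshelve. all: by end_near. Qed.

End FlatFunction.

Section Bump.
Context {R : realType} {n : nat} (M : riemannian_manifold R n).
Implicit Types (i j : chart M) (x y : 'rV[R]_n) (p : M) (e : R).

Lemma Ck_on_setU k (U V : set 'rV[R]_n) (f : 'rV[R]_n -> R) :
  Ck_on k U f -> Ck_on k V f -> Ck_on k (U `|` V) f.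
Proof.
elim: k f => [|k IH] f [Uf DUf] [Vf DVf]; split => //.
- by move=> x [/Uf|/Vf].
- by move=> x [/Uf|/Vf].
- by move=> a; exact: (IH _ (DUf a) (DVf a)).
Qed.

Lemma psiK i x : cod i x -> dom i (psi i x) /\ phi i (psi i x) = x.
Proof. by move=> [p ip <-]; rewrite phiK. Qed.

Lemma open_coord i (O : set M) : open O -> open (cod i `&` psi i @^-1` O).
Proof.
move=> oO; rewrite openE => x [ix Ox]; apply: filterI.
  by apply: open_nbhs_nbhs; split => //; exact: cod_open.
by apply: (psi_continuous ix); exact: open_nbhs_nbhs.
Qed.

Definition box x e : set 'rV[R]_n := [set y | forall a, `|y 0 a - x 0 a| <= e].

Lemma box_compact x e : compact (box x e).
Proof.
have := @rV_compact R n (fun a => `[x 0 a - e, x 0 a + e]%classic)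
  (fun a => @segment_compact _ _ _).
congr compact; apply/seteqP; split => y /= By a; have := By a;
  by rewrite in_itv/= ler_distl.
Qed.

(** A product over the coordinates, so that one-variable calculus suffices; it is
    positive exactly inside a box, rather than a ball. *)
Definition smooth_bump i x e p : R := if `[< dom i p >]
  then \prod_(a < n) flat 1 (e ^+ 2 - (phi i p 0 a - x 0 a) ^+ 2) else 0.

Lemma flat_ge0 (y : R) : 0 <= flat 1 y.
Proof. by rewrite /flat; case: ifP => // _; rewrite hornerC mul1r expR_ge0. Qed.

Lemma bump_ge0 i x e p : 0 <= smooth_bump i x e p.
Proof. by rewrite /smooth_bump; case: ifP => // _; apply: prodr_ge0 => a _; exact: flat_ge0. Qed.

Lemma bump_support i x e p : 0 <= e -> box x e `<=` cod i ->
  smooth_bump i x e p != 0 -> (psi i @` box x e) p /\ dom i p.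
Proof.
move=> e0 Bi; rewrite /smooth_bump; case: asboolP => [ip|_]; last by rewrite eqxx.
move=> p0; split => //; exists (phi i p); last exact: phiK.
move=> a; rewrite leNgt; apply/negP => ea; move: p0.
rewrite (bigD1 a)//= /flat ifF ?mul0r ?eqxx//.
apply/negP; rewrite subr_gt0 -[ltLHS]real_normK ?num_real// ltNge => /negP; apply.
by rewrite lerXn2r ?nnegrE// ltW.
Qed.

Lemma bump_support_compact i x e : box x e `<=` cod i -> compact (psi i @` box x e).
Proof.
move=> Bi; apply: continuous_compact; last exact: box_compact.
apply: continuous_in_subspaceT => y; rewrite inE => /Bi iy; exact: psi_continuous.
Qed.

(** In another chart [j], the bump is smooth on the overlap with the domain of [i],
    where the transition map is smooth, and vanishes off its compact support; these
    two open sets cover the chart, as the support lies in the domain of [i]. *)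
Lemma bump_test_function i x e : 0 <= e -> box x e `<=` cod i ->
  test_function (smooth_bump i x e).
Proof.
move=> e0 Bi; have cK := bump_support_compact Bi; set K := psi i @` _ in cK.
have u0 p : ~ K p -> smooth_bump i x e p = 0.
  move=> Kp; have [//|up] := eqVneq (smooth_bump i x e p) 0.
  by have [] := bump_support e0 Bi up.
split; last by exists K.
move=> j; apply/smooth_on_Ck => k.
have oV := @open_coord j (~` K) (closed_openC (compact_closed (@rm_hausdorff _ _ M) cK)).
have oW := @open_coord j (dom i) (dom_open i).
set V := _ `&` _ in oV; set W := _ `&` _ in oW.
have -> : cod j = W `|` V.
  apply/seteqP; split => [y jy|y [[]|[]]//].
  have [ip|ip] := pselect (dom i (psi j y)); [left|right]; split => //= -[z /Bi iz zy].
  by apply: ip; rewrite -zy; have [] := psiK iz.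
apply: Ck_on_setU.
- have E y : W y -> \prod_(a < n) flat 1 (e ^+ 2 +
      (-1) * (((phi i \o psi j) y 0 a + - x 0 a) * ((phi i \o psi j) y 0 a + - x 0 a)))
      = (smooth_bump i x e \o psi j) y.
    move=> [_ iy]; rewrite /smooth_bump/= ifT; last exact/asboolP.
    by apply: eq_bigr => a _; rewrite mulN1r expr2.
  apply: (Ck_on_ext oW E); apply: Ck_on_prod => // a.
  apply: (@Ck_on_comp _ _ k W {poly R} (@flat R) (@flat_deriv R)) => //.
    by move=> q z; exact: is_derive_flat.
  have Cf : Ck_on k W (fun y => (phi i \o psi j) y 0 a + - x 0 a).
    apply: Ck_onD => //; last exact: Ck_on_cst.
    move: (@transition_smooth _ _ M j i a) => /smooth_on_Ck/(_ k).
    suff -> : phi j @` (dom j `&` dom i) = W by [].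
    apply/seteqP; split => [_ [p [jp ip] <-]|y [jy iy]].
      by split; [exists p|rewrite /= phiK].
    by have [jz zy] := psiK jy; exists (psi j y).
  by apply: Ck_onD => //; [exact: Ck_on_cst|apply: Ck_onM => //; [exact: Ck_on_cst|exact: Ck_onM]].
- have E y : V y -> 0 = (smooth_bump i x e \o psi j) y by move=> [_ /u0].
  exact: Ck_on_ext oV E (Ck_on_cst _ _ _).
Qed.

Lemma test_functionZ (c : R) (u : M -> R) : test_function u ->
  test_function (fun p => c * u p).
Proof.
move=> [su [K cK uK]]; split; last by exists K => // p /uK ->; rewrite mulr0.
move=> i; apply/smooth_on_Ck => k; apply: Ck_onM; first exact: cod_open.
  exact: Ck_on_cst.
by move/smooth_on_Ck: (su i).
Qed.

Lemma test_function0 : test_function (fun _ : M => 0 : R).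
Proof.
split; last by exists set0; first exact: compact0.
by move=> i; apply/smooth_on_Ck => k; exact: Ck_on_cst.
Qed.

Lemma box_cod p i e : dom i p -> 0 < e ->
  exists2 e', 0 < e' <= e & box (phi i p) e' `<=` cod i.
Proof.
move=> ip e0; have : nbhs (phi i p) (cod i).
  by apply: open_nbhs_nbhs; split; [exact: cod_open|exists p].
move=> /nbhs_ballP[r/= r0 rB]; exists (Num.min e (r / 2)).
  by rewrite lt_min e0 divr_gt0//= ge_min lexx.
move=> y By; apply: rB; rewrite /ball/=; split => // a b; rewrite (ord1 a).
rewrite /ball/= distrC; apply: le_lt_trans (By b) _.
by rewrite gt_min (ltr_pdivrMr _ _ (ltr0n _ 2)) ltr_pMr// ltr1n orbT.
Qed.

Lemma box_nbhs p i e : dom i p -> 0 < e ->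
  nbhs p (dom i `&` phi i @^-1` [set y | forall a, `|y 0 a - phi i p 0 a| < e]).
Proof.
move=> ip e0; apply: filterI; first exact: (open_nbhs_nbhs (conj (dom_open i) ip)).
apply: (phi_continuous ip); apply/nbhs_ballP; exists e => //= y.
move=> [_ B] a; rewrite distrC; exact: B.
Qed.

End Bump.

(** * The volume measure *)

Section PositiveDefinite.
Context {R : realType} {n : nat}.

(** Along the segment from [A] to the identity every matrix is positive definite,
    hence invertible, so that the determinant keeps the sign it has at the identity. *)
Lemma det_gt0_posdef (A : 'M[R]_n) :
  (forall v : 'rV[R]_n, v != 0 -> 0 < (v *m A *m v^T) 0 0) -> 0 < \det A.
Proof.
move=> A0; pose Q : 'M[{poly R}]_n :=
  map_mx polyC A + 'X *: (map_mx polyC (1%:M - A)).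
have QE t : (\det Q).[t] = \det (A + t *: (1%:M - A)).
  rewrite -[LHS]/(horner_eval t (\det Q)) -det_map_mx; congr (\det _).
  by apply/matrixP => i j; rewrite !mxE /= /horner_eval hornerD hornerM hornerX !hornerC.
have [//|dA] := ltP 0 (\det A).
have H0 : (\det Q).[0] <= 0 <= (\det Q).[1].
  by rewrite !QE scale0r addr0 dA scale1r addrC subrK det1 ler01.
have [t /andP[t0 t1]] := @Num.poly_ivt R (\det Q) 0 1 ler01 H0.
move=> /rootP; rewrite QE => /eqP/det0P[v v0 /(congr1 (fun w => (w *m v^T) 0 0))].
have sq : 0 < (v *m v^T) 0 0.
  have [a va] : exists a, v 0 a != 0.
    apply/existsP; apply: contraNT v0; rewrite negb_exists => /forallP v0.
    by apply/eqP/rowP => a; rewrite mxE; apply/eqP; have := v0 a; rewrite negbK.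
  rewrite mxE (bigD1 a)//= mxE ltr_pwDl//; first by rewrite -expr2 exprn_even_gt0.
  by apply: sumr_ge0 => b _; rewrite mxE -expr2 sqr_ge0.
have -> : v *m (A + t *: (1%:M - A)) *m v^T =
    (1 - t) *: (v *m A *m v^T) + t *: (v *m v^T).
  rewrite mulmxDr -scalemxAr mulmxBr mulmx1 mulmxDl -scalemxAl mulmxBl.
  by rewrite scalerBr scalerBl scale1r addrAC addrA.
rewrite mul0mx !mxE/= => /eqP; rewrite gt_eqF//.
have := A0 _ v0; have := sq; rewrite !mxE => s0 a0.
have [->|t1'] := eqVneq t 1; first by rewrite subrr mul0r add0r mul1r.
by rewrite ltr_pwDl// ?mulr_gt0// ?mulr_ge0 ?(ltW s0)// subr_gt0 lt_neqAle t1'.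
Qed.

Lemma det_continuous_at (T : topologicalType) (x : T) (A : T -> 'M[R]_n) :
  (forall i j, {for x, continuous (fun y => A y i j)}) ->
  {for x, continuous (fun y => \det (A y))}.
Proof.
move=> cA; have cprod (s : seq 'I_n) (F : 'I_n -> T -> R) :
    (forall i, {for x, continuous (F i)}) ->
    {for x, continuous (fun y => \prod_(i <- s) F i y)}.
  move=> cF; elim: s => [|i s IH].
    have -> : (fun y => \prod_(i <- [::]) F i y) = fun=> 1 by apply/funext => y; rewrite big_nil.
    exact: cst_continuous.
  have -> : (fun y => \prod_(j <- i :: s) F j y) = fun y => F i y * \prod_(j <- s) F j y.
    by apply/funext => y; rewrite big_cons.
  exact: (cvgM (cF i) IH).
have csum (I : Type) (s : seq I) (F : I -> T -> R) :
    (forall i, {for x, continuous (F i)}) ->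
    {for x, continuous (fun y => \sum_(i <- s) F i y)}.
  move=> cF; elim: s => [|i s IH].
    have -> : (fun y => \sum_(i <- [::]) F i y) = fun=> 0 by apply/funext => y; rewrite big_nil.
    exact: cst_continuous.
  have -> : (fun y => \sum_(j <- i :: s) F j y) = fun y => F i y + \sum_(j <- s) F j y.
    by apply/funext => y; rewrite big_cons.
  exact: (cvgD (cF i) IH).
have cZ (c : R) (f : T -> R) :
    {for x, continuous f} -> {for x, continuous (fun y => c * f y)}.
  by move=> cf; exact: (cvgM (cvg_cst c) cf).
apply: csum => s; apply: cZ; apply: (cprod _ (fun i y => A y i (s i))) => i.
exact: cA.
Qed.

End PositiveDefinite.

Section TupleBox.
Context {R : realType}.
Notation RT := (measurableTypeR R).

Definition tuple_box n (c : 'I_n -> R) (e : R) : set (n.-tuple RT) :=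
  [set t | forall a, `|tnth t a - c a| <= e].

Lemma measurable_tuple_box n (c : 'I_n -> R) e : measurable (tuple_box c e).
Proof.
rewrite (_ : tuple_box c e = \bigcap_(a in [set: 'I_n])
    ((fun t : n.-tuple RT => tnth t a) @^-1` `[c a - e, c a + e]%classic)).
  apply: fin_bigcap_measurable; first exact: finite_finset.
  move=> a _; rewrite -[X in measurable X]setTI; exact: measurable_tnth.
apply/seteqP; split => t /= Bt a => [_|]; first by rewrite /= in_itv/= -ler_distl.
by have := Bt a Logic.I; rewrite /= in_itv/= -ler_distl.
Qed.

Lemma lebesgue_tuple_box n (c : 'I_n -> R) e : 0 < e ->
  lebesgue_tuple n (tuple_box c e) = (((e *+ 2) ^+ n)%:E)%E.
Proof.
move=> e0; elim: n c => [|n IH] c.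
  rewrite expr0 /= diracE mem_set//; by case.
rewrite /= /leb_step /pushforward.
rewrite (_ : _ @^-1` _ = `[c ord0 - e, c ord0 + e]%classic `*`
    tuple_box (fun a => c (lift ord0 a)) e).
  rewrite product_measure1E; last 2 first.
  - exact: measurable_itv.
  - exact: measurable_tuple_box.
  have Le : lebesgue_measure (`[c ord0 - e, c ord0 + e]%classic : set R) = (e *+ 2)%:E.
    rewrite lebesgue_measure_itv/= lte_fin ltrD2l gtrN// -EFinB.
    by rewrite opprB addrC subrKA mulr2n.
  transitivity ((e *+ 2)%:E * ((e *+ 2) ^+ n)%:E)%E; last by rewrite -EFinM exprS.
  by rewrite IH; congr (_ * _)%E.
apply/seteqP; split => -[x t] /=.
  move=> B; split; first by have := B ord0; rewrite /tnth/= in_itv/= -ler_distl.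
  by move=> a; have := B (lift ord0 a); rewrite tnthS.
move=> [Bx Bt] a; case: (unliftP ord0 a) => [b ->|->].
  by rewrite tnthS; exact: Bt.
by move: Bx; rewrite in_itv/= -ler_distl.
Qed.

End TupleBox.

Section ManifoldVolume.
Context {R : realType} {n : nat} (M : riemannian_manifold R n).
Implicit Types (i j : chart M) (x y : 'rV[R]_n) (p : M) (e : R).

Lemma open_borel (O : set M) : open O -> measurable (O : set (borel M)).
Proof. by move=> oO; apply: sub_sigma_algebra. Qed.

Lemma compact_borel (K : set M) : compact K -> measurable (K : set (borel M)).
Proof.
move=> cK; rewrite -(setCK K); apply: measurableC; apply: open_borel.
by apply: closed_openC; apply: compact_closed cK; exact: rm_hausdorff.
Qed.

Lemma continuous_borel (f : M -> R) : continuous f ->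
  measurable_fun setT (f : borel M -> R).
Proof.
move=> /continuousP cf; apply: (measurability _ (RGenOpens.measurableE R)).
move=> _ [_ [a [b ->] <-]]; rewrite setTI; apply: open_borel.
exact/cf/interval_open.
Qed.

Lemma sqrt_det_bounds i p : dom i p -> exists r c C : R,
  [/\ 0 < r, 0 < c & forall y, box (phi i p) r y -> c <= sqrt_det i y <= C].
Proof.
move=> ip; set x := phi i p.
have ix : cod i x by exists p.
have cd : {for x, continuous (sqrt_det i)}.
  have cdet : {for x, continuous (fun y => \det (metric i y))}.
    by apply: det_continuous_at => a b; have [] := metric_smooth a b [::] ix.
  exact: (continuous_comp cdet (@sqrt_continuous R _)).
have d0 : 0 < sqrt_det i x.
  by rewrite sqrtr_gt0; apply: det_gt0_posdef => v v0; exact: metric_pos.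
have /nbhs_ballP[r/= r0 rB] : nbhs x [set y | `|sqrt_det i x - sqrt_det i y| < sqrt_det i x / 2].
  by move/cvgrPdist_lt : cd => /(_ (sqrt_det i x / 2)); apply; rewrite divr_gt0.
exists (r / 2), (sqrt_det i x / 2), (2 * sqrt_det i x); split; rewrite ?divr_gt0//.
move=> y By; have : `|sqrt_det i x - sqrt_det i y| < sqrt_det i x / 2.
  apply: rB; rewrite /ball/=; split => // a b; rewrite (ord1 a).
  rewrite /ball/= distrC; apply: le_lt_trans (By b) _.
  by rewrite (ltr_pdivrMr _ _ (ltr0n _ 2)) ltr_pMr// ltr1n.
by rewrite ltr_distl => /andP[] *; apply/andP; split; lra.
Qed.

Variables (vol : {measure set (borel M) -> \bar R}) (hvol : is_volume_measure vol).

(** Small boxes are those on which the density stays between two positive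
    constants. *)
Lemma volume_box i p : dom i p -> exists2 r, 0 < r & forall e, 0 < e <= r ->
  box (phi i p) e `<=` cod i /\
  (0 < vol (psi i @` box (phi i p) e) < +oo)%E.
Proof.
move=> ip; have [r [c [C [r0 c0 bd]]]] := sqrt_det_bounds ip.
have [r' /andP[r'0 r'r] Bi] := box_cod ip r0; exists r' => // e /andP[e0 er'].
have {}Bi : box (phi i p) e `<=` cod i.
  by move=> y By; apply: Bi => a; exact: le_trans (By a) er'.
split => //; have mK := compact_borel (bump_support_compact Bi).
rewrite (hvol (i := i) mK); last by move=> _ [y /Bi iy <-]; have [] := psiK iy.
rewrite (_ : [set t | _] = tuple_box (phi i p 0) e); last first.
  have rE (t : n.-tuple (measurableTypeR R)) :
      box (phi i p) e (row_of_tuple t) <-> tuple_box (phi i p 0) e t.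
    by split => B a; have := B a; rewrite mxE.
  apply/seteqP; split => t.
    move=> [_ [y By <-] yt]; apply/rE; rewrite -yt.
    by have [_ ->] := psiK (Bi _ By).
  move=> /rE By; exists (psi i (row_of_tuple t)); first by exists (row_of_tuple t).
  by have [_ ->] := psiK (Bi _ By).
have mB := measurable_tuple_box (phi i p 0) e.
have lB := lebesgue_tuple_box (phi i p 0) e0.
have bt t : tuple_box (phi i p 0) e t -> c <= sqrt_det i (row_of_tuple t) <= C.
  move=> Bt; apply: bd => a; rewrite mxE; apply: le_trans (Bt a) _.
  exact: le_trans er' r'r.
set I := (\int[_]_(t in _) _)%E.
have lo : ((c * (e *+ 2) ^+ n)%:E <= I)%E.
  rewrite EFinM -lB -integral_cst//.
  by apply: ge0_le_lower_integral => t /bt /andP[ct _]; rewrite lee_fin// ltW.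
have hi : (I <= (C * (e *+ 2) ^+ n)%:E)%E.
  rewrite EFinM -lB -integral_cst//.
  apply: ge0_le_lower_integral => t /bt /andP[ct tC]; rewrite lee_fin//.
  exact: le_trans (ltW c0) ct.
apply/andP; split; last by apply: le_lt_trans hi _; exact: ltry.
by apply: lt_le_trans lo; rewrite lte_fin mulr_gt0// exprn_gt0// mulrn_wgt0.
Qed.

Lemma countable_basis : exists2 B : nat -> set M, forall k, open (B k) &
  forall p (U : set M), nbhs p U -> exists k, B k p /\ B k `<=` U.
Proof.
have [B /countable_injP[f injf] [oB nB]] := @rm_second_countable _ _ M.
exists (fun k => \bigcup_(U in [set U | B U /\ f U = k]) U).
  by move=> k; apply: bigcup_open => U [/oB].
move=> p U /nB[V [BV Vp] VU]; exists (f V); split; first by exists V.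
move=> q [W [BW fWV] Wq]; apply: VU.
by rewrite -(injf W V) ?inE//.
Qed.

(** The sets of finite volume in a countable basis cover the manifold. *)
Lemma volume_sigma_finite : sigma_finite setT vol.
Proof.
have [B oB nB] := countable_basis.
exists (fun k => if `[< (vol (B k) < +oo)%E >] then B k else set0).
  apply/seteqP; split => // p _.
  have ip := chart_atP p; have [r r0 /(_ r)] := volume_box ip.
  rewrite r0 lexx => /(_ isT)[Bi /andP[_ fin]].
  have [k [Bk kr]] := nB _ _ (box_nbhs ip r0).
  exists k => //; rewrite ifT//; apply/asboolP; apply: le_lt_trans fin.
  apply: le_measure; rewrite ?inE; [exact: open_borel|
    exact: compact_borel (bump_support_compact Bi)|].
  move=> q /kr[iq /= qr]; exists (phi (chart_at p) q); last exact: phiK.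
  by move=> a; exact: ltW.
move=> k; case: asboolP => [fin|_]; first by split => //; exact: open_borel.
by split; [exact: measurable0|rewrite measure0].
Qed.

End ManifoldVolume.

(** * Recovering point values from test functions *)

Section Average.
Context {d : measure_display} {T : measurableType d} {R : realType}.
Variable mu : {measure set T -> \bar R}.

Lemma weighted_average_close (b g : T -> R) (a e : R) :
  mu.-integrable setT (EFin \o b) -> (forall x, 0 <= b x) ->
  0 < \int[mu]_x b x -> measurable_fun setT g ->
  (forall x, b x != 0 -> `|g x - a| <= e) ->
  `|\int[mu]_x ((\int[mu]_x b x)^-1 * b x * g x) - a| <= e.
Proof.
move=> ib b0; set Z := \int[mu]_x b x => Z0 mg ba.
have mb : measurable_fun setT b by apply/measurable_EFinP; case/integrableP: ib.
have bd x : `|b x * (g x - a)| <= e * b x.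
  rewrite normrM (ger0_norm (b0 x)) mulrC.
  by have [->|/ba ?] := eqVneq (b x) 0; [rewrite !mulr0|rewrite ler_wpM2r].
have ieb : mu.-integrable setT (EFin \o (fun x => e * b x)).
  by rewrite (_ : _ \o _ = (fun x => e%:E * (EFin \o b) x)%E) //; exact: integrableZl.
have iab : mu.-integrable setT (EFin \o (fun x => a * b x)).
  by rewrite (_ : _ \o _ = (fun x => a%:E * (EFin \o b) x)%E) //; exact: integrableZl.
have ibg : mu.-integrable setT (EFin \o (fun x => b x * (g x - a))).
  apply: le_integrable ieb => //.
    by apply/measurable_EFinP; apply: measurable_funM => //; exact: measurable_funB.
  move=> x _; rewrite /= lee_fin (le_trans (bd x))//; exact: ler_norm.
have Zg : \int[mu]_x (b x * (g x - a)) <= e * Z.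
  rewrite -RintegralZl//; apply: le_Rintegral => // x _.
  exact: le_trans (ler_norm _) (bd x).
have ZgN : - (e * Z) <= \int[mu]_x (b x * (g x - a)).
  rewrite -mulNr -RintegralZl//; apply: le_Rintegral => //.
    rewrite (_ : _ \o _ = (fun x => (- e)%:E * (EFin \o b) x)%E) //; exact: integrableZl.
  by move=> x _; have := bd x; rewrite ler_norml mulNr => /andP[].
have -> : \int[mu]_x (Z^-1 * b x * g x) = Z^-1 * \int[mu]_x (b x * (g x - a)) + a.
  transitivity (Z^-1 * (\int[mu]_x (b x * (g x - a)) + \int[mu]_x (a * b x))).
    rewrite -RintegralD// -RintegralZl//; last first.
      rewrite (_ : _ \o _ = ((EFin \o (fun x => b x * (g x - a))%R) \+
        (EFin \o (fun x => a * b x)%R))%E)//; exact: integrableD.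
    by apply: eq_Rintegral => x _; ring.
  by rewrite RintegralZl// -/Z mulrDr mulrCA mulVf ?gt_eqF// mulr1.
rewrite addrK normrM gtr0_norm ?invr_gt0// mulrC ler_pdivrMr// ler_norml.
by rewrite Zg ZgN.
Qed.

End Average.

Section PointValues.
Context {R : realType} {n : nat} (M : riemannian_manifold R n).
Implicit Types (i : chart M) (p : M) (e : R).

Lemma test_function_continuous (u : M -> R) : test_function u -> continuous u.
Proof.
move=> [su _] p; set i := chart_at p; have ip : dom i p := chart_atP p.
have iP : cod i (phi i p) by exists p.
have [cu _] := su i [::] _ iP.
have c' : {for p, continuous ((u \o psi i) \o phi i)}.
  by apply: continuous_comp; [exact: phi_continuous|exact: cu].
have E : \forall q \near p, ((u \o psi i) \o phi i) q = u q.
  by apply: filterS (open_nbhs_nbhs (conj (dom_open i) ip)) => q iq /=; rewrite phiK.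
rewrite /prop_for /continuous_at /= phiK// in c'.
apply: cvg_trans c'; exact: near_eq_cvg.
Qed.

Lemma bump_le1 i x e p : smooth_bump i x e p <= 1.
Proof.
rewrite /smooth_bump; case: ifP => // _; apply: prodr_ile1 => a _; rewrite flat_ge0/=.
rewrite /flat; case: ifP => // y0; rewrite hornerC mul1r -expR0 ler_expR.
by rewrite oppr_le0 invr_ge0 ltW.
Qed.

(** On the box of half the size, [e^2 - y^2 >= 3/4 e^2] for each coordinate [y]. *)
Lemma bump_ge i p q e : 0 < e -> dom i q -> box (phi i p) (e / 2) (phi i q) ->
  expR (- (3 / 4 * e ^+ 2)^-1) ^+ n <= smooth_bump i (phi i p) e q.
Proof.
move=> e0 iq Bq; rewrite /smooth_bump ifT; last exact/asboolP.
rewrite -[n in X in X <= _](card_ord n) -prodr_const; apply: ler_prod => a _.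
rewrite expR_ge0/=.
have y0 : 0 < 3 / 4 * e ^+ 2 by rewrite mulr_gt0// ?exprn_gt0// divr_gt0.
have y1 : 3 / 4 * e ^+ 2 <= e ^+ 2 - (phi i q 0 a - phi i p 0 a) ^+ 2.
  have : `|phi i q 0 a - phi i p 0 a| ^+ 2 <= (e / 2) ^+ 2.
    by rewrite lerXn2r ?nnegrE// ?divr_ge0// ltW.
  by rewrite real_normK ?num_real//; lra.
rewrite /flat (lt_le_trans y0 y1) hornerC mul1r ler_expR lerN2 lef_pV2 ?posrE//.
exact: lt_le_trans y1.
Qed.

Variables (vol : {measure set (borel M) -> \bar R}) (hvol : is_volume_measure vol).

Lemma bump_integral i p : dom i p -> exists2 r, 0 < r & forall e, 0 < e <= r ->
  [/\ test_function (smooth_bump i (phi i p) e),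
    vol.-integrable setT (EFin \o (smooth_bump i (phi i p) e : borel M -> R)) &
    0 < \int[vol]_x (smooth_bump i (phi i p) e : borel M -> R) x].
Proof.
move=> ip; have [r r0 vb] := volume_box hvol ip; exists r => // e /andP[e0 er].
have [Bi /andP[_ Kfin]] : box (phi i p) e `<=` cod i /\
    (0 < vol (psi i @` box (phi i p) e) < +oo)%E by apply: vb; rewrite e0.
have [B'i /andP[K'0 K'fin]] : box (phi i p) (e / 2) `<=` cod i /\
    (0 < vol (psi i @` box (phi i p) (e / 2)) < +oo)%E.
  apply: vb; rewrite divr_gt0//= (le_trans _ er)// ler_pdivrMr// ler_pMr//.
  by rewrite ler1n.
have tb := bump_test_function (ltW e0) Bi.
have mK := compact_borel (bump_support_compact Bi).
have mK' := compact_borel (bump_support_compact B'i).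
set K := psi i @` _ in mK Kfin; set K' := psi i @` _ in mK' K'0 K'fin.
set b := smooth_bump _ _ _ in tb *.
have mb : measurable_fun setT (b : borel M -> R).
  by apply: continuous_borel; exact: test_function_continuous.
have bfin : (\int[vol]_(x in (setT : set (borel M))) (b x)%:E < +oo)%E.
  apply: (@le_lt_trans _ _ (\int[vol]_(x in (setT : set (borel M))) (\1_K x)%:E)%E).
    apply: ge0_le_lower_integral => x _; rewrite lee_fin; first exact: bump_ge0.
    rewrite indicE; have [_|xK] := boolP (x \in K); first exact: bump_le1.
    have [->//|bx] := eqVneq (b x) 0.
    have [Kx _] := bump_support (ltW e0) Bi bx.
    by move/negP: xK; rewrite inE.
  by rewrite integral_indic// setIT.
have ib : vol.-integrable setT (EFin \o (b : borel M -> R)).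
  apply/integrableP; split; first exact/measurable_EFinP.
  apply: le_lt_trans bfin; apply: ge0_le_lower_integral => x _ //=.
  by rewrite lee_fin ger0_norm// bump_ge0.
split => //; rewrite /Rintegral fine_gt0//; apply/andP; split => //.
set c := expR (- (3 / 4 * e ^+ 2)^-1) ^+ n.
have lo : (\int[vol]_(x in (K' : set (borel M))) c%:E <=
    \int[vol]_(x in (setT : set (borel M))) (b x)%:E)%E.
  rewrite integral_mkcond; apply: ge0_le_lower_integral => x _; rewrite patchE.
    by case: ifP => // _; rewrite lee_fin exprn_ge0// expR_ge0.
  case: ifPn => [|_]; last by rewrite lee_fin bump_ge0.
  rewrite inE => -[y By <-]; have [iy yy] := psiK (B'i _ By).
  by rewrite lee_fin; apply: bump_ge => //; rewrite yy.
apply: lt_le_trans lo.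
by rewrite integral_cst// mule_gt0// lte_fin exprn_gt0// expR_gt0.
Qed.

(** Normalised bumps on shrinking boxes around [p]. *)
Lemma dirac_sequence p : exists u : nat -> M -> R,
  (forall k, test_function (u k)) /\
  forall f : M -> R, continuous f ->
    (\int[vol]_(x in (setT : set (borel M))) (u k x * f x))%R @[k --> \oo] --> f p.
Proof.
have ip := chart_atP p; set i := chart_at p in ip.
have [r r0 br] := bump_integral ip.
have [r' /andP[r'0 r'r] Bi] := box_cod ip r0.
pose e k := r' / k.+1%:R.
have e0 k : 0 < e k by rewrite divr_gt0.
have er' k : e k <= r' by rewrite ler_pdivrMr// ler_pMr// ler1n.
have er k : 0 < e k <= r by rewrite e0 (le_trans (er' k)).
pose b k : borel M -> R := smooth_bump i (phi i p) (e k).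
exists (fun k x => (\int[vol]_x b k x)^-1 * b k x); split.
  by move=> k; apply: test_functionZ; have [] := br _ (er k).
move=> f cf; apply/cvgrPdist_le => eps eps0.
have fp : {for phi i p, continuous (f \o psi i)}.
  apply: continuous_comp; last exact: cf.
  by apply: psi_continuous; exists p.
have /nbhs_ballP[s/= s0 sB] :
    nbhs (phi i p) [set y | `|f (psi i (phi i p)) - f (psi i y)| <= eps].
  by move/cvgrPdist_le : fp => /(_ _ eps0).
have ecv : e k @[k --> \oo] --> (0 : R).
  have := cvgM (cvg_cst r') (@cvg_harmonic R); rewrite mulr0; exact.
have : \forall k \near \oo, e k < s.
  by move/cvgrPdist_lt : ecv => /(_ _ s0); apply: filterS => k;
    rewrite sub0r normrN gtr0_norm.
apply: filterS => k ks; rewrite distrC.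
have [_ ib Z0] := br _ (er k).
apply: weighted_average_close => //.
- by move=> x; exact: bump_ge0.
- exact: continuous_borel.
- move=> x bx.
  have [|[y By yx] ix] := bump_support (ltW (e0 k)) _ bx.
    by move=> y By; apply: Bi => a; exact: le_trans (By a) (er' k).
  rewrite -yx distrC -[f p](congr1 f (phiK ip)); apply: sB.
  rewrite /ball/=; split => // a c; rewrite (ord1 a).
  by rewrite /ball/= distrC (le_lt_trans (By c)).
Qed.

End PointValues.

(** * The field at a point is Gaussian *)

Section Field.
Context {R : realType} {n : nat} (M : riemannian_manifold R n).
Variables (vol : {measure set (borel M) -> \bar R}) (m s : R).
Context {d : measure_display} {Omega : measurableType d} (P : probability Omega R).
Variable H : Omega -> (M -> R) -> R.
Hypothesis hH : is_FGF vol P s m H.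

Lemma distributionZ (T : (M -> R) -> R) (a : R) (u : M -> R) :
  Defs.distribution T -> test_function u -> T (fun x => a * u x) = a * T u.
Proof.
move=> [linT _] tu; have t0 := @test_function0 R n M.
have T0 : T (fun=> 0) = 0.
  have E0 : (fun _ : M => 1 * 0 + 0 : R) = fun=> 0 by rewrite mul1r addr0.
  have := linT 1 _ _ t0 t0; rewrite E0 mul1r.
  by move/eqP; rewrite -subr_eq0 opprD addrA subrr sub0r oppr_eq0 => /eqP.
have := linT a _ _ tu t0; rewrite T0 addr0 => <-.
by congr T; apply/funext => x; rewrite addr0.
Qed.

(** All multiples of [u] are tested at once: the characteristic functional at [t u]
    is Gaussian in [t] because the norm of [A_m^(-s/2) (t u)] is homogeneous. *)
Lemma FGF_characteristic (u : M -> R) : test_function u -> exists q, forall t, t != 0 ->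
  \int[P]_w cos (t * H w u) = expR (- (t ^+ 2 * q / 2)) /\
  \int[P]_w sin (t * H w u) = 0.
Proof.
have [dH mH cH] := hH; move=> tu; have [v uv _] := cH _ tu.
exists (L2_inner vol v v) => t t0.
have [v' uv' [ct st]] := cH _ (test_functionZ t tu).
have E f : \int[P]_w f (t * H w u) = \int[P]_w f (H w (fun x => t * u x)) :> R.
  by apply: eq_Rintegral => w _; rewrite distributionZ.
rewrite !E ct st; split => //; congr (expR (- _)).
have v'2 : in_L2 vol v' by have [? _ []] := uv'.
rewrite (_ : fine _ ^+ 2 = L2_inner vol v' v'); last exact: sqr_Lnorm2 v'2.
by rewrite (A_power_norm_homogeneous t0 uv uv') mulrC.
Qed.

Hypothesis hvol : is_volume_measure vol.
Variable h : Omega -> M -> R.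
Hypothesis hh : continuous_representative vol P H h.

(** The field is set to 0 on the null set where it fails to be continuous.  At a point
    [x] it is then the limit of the Gaussian variables given by a sequence of test
    functions concentrating at [x]. *)
Lemma continuous_version : exists (N : set Omega) (h' : Omega -> M -> R),
  [/\ measurable N /\ P N = 0, forall w, continuous (h' w),
    forall w, ~ N w -> h w = h' w &
    forall x, measurable_fun setT (h' ^~ x) /\ exists q, [/\ 0 <= q,
      forall t, \int[P]_w cos (t * h' w x) = expR (- (t ^+ 2 * q / 2)) &
      forall t, \int[P]_w sin (t * h' w x) = 0]].
Proof.
have [N [mN N0 hN]] := hh.
have {}hN w : ~ N w -> continuous (h w) /\ forall u, test_function u ->
    H w u = (\int[vol]_(x in (setT : set (borel M))) (u x * h w x))%R.
  by move=> Nw; apply: contrapT => /hN.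
pose h' w x := if `[< N w >] then 0 else h w x.
have h'E w x : ~ N w -> h' w x = h w x by move=> Nw; rewrite /h' ifF//; apply/asboolPn.
exists N, h'; split => //.
- move=> w x; rewrite /h'; case: asboolP => [_|/hN[ch _]]; last exact: ch.
  exact: cst_continuous.
- by move=> w Nw; apply/funext => x; rewrite h'E.
move=> x; have [u [tu ux]] := dirac_sequence hvol x.
pose X k w : R := if `[< N w >] then 0 else H w (u k).
have [dH mH cH] := hH.
have mX k : measurable_fun setT (X k).
  rewrite (_ : X k = (fun w => H w (u k)) \_ (~` N)).
    apply/(measurable_restrictT _ (measurableC mN)); apply: measurable_funS (mH _ (tu k)) => //.
  apply/funext => w; rewrite /X patchE in_setC.
  by case: asboolP => Nw; [rewrite mem_set|rewrite memNset].
have Xlim w : X k w @[k --> \oo] --> h' w x.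
  rewrite /X /h'; case: asboolP => [_|/hN[ch Hh]]; first exact: cvg_cst.
  rewrite (_ : (fun k => H w (u k)) = fun k =>
    (\int[vol]_(x in (setT : set (borel M))) (u k x * h w x))%R); first exact: ux.
  by apply/funext => k; rewrite Hh.
split; first by apply: (@measurable_realfun.measurable_fun_cvg _ _ _ _ X) => // w _; exact: Xlim.
have /choice[q qP] k := FGF_characteristic (tu k).
have XE f k : continuous f -> \int[P]_w f (X k w) = \int[P]_w f (H w (u k)) :> R.
  move=> cf; have mf := continuous_measurable_fun cf.
  rewrite /Rintegral; congr fine; apply: ae_eq_integral => //.
  - by apply/measurable_EFinP; exact: (measurableT_comp mf (mX k)).
  - by apply/measurable_EFinP; exact: (measurableT_comp mf (mH _ (tu k))).
  - exists N; split => // w; apply: contra_notP => Nw _.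
    by rewrite /X /= ifF//; exact/asboolPn.
have cM t : continuous (fun y : R => t * y).
  by move=> y; apply: cvgM; [exact: cvg_cst|exact: cvg_id].
apply: (gaussian_limit (Xk := X) (qk := q)) => // k t t0.
  rewrite (XE (fun y => cos (t * y))); first by have [] := qP k t t0.
  by move=> y; apply: continuous_comp; [exact: cM|exact: continuous_cos].
rewrite (XE (fun y => sin (t * y))); first by have [] := qP k t t0.
by move=> y; apply: continuous_comp; [exact: cM|exact: continuous_sin].
Qed.

End Field.

(** * Tonelli and the expected volume and length *)

Section SigmaFiniteVersion.
Context d (T : measurableType d) (R : realType) (mu : {measure set T -> \bar R}).
Hypothesis smu : sigma_finite setT mu.

(** Records the hypothesis [smu] so that the bundled structure can be inferred. *)
Definition sigma_finite_version : set T -> \bar R := let _ := smu in mu.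

Let version0 : sigma_finite_version set0 = 0%E.
Proof. exact: measure0. Qed.

Let version_ge0 A : (0 <= sigma_finite_version A)%E.
Proof. exact: measure_ge0. Qed.

Let version_sigma_additive : semi_sigma_additive sigma_finite_version.
Proof. exact: measure_semi_sigma_additive. Qed.

HB.instance Definition _ := isMeasure.Build _ _ _ sigma_finite_version
  version0 version_ge0 version_sigma_additive.

HB.instance Definition _ :=
  Measure_isSigmaFinite.Build _ _ _ sigma_finite_version smu.

End SigmaFiniteVersion.

Section Tonelli.
Context d1 d2 (T1 : measurableType d1) (T2 : measurableType d2) (R : realType).
Variable P : probability T1 R.
Variable mu : {measure set T2 -> \bar R}.
Hypothesis smu : sigma_finite setT mu.
Variable F : T1 * T2 -> R.
Hypothesis mF : measurable_fun setT F.
Hypothesis F0 : forall z, 0 <= F z.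

Lemma tonelli_on (A : set T2) : measurable A ->
  (\int[P]_w \int[mu]_(x in A) (F (w, x))%:E = \int[mu]_(x in A) \int[P]_w (F (w, x))%:E)%E.
Proof.
move=> mA.
pose mu' : {sigma_finite_measure set T2 -> \bar R} := sigma_finite_version smu.
pose G (z : T1 * T2) : \bar R := (F z * \1_A z.2)%:E.
have mG : measurable_fun setT G.
  apply/measurable_EFinP; apply: measurable_funM => //.
  apply: (measurableT_comp _ measurable_snd); exact: measurable_indic.
have G0 z : (0 <= G z)%E by rewrite lee_fin mulr_ge0.
have E1 w : (\int[mu']_x G (w, x) = \int[mu]_(x in A) (F (w, x))%:E)%E.
  rewrite [RHS]integral_mkcond; apply: eq_integral => x _.
  by rewrite patchE /G/= indicE; case: ifP => _; rewrite ?mulr1// mulr0.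
transitivity (\int[P]_w \int[mu']_x G (w, x))%E; first exact: eq_integral.
rewrite (@fubini_tonelli _ _ T1 T2 R P mu' G mG G0).
rewrite [RHS]integral_mkcond; apply: eq_integral => x _.
rewrite patchE /G/= indicE; case: ifP => _.
  by apply: eq_integral => w _; rewrite mulr1.
by under eq_integral do rewrite mulr0; rewrite integral0.
Qed.

Lemma tonelli_measurable : measurable_fun setT (fun x => \int[P]_w (F (w, x))%:E)%E.
Proof.
apply: (@measurable_fun_fubini_tonelli_G _ _ T1 T2 R P (fun z => (F z)%:E)).
  exact/measurable_EFinP.
by move=> z; rewrite lee_fin.
Qed.

End Tonelli.

Section JointMeasurability.
Context {R : realType} {n : nat} (M : riemannian_manifold R n).
Context {d : measure_display} {Omega : measurableType d}.

(** [f w x > a] holds iff [f w] is at least some rational [r > a] on a basic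
    neighbourhood of [x]; by continuity it is enough to check this at one chosen point
    of each basic subset of that neighbourhood. *)
Lemma continuous_jointly_measurable (f : Omega -> M -> R) :
  (forall w, continuous (f w)) -> (forall x, measurable_fun setT (f ^~ x)) ->
  measurable_fun setT (fun z : Omega * borel M => f z.1 z.2).
Proof.
move=> cf mf; have [B oB nB] := countable_basis M.
pose D k := xget point (B k).
have DB k : B k !=set0 -> B k (D k) by move=> [x Bx]; apply: xgetPex; exists x.
apply: (measurability _ (RGenOInfty.measurableE R)).
move=> _ [_ [a ->] <-]; rewrite setTI.
pose S k (r : rat) : set Omega := \bigcap_j [set w | B j `<=` B k -> B j !=set0 ->
   ratr r <= f w (D j)].
pose V k (r : rat) : set (Omega * borel M) :=
  if `[< a < ratr r >] then S k r `*` (B k : set (borel M)) else set0.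
rewrite (_ : _ @^-1` _ = \bigcup_k \bigcup_r V k r); last first.
  apply/seteqP; split => -[w x]/=; last first.
    move=> [k _ [r _]]; rewrite /V; case: asboolP => // ar [/= Sw Bx].
    rewrite in_itv/= andbT; apply: (lt_le_trans ar); rewrite leNgt; apply/negP => fr.
    have nU : nbhs x (B k `&` f w @^-1` [set y | y < ratr r]).
      apply: filterI; first exact: (open_nbhs_nbhs (conj (oB k) Bx)).
      by apply: cf; apply: lt_nbhsl.
    have [j [Bjx BjU]] := nB _ _ nU.
    have Bj0 : B j !=set0 by exists x.
    have := Sw j Logic.I (fun y By => (BjU y By).1) Bj0; rewrite leNgt => /negP; apply.
    by have [] := BjU _ (DB _ Bj0).
  rewrite in_itv/= andbT => afx.
  have [r /andP[ar rf]] := rat_in_itvoo afx.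
  have nU : nbhs x (f w @^-1` [set y | ratr r < y]).
    by apply: cf; apply: lt_nbhsr.
  have [k [Bkx BkU]] := nB _ _ nU.
  exists k => //; exists r => //; rewrite /V ifT; last exact/asboolP.
  split => //= j _ Bjk Bj0; apply: ltW; apply: BkU; apply: Bjk; exact: DB.
apply: bigcupT_measurable => k; apply: bigcupT_measurable_rat => r; rewrite /V.
case: asboolP => // _; apply: measurableX; last exact: open_borel.
apply: bigcapT_measurable => j.
have [jk|jk] := pselect (B j `<=` B k /\ B j !=set0).
  rewrite (_ : [set w | _] = [set w | ratr r <= f w (D j)]); last first.
    by case: jk => j1 j2; apply/seteqP; split => w /=; [apply|].
  exact: measurable_superlevel.
rewrite (_ : [set w | _] = setT); first exact: measurableT.
by apply/seteqP; split => // w _ /= j1 j2; case: jk.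
Qed.

End JointMeasurability.

Section Curve.
Context {R : realType} {n : nat} (M : riemannian_manifold R n).

(** Precomposition with [clamp] extends a curve on [[0, 1]] continuously to the line. *)
Definition clamp (r : R) : R := Num.max 0 (Num.min 1 r).

Lemma clamp_itv r : 0 <= clamp r <= 1.
Proof. by rewrite /clamp le_max lexx/= ge_max ler01 ge_min lexx. Qed.

Lemma clamp_id r : 0 <= r <= 1 -> clamp r = r.
Proof. by move=> /andP[r0 r1]; rewrite /clamp min_r// max_r. Qed.

Lemma clamp_continuous : continuous clamp.
Proof.
move=> x; apply: (@continuous_max R R (fun=> 0) (fun r => Num.min 1 r)).
  exact: cst_continuous.
apply: (@continuous_min R R (fun=> 1) id); first exact: cst_continuous.
exact: cvg_id.
Qed.

Lemma curve_measurable (gamma : R -> M) : {within `[0, 1], continuous gamma} ->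
  measurable_fun setT (gamma \o clamp : measurableTypeR R -> borel M).
Proof.
move=> /subspace_continuousP cg.
have cgc : continuous (gamma \o clamp).
  move=> r; have cr : `[0, 1]%classic (clamp r) by rewrite /= in_itv/= clamp_itv.
  apply: cvg_trans (cg _ cr) => U nU.
  have nW : nbhs (clamp r) [set y | `[0, 1]%classic y -> U (gamma y)] by exact: nU.
  have W : nbhs r (clamp @^-1` [set y | `[0, 1]%classic y -> U (gamma y)]).
    exact: clamp_continuous nW.
  suff : nbhs r [set y | U (gamma (clamp y))] by [].
  by apply: filterS W => y; apply; rewrite /= in_itv/= clamp_itv.
apply: (@measurability _ _ (measurableTypeR R) (borel M) setT (gamma \o clamp) (@open M)) => //.
move=> _ [V oV <-]; rewrite setTI; apply: open_measurable.
by move/continuousP : cgc; exact.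
Qed.

End Curve.

Theorem proposition1p4 (R : realType) (n : nat) (M : riemannian_manifold R n)
    (hconn : connected [set: M]) (hcomplete : complete_manifold M)
    (hgeom : bounded_geometry M)
    (vol : {measure set (borel M) -> \bar R}) (hvol : is_volume_measure vol)
    (m s : R) (hm : 0 < m) (hs : n%:R / 2 < s)
    (d : measure_display) (Omega : measurableType d) (P : probability Omega R)
    (H : Omega -> (M -> R) -> R) (hH : is_FGF vol P s m H)
    (h : Omega -> M -> R) (hh : continuous_representative vol P H h) :
  let theta : M -> R := fun x => fine ('E_P[(fun w => h w x ^+ 2)%R])%E in
  [/\ forall x : M, ('E_P[(fun w => h w x ^+ 2)%R] = (theta x)%:E)%E /\ 0 <= theta x,
      forall A : set M, measurable (A : set (borel M)) ->
        ((\int[P]_w conformal_volume vol (h w) A)%E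
          = conformal_volume vol (fun x => n%:R * theta x / 2)%R A) /\
        (vol A <= conformal_volume vol (fun x => n%:R * theta x / 2)%R A)%E &
      forall gamma : R -> M, abs_continuous_curve gamma ->
        ((\int[P]_w conformal_length (h w) gamma)%E
          = conformal_length (fun x => theta x / 2)%R gamma) /\
        (curve_length gamma <= conformal_length (fun x => theta x / 2)%R gamma)%E].
Proof.
move=> theta.
(* [h'] is the continuous version, equal to [h] off the null set [N]; its variance at
   [x] is [q x] *)
have [N [h' [[mN N0] ch' hE hg]]] := continuous_version hH hvol hh.
have mh x : measurable_fun setT (h' ^~ x) by have [] := hg x.
have /choice[q qP] x := (hg x).2.
have Eh x : ('E_P[(fun w => h w x ^+ 2)%R] = (q x)%:E)%E.
  have [q0 cq sq] := qP x; rewrite unlock.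
  rewrite -(gaussian_variance (mh x) cq).
  apply: (negligible_lower_integral mN N0) => w _; rewrite ?lee_fin ?sqr_ge0//.
  by move=> /hE ->.
have thE x : theta x = q x by rewrite /theta Eh.
have th0 x : 0 <= theta x by rewrite thE; have [] := qP x.
have Eexp a x : (\int[P]_w (expR (a * h' w x))%:E = (expR (a ^+ 2 * theta x / 2))%:E)%E.
  have [q0 cq sq] := qP x; rewrite thE; apply: gaussian_exp_mean.
  - exact: measurable_funM.
  - by rewrite mulr_ge0// sqr_ge0.
  - move=> t; under eq_Rintegral do rewrite mulrA.
    by rewrite cq exprMn mulrA.
  - by move=> t; under eq_Rintegral do rewrite mulrA.
have jm := continuous_jointly_measurable ch' mh.
split=> [x|A mA|gamma acg].
- by rewrite Eh thE; split => //; rewrite -thE.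
- pose F (z : Omega * borel M) := expR (n%:R * h' z.1 z.2).
  have mF : measurable_fun setT F.
    by apply: measurableT_comp => //; exact: measurable_funM.
  have F0 z : 0 <= F z by exact: expR_ge0.
  split; last first.
    rewrite -[leLHS]mul1e -(integral_cst _ mA); apply: ge0_le_lower_integral => x _ //.
    by rewrite lee_fin -expR0 ler_expR mulr_ge0// divr_ge0// mulr_ge0.
  transitivity (\int[P]_w \int[vol]_(x in (A : set (borel M))) (F (w, x))%:E)%E.
    apply: (negligible_lower_integral mN N0) => w _.
    - by apply: integral_ge0 => x _; rewrite lee_fin expR_ge0.
    - by apply: integral_ge0 => x _; rewrite lee_fin expR_ge0.
    - by move=> Nw; rewrite /conformal_volume hE.
  rewrite (tonelli_on P (volume_sigma_finite hvol) mF F0 mA).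
  apply: eq_integral => x _; rewrite /F/= Eexp; congr (expR _)%:E.
  by rewrite expr2 -!mulrA.
- have [cg _] := acg.
  pose I : set (measurableTypeR R) := `[0%R, 1%R]%classic.
  have mI : measurable I by exact: measurable_itv.
  have Ifin : (@lebesgue_measure R I < +oo)%E.
    by rewrite /I lebesgue_measure_itv/= lte_fin ltr01 -EFinB ltry.
  have sp0 r : 0 <= speed gamma r by rewrite /speed; case: ifP => // _; exact: sqrtr_ge0.
  (* [G] is a measurable substitute for the speed, as Tonelli asks for measurability *)
  have [G [mG G0 GE]] := lower_integralM_minorant mI Ifin (fun r _ => sp0 r).
  have cl r : I r -> gamma r = (gamma \o clamp) r.
    by rewrite /I/= in_itv/= => Ir; rewrite clamp_id.
  have mgc := curve_measurable cg.
  pose F (z : Omega * measurableTypeR R) := expR (h' z.1 (gamma (clamp z.2))).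
  have mF : measurable_fun setT F.
    apply: measurableT_comp => //.
    apply: (@measurableT_comp _ _ _ _ _ _ (fun z : Omega * borel M => h' z.1 z.2) _
      (fun z : Omega * measurableTypeR R => (z.1, (gamma \o clamp) z.2 : borel M))) => //.
    apply: measurable_fun_pair; first exact: measurable_fst.
    exact: (measurableT_comp mgc measurable_snd).
  have FE r : (\int[P]_w (F (w, r))%:E = (expR (theta (gamma (clamp r)) / 2))%:E)%E.
    have := Eexp 1 (gamma (clamp r)); rewrite expr1n mul1r => <-.
    by apply: eq_integral => w _; rewrite mul1r.
  (* extended by 0, for measurability on the whole line *)
  pose G' : measurableTypeR R -> R := G \_ I.
  have mG' : measurable_fun setT G' by exact/(measurable_restrictT _ mI).
  have G'0 r : 0 <= G' r by rewrite /G' patchE; case: ifPn => // /set_mem; exact: G0.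
  have G'E r : I r -> G' r = G r by move=> Ir; rewrite /G' patchE mem_set.
  pose FG (z : Omega * measurableTypeR R) := F z * G' z.2.
  have mFG : measurable_fun setT FG.
    by apply: measurable_funM => //; exact: (measurableT_comp mG' measurable_snd).
  have FG0 z : 0 <= FG z by rewrite mulr_ge0// expR_ge0.
  split; last first.
    apply: ge0_le_lower_integral => r _; rewrite lee_fin// ler_peMl//.
    by rewrite -expR0 ler_expR divr_ge0.
  transitivity (\int[P]_w \int[lebesgue_measure]_(r in I) (FG (w, r))%:E)%E.
    apply: (negligible_lower_integral mN N0) => w _.
    - by apply: integral_ge0 => r _; rewrite lee_fin mulr_ge0// expR_ge0.
    - by apply: integral_ge0 => r _; rewrite lee_fin.
    - move=> Nw; rewrite /conformal_length hE//.
      transitivity (\int[lebesgue_measure]_(r in I) (F (w, r) * speed gamma r)%:E)%E.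
        by apply: eq_integral => r /set_mem /cl Ir; rewrite /F/= -[gamma (clamp r)]Ir.
      rewrite (GE (fun r => F (w, r))).
      + by apply: eq_integral => r /set_mem Ir; rewrite /FG/= G'E.
      + apply: measurable_funS (_ : measurable_fun setT _) => //.
        exact: (measurableT_comp mF (pair1_measurable w)).
      + by move=> r _; exact: expR_gt0.
  rewrite (tonelli_on P (sigma_finiteT _) mFG FG0 mI).
  transitivity (\int[lebesgue_measure]_(r in I)
      (expR (theta (gamma (clamp r)) / 2) * G r)%:E)%E.
    apply: eq_integral => r /set_mem Ir; rewrite /FG.
    have mFr : measurable_fun setT (fun w => (F (w, r))%:E).
      by apply/measurable_EFinP; exact: (measurableT_comp mF (pair2_measurable r)).
    transitivity (\int[P]_w ((G' r)%:E * (F (w, r))%:E))%E.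
      by apply: eq_integral => w _; rewrite -EFinM mulrC.
    transitivity ((G' r)%:E * \int[P]_w (F (w, r))%:E)%E.
      by apply: ge0_integralZl_EFin => // w _; rewrite lee_fin expR_ge0.
    by rewrite FE -EFinM mulrC G'E.
  rewrite -(GE (fun r => expR (theta (gamma (clamp r)) / 2))); last 2 first.
  - have mT := tonelli_measurable P mF (fun z => expR_ge0 _).
    have {}mT : measurable_fun setT
        (fun r : measurableTypeR R => (expR (theta (gamma (clamp r)) / 2))%:E).
      by rewrite (_ : (fun r => _) = (fun r => \int[P]_w (F (w, r))%:E)%E)//;
        apply/funext => r; rewrite FE.
    by apply/measurable_EFinP; exact: measurable_funS mT.
  - by move=> r _; exact: expR_gt0.
  by apply: eq_integral => r /set_mem /cl Ir; rewrite -[gamma (clamp r)]Ir.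
Qed.
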